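(* Suppose $(X,f)$ is topologically Anosov and transitive. Then $(X,f)$ satisfies the 'multi-horseshoe' dense property.
   Context: $(X,d)$ is a compact metric space, $f:X\to X$ continuous. $\mathcal{M}(X)$ is the set of Borel probability measures, $\mathcal{M}_f(X)$ the $f$-invariant ones, with weak* metric $\rho(\xi,\tau)=\sum_{j\ge1}\frac{|\int\varphi_j d\xi-\int\varphi_j d\tau|}{2^j\|\varphi_j\|}$, $\{\varphi_j\}$ a fixed dense sequence in $C(X)$. For $\Lambda\subset X$ compact with $f(\Lambda)=\Lambda$, $\mathcal{M}_f(\Lambda)$ is the set of invariant measures supported on $\Lambda$. $h_\mu(f)$ is metric entropy and $h_{top}(f,\Lambda)$ topological entropy of $f$ on $\Lambda$. $(X,f)$ is transitive if for all non-empty open $U,V$ there is an integer $n$ with $f^n(U)\cap V\ne\emptyset$. $(X,f)$ is topologically Anosov if $f$ is a homeomorphism, $X$ has infinitely many points, $(X,f)$ is expansive (there is $c>0$ such that for any $x\ne y$, $d(f^i(x),f^i(y))>c$ for some $i\in\mathbb{Z}$) and has the shadowing property (for any $\varepsilon>0$ there is $\delta>0$ such that for each sequence $\{x_n\}_{n\in\mathbb{Z}}$ with $d(f(x_n),x_{n+1})<\delta$ for all $n$ there is $y\in X$ with $d(f^n(y),x_n)<\varepsilon$ for all $n\in\mathbb{Z}$). $d_H(A,B)=\max\{\sup_{\mu\in A}\inf_{\nu\in B}\rho(\mu,\nu),\sup_{\nu\in B}\inf_{\mu\in A}\rho(\nu,\mu)\}$ for nonempty $A,B\subset\mathcal{M}(X)$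 (a single measure is identified with a singleton), and $\mathrm{cov}\{\mu_i\}_{i=1}^m=\{\sum_i t_i\mu_i:t_i\in[0,1],\sum_i t_i=1\}$. $(X,f)$ satisfies the 'multi-horseshoe' (entropy-)dense property if for any positive integer $m$, any $\{\mu_i\}_{i=1}^m\subseteq\mathcal{M}_f(X)$, any $x\in X$ and any $\eta,\zeta>0$, there exist compact invariant subsets $\Lambda_i\subseteq\Lambda\subsetneq X$ such that for each $1\le i\le m$: (1) $(\Lambda_i,f)$ and $(\Lambda,f)$ conjugate to transitive two-sided subshifts of finite type (closed shift-invariant subsets of $\{0,\dots,k-1\}^{\mathbb{Z}}$ consisting exactly of the sequences all of whose blocks of some fixed length $N+1$ belong to a prescribed collection); (2) $h_{top}(f,\Lambda_i)>h_{\mu_i}(f)-\eta$; (3) $d_H(K,\mathcal{M}_f(\Lambda))<\zeta$ and $d_H(\mu_i,\mathcal{M}_f(\Lambda_i))<\zeta$, where $K=\mathrm{cov}\{\mu_i\}_{i=1}^m$. Here $(Y,g)$ conjugates to $(Z,h)$ if there is a homeomorphism $\pi:Y\to Z$ with $\pi\circ g=h\circ\pi$.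
   Formalization: Transitivity is taken with an integer n ≥ 0 (for X and for the subshifts); with n allowed to be negative the claim fails for the orbit closure of ...000111... under the shift. *)

(* Defs.v *)
From HB Require Import structures.
From mathcomp Require Import all_boot all_order all_algebra finmap.
From mathcomp Require Import all_classical all_reals all_analysis.

Set Implicit Arguments.
Unset Strict Implicit.
Unset Printing Implicit Defensive.
Import Order.TTheory GRing.Theory Num.Theory.
Import numFieldNormedType.Exports.

Local Open Scope classical_set_scope.
Local Open Scope ring_scope.

(* The library's measurable types are pointed, so a space carrying Borel measures
   must come with a base point; nothing below depends on its choice. *)
#[short(type="pmetricType")]
HB.structure Definition PointedMetric (K : numDomainType) :=
  { M of Metric K M & isPointed M }.

Section Systems.
Context {R : realType} {X : metricType R}.
Implicit Type f : X -> X.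

(* [f^n] for [n] in Z, where [g] plays the role of the inverse of [f]. *)
Definition ziter f (g : X -> X) (n : int) : X -> X :=
  match n with Posz k => iter k f | Negz k => iter k.+1 g end.

Definition homeo_inverse f (g : X -> X) : Prop :=
  [/\ continuous f, continuous g, cancel f g & cancel g f].

Definition expansive f g : Prop :=
  exists2 c : R, 0 < c &
    forall x y : X, x <> y ->
      exists i : int, c < mdist (ziter f g i x) (ziter f g i y).

Definition shadowing f g : Prop :=
  forall e : R, 0 < e -> exists2 d : R, 0 < d &
    forall u : int -> X, (forall n, mdist (f (u n)) (u (n + 1)) < d) ->
      exists y : X, forall n, mdist (ziter f g n y) (u n) < e.

Definition topologically_anosov f : Prop :=
  infinite_set [set: X] /\
  exists g : X -> X, [/\ homeo_inverse f g, expansive f g & shadowing f g].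

(* Topological entropy by Bowen's (n, e)-separated sets. *)

Definition bowen_dist f (n : nat) (x y : X) : R :=
  \big[Num.max/0]_(i < n) mdist (iter i f x) (iter i f y).

Definition bowen_separated f (n : nat) (e : R) (E : set X) : Prop :=
  forall x y, E x -> E y -> x <> y -> e < bowen_dist f n x y.

Definition separated_number f (L : set X) (n : nat) (e : R) : \bar R :=
  ereal_sup [set (#|` E|%fset)%:R%:E | E in
    [set E : {fset X} | [set` E] `<=` L /\ bowen_separated f n e [set` E]]].

Definition htop f (L : set X) : \bar R :=
  lim ((limn_esup (fun n : nat =>
          ((n%:R : R)^-1)%:E * lne (separated_number f L n e))%E)
       @[e --> (0 : R)^'+]).

End Systems.

(* For the relative topology of [A], with [n >= 0]: allowing negative [n] would
   make the orbit closure of ...000111... under the shift transitive. *)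
Definition transitive_on {Y : topologicalType} (A : set Y) (g : Y -> Y) : Prop :=
  forall U V : set Y, open U -> open V -> A `&` U !=set0 -> A `&` V !=set0 ->
    exists n : nat, (iter n g @` (A `&` U)) `&` (A `&` V) !=set0.

Definition conjugate {Y Z : topologicalType}
    (A : set Y) (g : Y -> Y) (B : set Z) (h : Z -> Z) : Prop :=
  exists (p : Y -> Z) (q : Z -> Y),
    [/\ {within A, continuous p} /\ {within B, continuous q},
        set_fun A B p, set_fun B A q,
        (forall y, A y -> q (p y) = y) /\ (forall z, B z -> p (q z) = z)
      & forall y, A y -> p (g y) = h (p y)].

Section Subshifts.
Variable k : nat.

Definition sequence_space : topologicalType :=
  {ptws int -> discrete_topology 'I_k}.

Definition left_shift (u : sequence_space) : sequence_space := fun i : int => u (i + 1).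

Definition block (N : nat) (u : sequence_space) (i : int) : N.-tuple 'I_k :=
  [tuple (u (i + j%:Z) : 'I_k) | j < N].

Definition subshift (S : set sequence_space) : Prop :=
  closed S /\ left_shift @` S = S.

Definition subshift_of_finite_type (S : set sequence_space) : Prop :=
  subshift S /\
  exists (N : nat) (W : {set N.+1.-tuple 'I_k}),
    S = [set u | forall i : int, block N.+1 u i \in W].

End Subshifts.

Definition conjugate_to_transitive_sft {Y : topologicalType}
    (A : set Y) (g : Y -> Y) : Prop :=
  exists (k : nat) (S : set (sequence_space k)),
    [/\ subshift_of_finite_type S, transitive_on S (@left_shift k)
      & conjugate A g S (@left_shift k)].

Notation borel X := (g_sigma_algebraType (@open X)).

Section Measures.
Context {R : realType} {X : pmetricType R}.
Implicit Type f : X -> X.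

Local Notation measures := (probability (borel X) R).

Definition invariant_measure f (mu : measures) : Prop :=
  forall A : set (borel X), measurable A -> mu (f @^-1` A) = mu A.

Definition invariant_measures f (L : set X) : set measures :=
  [set mu | invariant_measure f mu /\ mu L = 1%E].

(* Metric entropy; [xi] is a finite measurable partition, possibly with empty
   atoms. *)

Definition finite_partition (k : nat) (xi : 'I_k -> set X) : Prop :=
  [/\ forall a, measurable (xi a : set (borel X)),
      trivIset setT xi & \bigcup_a xi a = setT].

Definition join_atom f (n k : nat) (xi : 'I_k -> set X)
    (w : {ffun 'I_n -> 'I_k}) : set X :=
  \bigcap_(j : 'I_n) (iter j f @^-1` xi (w j)).

Definition join_entropy (mu : measures) f (n k : nat) (xi : 'I_k -> set X) : R :=
  - \sum_(w : {ffun 'I_n -> 'I_k})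
      (let p := fine (mu (join_atom f xi w)) in p * ln p).

Definition partition_entropy (mu : measures) f (k : nat) (xi : 'I_k -> set X) : R :=
  limn (fun n => join_entropy mu f n xi / n%:R).

Definition metric_entropy (mu : measures) f : \bar R :=
  ereal_sup [set h | exists (k : nat) (xi : 'I_k -> set X),
    finite_partition xi /\ h = (partition_entropy mu f xi)%:E].

Definition sup_norm (g : X -> R) : R := sup [set `|g x| | x in [set: X]].

Definition dense_in_C (phi : nat -> X -> R) : Prop :=
  (forall j, continuous (phi j)) /\
  forall g : X -> R, continuous g -> forall e : R, 0 < e ->
    exists j, sup_norm (fun x => g x - phi j x) < e.

(* [phi] is indexed from 0, whence the weight 2^(j+1). If [phi j] vanishes
   identically, its term is 0 / 0 = 0. *)
Definition weak_dist (phi : nat -> X -> R) (xi tau : measures) : R :=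
  limn (series (fun j =>
    `| \int[xi]_x phi j x - \int[tau]_x phi j x |
      / (2 ^+ j.+1 * sup_norm (phi j)))).

(* Inf and sup are taken in the extended reals, so that the distance from a
   nonempty set to the empty set is +oo. *)
Definition hausdorff_dist (phi : nat -> X -> R) (A B : set measures) : \bar R :=
  maxe
   (ereal_sup [set ereal_inf [set (weak_dist phi mu nu)%:E | nu in B] | mu in A])
   (ereal_sup [set ereal_inf [set (weak_dist phi nu mu)%:E | mu in A] | nu in B]).

Definition cov (m : nat) (mu : 'I_m -> measures) : set measures :=
  [set nu | exists t : 'I_m -> R,
    [/\ forall i, 0 <= t i <= 1, \sum_i t i = 1
      & forall A : set (borel X), measurable A ->
          nu A = (\sum_i (t i)%:E * mu i A)%E]].

Definition compact_invariant f (L : set X) : Prop := compact L /\ f @` L = L.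

(* The conclusion does not depend on the point [x]. *)
Definition multi_horseshoe_dense (phi : nat -> X -> R) f : Prop :=
  forall (m : nat) (mu : 'I_m -> measures) (x : X) (eta zeta : R),
    (0 < m)%N -> (forall i, invariant_measure f (mu i)) -> 0 < eta -> 0 < zeta ->
    exists (Li : 'I_m -> set X) (L : set X),
      [/\ forall i, compact_invariant f (Li i), compact_invariant f L,
          forall i, Li i `<=` L, L `<` setT
        & forall i : 'I_m,
          [/\ conjugate_to_transitive_sft (Li i) f /\
                conjugate_to_transitive_sft L f,
              (metric_entropy (mu i) f - eta%:E < htop f (Li i))%E
            & (hausdorff_dist phi (cov mu) (invariant_measures f L) < zeta%:E)%E /\
              (hausdorff_dist phi [set mu i] (invariant_measures f (Li i))
                 < zeta%:E)%E]].

End Measures.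

(* Main.v *)
(* Expansiveness and shadowing give a periodic point [p] and a point [q] outside its
   orbit that is asymptotic to it in both time directions; the orbit of [q] stays away
   from [q] at all nonzero times. Pseudo-orbits that leave [q], follow the periodic
   orbit for as long as desired and come back to [q] therefore serve as markers.

   Fix a large [n] and a small [e]. An [(n, e)]-separated and spanning family [ys] comes
   with a partition [eta] subordinate to its Bowen balls, and the Shannon entropy of
   [eta] for [mu i] is at least about [n * h_(mu i) f]. Through transitivity each orbit
   segment of length [n] is closed up to a loop at [q], called a block, shorter than
   the marker and of length close to [n]. For each [i] take a word [v i] in the blocks
   whose letter frequencies approximate the [mu i]-masses of the cells of [eta], all
   [v i] giving loops of one common length [l]. A tour is the marker followed by the
   blocks of a permutation of some [v i].

   Free concatenations of tours form a subshift of finite type (the tower over the set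
   of tours). The markers tell where a tour starts and distinct blocks are separated,
   so shadowing codes this subshift injectively into [X]; the image is a horseshoe, and
   it avoids [p]. Every invariant measure on it integrates a test function to a
   convex combination of averages along tours, which are close to the [mu i]-integrals.
   Its topological entropy is at least the logarithm of the number of tours divided by
   [l], and the number of permutations of [v i] is about the exponential of [size (v i)]
   times the Shannon entropy of [eta]. *)
Require Import Defs.
From mathcomp Require Import all_boot all_order all_algebra finmap.
From mathcomp Require Import all_classical all_reals all_analysis measurable_realfun.
From mathcomp Require Import ring lra zify.
Set Implicit Arguments.
Unset Strict Implicit.
Unset Printing Implicit Defensive.
Import Order.TTheory GRing.Theory Num.Theory.
Import numFieldNormedType.Exports.
Local Open Scope classical_set_scope.
Local Open Scope ring_scope.

(** * Compact metric spaces and iterates *)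

(** Transitivity without mixing bounds the length of connections but cannot prescribe it, so blocks
    have unequal lengths and must be readable without a common block length. A tag at the head of
    each block, itself a loop of the marker type, has a length that encodes that of the first
    connection: two blocks then either differ when the shorter tag returns to [q], or run through
    their orbit segments in step. The marker is longer than every block, so outside it a visit to
    [q] is never as far away as the marker is long. The words of one class are permutations of a
    single word, so their tours have equal length and equal averages; multiplying the letter counts
    of each class by the body lengths of the other classes makes the lengths agree across classes.
    Marker, tags and connections lengthen a tour by a factor of at most [1 + kap]. This costs about
    [kap] times the entropy, which is harmless because expansiveness bounds all metric entropies at
    once. *)

Section MetricBasics.
Context {R : realType} {X : metricType R}.
Implicit Types (x y z : X) (r e : R).

Lemma mdist_lt_split x y z r : mdist x y < r / 2 -> mdist y z < r / 2 -> mdist x z < r.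
Proof.
move=> h1 h2; apply: le_lt_trans (metric_triangle x y z) _.
by rewrite [ltRHS]splitr ltrD.
Qed.

Lemma near_mdist x r : 0 < r -> \forall y \near x, mdist x y < r.
Proof. by move=> r0; have := nbhsx_ballx x r r0; rewrite ballEmdist. Qed.

Lemma nbhs_mdist_ex x (P : set X) : nbhs x P ->
  exists2 d, 0 < d & forall y, mdist x y < d -> P y.
Proof. by rewrite -metricType_numDomainType.nbhs_nbhs_mdist => -[d d0 H]; exists d. Qed.

Lemma open_mdist x r : open [set y | mdist x y < r].
Proof.
rewrite openE => y /= yx; have yx0 : 0 < r - mdist x y by rewrite subr_gt0.
apply: filterS (near_mdist y yx0) => z h /=.
by apply: le_lt_trans (metric_triangle x y z) _; rewrite -ltrBrDl.
Qed.

Lemma closed_mdist x r : closed [set y | mdist x y <= r].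
Proof.
rewrite -openC openE => y /= /negP; rewrite -ltNge => xy.
have yx0 : 0 < mdist x y - r by rewrite subr_gt0.
apply: filterS (near_mdist y yx0) => z h /=; apply/negP; rewrite -ltNge.
have := metric_triangle x z y; rewrite (metric_sym z y); lra.
Qed.

End MetricBasics.

Section CompactMetric.
Context {R : realType} {X : metricType R}.
Implicit Types (x y z : X) (r e : R).

Lemma finite_net (hX : compact [set: X]) r : 0 < r ->
  exists s : seq X, forall x, exists2 y, y \in s & mdist y x < r.
Proof.
move=> r0; pose P (s : seq X) x := exists2 y, y \in s & mdist y x < r.
(* With the filter of lists extending a given list, near-covering compactness yields a finite
   subcover. *)
pose F := filter_from [set: seq X] (fun s => [set t : seq X | {subset s <= t}]).
have FF : Filter F.
  apply: filter_from_filter; first by exists [::].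
  move=> s t _ _; exists (s ++ t) => // u su; split=> z zs; apply: su; rewrite mem_cat zs ?orbT //.
have /compact_near_coveringP := hX.
move=> /(_ _ F P FF) H.
have [|s _ sP] := H.
  move=> x _; exists ([set y | mdist x y < r], [set t : seq X | x \in t]) => /=.
    split; first exact: near_mdist.
    by exists [:: x] => // t; apply; rewrite inE.
  by move=> [y t] /= [h1 h2]; exists x.
by exists s => x; apply: (sP s).
Qed.

Lemma compact_unif_continuous {Y : metricType R} (hX : compact [set: X]) (h : X -> Y) e :
  continuous h -> 0 < e ->
  exists2 d, 0 < d & forall x y, mdist x y < d -> mdist (h x) (h y) < e.
Proof.
move=> ch e0.
have H x : exists2 d, 0 < d & forall y, mdist x y < d -> mdist (h x) (h y) < e / 2.
  have e2 : 0 < e / 2 by rewrite divr_gt0.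
  have [d d0 H] := nbhs_mdist_ex (ch x _ (near_mdist (h x) e2)).
  by exists d => // y /H.
have /compact_near_coveringP := hX.
move=> /(_ _ (nbhs (0 : R)^'+) (fun d x => forall y, mdist x y < d -> mdist (h x) (h y) < e)) [].
  move=> x _; have [d d0 dH] := H x.
  exists ([set y | mdist x y < d / 2], [set r | r < d / 2]) => /=.
    split; first by apply: near_mdist; rewrite divr_gt0.
    by apply: nbhs_right_lt; rewrite divr_gt0.
  move=> [y r] /= [h1 h2] z yz; apply: (@mdist_lt_split _ _ _ (h x)).
    by rewrite metric_sym; apply: dH; rewrite (lt_trans h1)// ltr_pdivrMr// ltr_pMr// ltr1n.
  by apply: dH; apply: (mdist_lt_split h1); apply: lt_trans h2.
move=> d /= d0 dP; exists (d / 2); first by rewrite divr_gt0.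
have d2 : 0 < d / 2 by rewrite divr_gt0.
move=> x y xy; apply: (dP (d / 2)) => //=.
by rewrite /ball_ sub0r normrN gtr0_norm// ltr_pdivrMr// ltr_pMr// ltr1n.
Qed.

Lemma lower_bound_iota (h : nat -> R) N : (forall i, (i < N)%N -> 0 < h i) ->
  exists2 e, 0 < e & forall i, (i < N)%N -> e <= h i.
Proof.
elim: N => [|N IH] H; first by exists 1.
have [|e e0 eh] := IH; first by move=> i iN; apply: H; rewrite ltnS ltnW.
exists (Num.min e (h N)); first by rewrite lt_min e0 H.
move=> i; rewrite ltnS leq_eqVlt => /orP[/eqP->|iN]; first by rewrite ge_min lexx orbT.
by rewrite ge_min eh.
Qed.

End CompactMetric.

Section Iterates.
Context {R : realType} {X : metricType R} (f g : X -> X).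
Hypotheses (fK : cancel f g) (gK : cancel g f).
Local Notation F := (ziter f g).

Lemma ziterS n x : F (n + 1) x = f (F n x).
Proof.
case: n => [n|n]; first by rewrite -PoszD addn1.
case: n => [|n]; first by rewrite /= gK.
have -> : Negz n.+1 + 1 = Negz n by lia.
by rewrite /= gK.
Qed.

Lemma ziterB1 n x : F (n - 1) x = g (F n x).
Proof. by have := ziterS (n - 1) x; rewrite subrK => ->; rewrite fK. Qed.

Lemma ziterD m n x : F (m + n) x = F m (F n x).
Proof.
elim: m => [|m IH|m IH]; first by rewrite add0r.
  have -> : m.+1%:Z + n = m%:Z + n + 1 by lia.
  have -> : m.+1%:Z = m%:Z + 1 by lia.
  by rewrite !ziterS IH.
have -> : - m.+1%:Z + n = - m%:Z + n - 1 by lia.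
have -> : - m.+1%:Z = - m%:Z - 1 by lia.
by rewrite !ziterB1 IH.
Qed.

Lemma ziterSr n x : F (n + 1) x = F n (f x).
Proof. by rewrite ziterD. Qed.

Lemma ziter_nat n x : F n%:Z x = iter n f x. Proof. by []. Qed.

Lemma ziter_periodic (p : int) x : F p x = x -> forall k : int, F (k * p) x = x.
Proof.
move=> px; have H (n : nat) : F (n%:Z * p) x = x.
  by elim: n => [|n IH]; rewrite ?mul0r// intS mulrDl mul1r ziterD IH.
move=> [n|n]; first exact: H.
by rewrite NegzE mulNr -{1}(H n.+1) -ziterD addNr.
Qed.

Lemma ziter_modn x (k : nat) : (0 < k)%N -> F k%:Z x = x ->
  forall n, exists2 i : nat, (i < k)%N & F n x = F i%:Z x.
Proof.
move=> k0 kx n; exists `|(n %% k%:Z)%Z|%N.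
  by rewrite -ltz_nat gez0_abs ?modz_ge0 ?ltz_pmod//; lia.
rewrite gez0_abs ?modz_ge0//; last by lia.
rewrite [in LHS](divz_eq n k%:Z) [X in F X _]addrC ziterD; congr F.
exact: ziter_periodic.
Qed.

Lemma iter_continuous (h : X -> X) n : continuous h -> continuous (iter n h).
Proof.
move=> ch; elim: n => [|n IH] x; first exact: cvg_id.
by apply: continuous_comp; [exact: IH|exact: ch].
Qed.

Lemma ziter_continuous n : continuous f -> continuous g -> continuous (F n).
Proof. by move=> cf cg; case: n => n; apply: iter_continuous. Qed.

End Iterates.

(** * Expansiveness, pseudo-orbits and a homoclinic orbit *)

Section Expansive.
Context {R : realType} {X : metricType R} (f g : X -> X).
Hypothesis hX : compact [set: X].
Hypotheses (cf : continuous f) (cg : continuous g) (fK : cancel f g) (gK : cancel g f).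
Local Notation F := (ziter f g).
Variable c : R.
Hypothesis hc : forall x y, x <> y -> exists i, c < mdist (F i x) (F i y).

Lemma expansive_eq x y : (forall i, mdist (F i x) (F i y) <= c) -> x = y.
Proof.
move=> H; apply: contrapT => /hc[i]; apply/negP; rewrite -leNgt; exact: H.
Qed.

(** Compactness of [X * X]: near the diagonal the points are already close, and a pair off the
    diagonal is separated by more than [c] at one time, which persists on a neighbourhood of the
    pair. *)
Lemma expansive_unif e : 0 < e -> exists N : nat, forall x y,
  (forall i : int, (`|i| <= N)%N -> mdist (F i x) (F i y) <= c) -> mdist x y < e.
Proof.
move=> e0.
have /compact_near_coveringP : compact [set: X * X].
  by rewrite -setXTT; apply: compact_setX.
move=> /(_ nat \oo (fun N (z : X * X) =>
  (forall i : int, (`|i| <= N)%N -> mdist (F i z.1) (F i z.2) <= c) -> mdist z.1 z.2 < e)).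
case.
  move=> [x y] _ /=.
  have [<-|xy] := pselect (x = y).
    exists ([set z | mdist x z.1 < e / 2 /\ mdist x z.2 < e / 2], setT) => /=.
      split; last by exists 0%N.
      exists ([set z | mdist x z < e/2], [set z | mdist x z < e/2]) => //=.
      by split; apply: near_mdist; rewrite divr_gt0.
    move=> [[a b] N] /= [[h1 h2] _] _.
    by apply: mdist_lt_split h2; rewrite metric_sym.
  have [i ci] := hc xy.
  pose r := (mdist (F i x) (F i y) - c) / 2.
  have r0 : 0 < r by rewrite divr_gt0// subr_gt0.
  have nF z : nbhs z [set w | mdist (F i z) (F i w) < r].
    exact: (@ziter_continuous _ _ f g i cf cg z _ (near_mdist (F i z) r0)).
  exists ([set z | mdist (F i x) (F i z.1) < r /\ mdist (F i y) (F i z.2) < r],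
          [set N | (`|i| <= N)%N]) => /=.
    split; last by exists `|i|%N.
    exists ([set z | mdist (F i x) (F i z) < r], [set z | mdist (F i y) (F i z) < r]) => //=.
  move=> [[a b] N] /= [[h1 h2] iN] /(_ i iN) h; exfalso.
  have := metric_triangle (F i x) (F i a) (F i y).
  have := metric_triangle (F i a) (F i b) (F i y).
  rewrite (metric_sym (F i b)) /r in h1 h2 *; lra.
move=> N _ HN; exists N => x y xy; exact: (HN N (leqnn N) (x, y)).
Qed.

End Expansive.

Section Chains.
Context {R : realType} {X : metricType R} (f : X -> X).
Implicit Types (x y a b : X) (d : R) (s : seq X).

(** One step of a [d]-pseudo-orbit; [path] and [cycle] then express finite and periodic
    pseudo-orbits. *)
Definition jump d : rel X := fun x y => mdist (f x) y < d.

Lemma path_traject d w j a b : 0 < d ->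
  mdist (f a) w < d / 2 -> mdist (iter j f w) b < d / 2 ->
  path (jump d) a (rcons (traject f w j) b).
Proof.
move=> d0; elim: j w a => [|j IH] w a h1 h2 /=.
  by rewrite andbT; apply: mdist_lt_split h1 h2.
apply/andP; split.
  by rewrite /jump (lt_trans h1)// ltr_pdivrMr// ltr_pMr// ltr1n.
by apply: IH; rewrite ?mdistxx ?divr_gt0// -iterSr.
Qed.

(** The bound [T] is uniform because only the finitely many pairs of net points, close to [f a] and
    [b], have to be joined by true orbit segments. *)
Lemma chain_connect (hX : compact [set: X]) d : transitive_on [set: X] f -> 0 < d ->
  exists T : nat, forall a b, exists s,
    (size s <= T)%N /\ path (jump d) a (rcons s b).
Proof.
move=> tr d0; have d4 : 0 < d / 4 by rewrite divr_gt0.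
have [cs csP] := finite_net hX d4.
have H (z : X * X) : exists jw : nat * X,
    mdist z.1 jw.2 < d / 4 /\ mdist z.2 (iter jw.1 f jw.2) < d / 4.
  have [] := tr _ _ (open_mdist z.1 (d / 4)) (open_mdist z.2 (d / 4)).
  - by exists z.1; split => //=; rewrite mdistxx.
  - by exists z.2; split => //=; rewrite mdistxx.
  by move=> j [_ [[w [_ /= w1] <-] [_ /= w2]]]; exists (j, w).
have [k kP] := choice H.
exists (\max_(z <- [seq (x, y) | x <- cs, y <- cs]) (k z).1) => a b.
have [x xs xa] := csP (f a); have [y ys yb] := csP b.
have [h1 h2] := kP (x, y); exists (traject f (k (x, y)).2 (k (x, y)).1); split.
  rewrite size_traject; apply: (@leq_bigmax_seq _ _ xpredT (fun z => (k z).1)) => //.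
  by apply/allpairsP; exists (x, y).
have e4 : d / 4 = d / 2 / 2 by lra.
rewrite e4 /= in h1 h2 xa yb.
apply: path_traject => //; first by rewrite metric_sym in xa; apply: mdist_lt_split xa h1.
by rewrite metric_sym in h2; apply: mdist_lt_split h2 yb.
Qed.

Definition periodize (x0 : X) s (n : int) : X := nth x0 s `|(n %% (size s)%:Z)%Z|%N.

Lemma periodizeD x0 s n : periodize x0 s (n + (size s)%:Z) = periodize x0 s n.
Proof. by rewrite /periodize modzDr. Qed.

Lemma cycle_nth d x0 s (i : nat) : cycle (jump d) s -> (i < size s)%N ->
  jump d (nth x0 s i) (nth x0 s (if i.+1 == size s then 0%N else i.+1)).
Proof.
case: s => // x s; rewrite (cycle_path x0) => /(pathP x0) H iS; move: (iS).
rewrite /= ltnS leq_eqVlt => /orP[/eqP->|lis].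
  rewrite eqxx; have := H 0%N isT; rewrite /= (last_nth x0).
  by congr jump.
by rewrite eqSS (ltn_eqF lis); apply: (H i.+1).
Qed.

Lemma periodize_jump d x0 s : cycle (jump d) s -> s != [::] ->
  forall n, jump d (periodize x0 s n) (periodize x0 s (n + 1)).
Proof.
move=> cs s0 n; have s0' : (0 < size s)%N by rewrite lt0n size_eq0.
rewrite /periodize -modzDml.
have : (0 <= (n %% (size s)%:Z)%Z < (size s)%:Z)%R.
  by rewrite modz_ge0 ?ltz_pmod //; lia.
case: (n %% _)%Z => // m; rewrite ltz_nat /= => lm.
have := cycle_nth x0 cs lm; rewrite -PoszD addn1 modz_nat absz_nat.
case: eqP => [->|ne]; first by rewrite modnn.
by rewrite modn_small// ltn_neqAle lm andbT; apply/eqP.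
Qed.

End Chains.

Section Homoclinic.
Context {R : realType} {X : metricType R} (f g : X -> X).
Hypothesis hX : compact [set: X].
Hypotheses (cf : continuous f) (cg : continuous g) (fK : cancel f g) (gK : cancel g f).
Local Notation F := (ziter f g).
Variable c : R.
Hypothesis c0 : 0 < c.
Hypothesis hc : forall x y, x <> y -> exists i, c < mdist (F i x) (F i y).
Hypothesis hs : shadowing f g.
Hypothesis tr : transitive_on [set: X] f.

Lemma shadow_unique (e : R) (u : int -> X) y y' : e + e <= c ->
  (forall n, mdist (F n y) (u n) < e) -> (forall n, mdist (F n y') (u n) < e) ->
  y = y'.
Proof.
move=> ec h1 h2; apply: (expansive_eq hc) => i.
apply: le_trans (metric_triangle _ (u i) _) _; apply: le_trans ec.
by rewrite lerD// ltW// metric_sym.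
Qed.

(** The point shadowing a periodic pseudo-orbit is periodic: its image after one period shadows the
    same sequence, and shadowing points are unique. *)
Lemma exists_periodic (x0 : X) : exists (p : X) (k : nat), (0 < k)%N /\ F k%:Z p = p.
Proof.
have c2 : 0 < c / 2 by rewrite divr_gt0.
have [d d0 dP] := hs c2.
have [T TP] := chain_connect hX tr d0.
have [s [_ ps]] := TP x0 x0.
have cy : cycle (jump f d) (x0 :: s) by [].
have [y yP] := dP (periodize x0 (x0 :: s)) (periodize_jump x0 cy isT).
exists y, (size (x0 :: s)); split => //.
apply: (@shadow_unique (c / 2) (periodize x0 (x0 :: s))) => //; first by rewrite -splitr.
by move=> n; rewrite -ziterD// -(periodizeD x0 (x0 :: s) n).
Qed.

(** [p1] and [p2] will be two points of one periodic orbit, as the forward and backward asymptotic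
    phases may differ. *)
Definition homoclinic (q p1 p2 : X) := forall e, 0 < e -> exists N : nat, forall n : nat,
  (N <= n)%N -> mdist (F n%:Z q) (F n%:Z p1) < e /\ mdist (F (- n%:Z) q) (F (- n%:Z) p2) < e.

(** Shadow a pseudo-orbit that follows the periodic orbit except for one excursion through a point
    [a] off that orbit. A precision finer than the distance from [a] to the orbit keeps [q] off it,
    and expansiveness turns closeness at all large times into convergence. *)
Lemma exists_homoclinic (x0 : X) : infinite_set [set: X] ->
  exists (p q : X) (k : nat) (j1 j2 : int), [/\ (0 < k)%N, F k%:Z p = p,
    forall n, F n p <> q & homoclinic q (F j1 p) (F j2 p)].
Proof.
move=> infX; have [p [k [k0 kp]]] := exists_periodic x0.
have [a aO] : exists a, forall n, F n p <> a.
  apply: contrapT => H; apply: infX.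
  have : finite_set [set F i%:Z p | i in `I_k] by apply: finite_image; exact: finite_II.
  apply: sub_finite_set => a _; apply: contrapT => aH; apply: H; exists a => n na.
  by have [i ik niE] := ziter_modn fK gK k0 kp n; apply: aH; exists i; rewrite // -niE.
have [e0 e00 e0P] : exists2 e, 0 < e & forall n, e <= mdist (F n p) a.
  have [|e e0 eP] := @lower_bound_iota R (fun i => mdist (F i%:Z p) a) k.
    by move=> i _; rewrite mdist_gt0; apply/eqP/aO.
  by exists e => // n; have [i ik ->] := ziter_modn fK gK k0 kp n; apply: eP.
pose e := Num.min e0 (c / 2).
have e0' : 0 < e by rewrite lt_min e00 divr_gt0.
have [d d0 dP] := hs e0'.
have [T TP] := chain_connect hX tr d0.
have [s1 [_ ps1]] := TP p a; have [s2 [_ ps2]] := TP a p.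
pose s := rcons s1 a ++ s2.
have ps : path (jump f d) p (rcons s p).
  by rewrite rcons_cat cat_path ps1 last_rcons.
pose S := (size s).+1.
(* The exact orbit of [p] before time 0 and again from time [S] on, with the chain through [a] in
   between. *)
pose u (n : int) := match n with
  | Posz m => if (m < S)%N then nth p (p :: s) m else F (m%:Z - S%:Z) p
  | Negz m => F n p end.
have uj n : mdist (f (u n)) (u (n + 1)) < d.
  case: n => [m|m]; last first.
    rewrite /u; case: m => [|m]; first by rewrite /= gK mdistxx.
    have -> : Negz m.+1 + 1 = Negz m by lia.
    by rewrite /= gK mdistxx.
  rewrite -PoszD addn1 /u; have [mS|Sm] := ltnP m S; last first.
    have -> : (m.+1 < S)%N = false by lia.
    have -> : m.+1%:Z - S%:Z = m%:Z - S%:Z + 1 by lia.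
    by rewrite (ziterS gK) mdistxx.
  have := pathP p ps m; rewrite size_rcons -/S => /(_ mS); rewrite /jump.
  have [mS'|Sm] := ltnP m.+1 S.
    have -> : nth p (p :: rcons s p) m = nth p (p :: s) m.
      by rewrite -rcons_cons nth_rcons /= mS.
    by rewrite /= nth_rcons; have -> : (m < size s)%N by lia.
  have mE : m = size s by lia.
  have -> : m.+1%:Z - S%:Z = 0 by lia.
  by rewrite mE -rcons_cons nth_rcons /= ltnS leqnn nth_rcons ltnn eqxx.
have [y yP] := dP u uj.
pose na := (size s1).+1.
have naS : (na < S)%N by rewrite /S /s size_cat size_rcons; lia.
have una : u na%:Z = a.
  by rewrite /u naS /= /s nth_cat size_rcons ltnSn nth_rcons ltnn eqxx.
(* The origin of time moves to the passage near [a]. Before it the orbit of [p] has phase [na];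
   after the excursion it was restarted at time [S], hence the phase [na - S]. *)
exists p, (F na%:Z y), k, (na%:Z - S%:Z), na%:Z; split => //.
  move=> n nE; have := yP na%:Z; rewrite una -nE.
  by apply/negP; rewrite -leNgt (le_trans _ (e0P n))// /e ge_min lexx.
have ec : e <= c by rewrite /e ge_min; apply/orP; right; rewrite ler_pdivrMr// ler_pMr// ler1n.
move=> r r0; have [N NP] := expansive_unif hX cf cg hc r0.
exists (N + S)%N => n Nn; rewrite -!(ziterD fK gK); split; apply: NP => i iN;
  rewrite -!(ziterD fK gK).
  have [m mE] : exists m : nat, i + (n%:Z + na%:Z) = m%:Z by exists `|(i + (n%:Z + na%:Z))%R|%N; lia.
  have -> : i + (n%:Z + (na%:Z - S%:Z)) = m%:Z - S%:Z by lia.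
  rewrite mE; apply/ltW/(lt_le_trans _ ec); have := yP m%:Z; rewrite /u.
  by have -> : (m < S)%N = false by lia.
rewrite addrA; have [m mE] : exists m : nat, i - n%:Z + na%:Z = Negz m.
  by exists `|(i - n%:Z + na%:Z + 1)%R|%N; lia.
by rewrite mE; apply/ltW/(lt_le_trans _ ec); have := yP (Negz m).
Qed.

(** At large times the orbit of [q] is so near the periodic orbit that it stays away from [q]. Only
    finitely many times remain, where it suffices that [q] is not periodic. *)
Lemma homoclinic_isolated (p q : X) (k : nat) (j1 j2 : int) :
  (0 < k)%N -> F k%:Z p = p -> (forall n, F n p <> q) ->
  homoclinic q (F j1 p) (F j2 p) ->
  exists2 e, 0 < e & (forall n, e <= mdist (F n p) q) /\
    (forall n, n != 0 -> e <= mdist (F n q) q).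
Proof.
move=> k0 kp pq hom.
have [|e e0 eP] := @lower_bound_iota R (fun i => mdist (F i%:Z p) q) k.
  by move=> i _; rewrite mdist_gt0; apply/eqP/pq.
have {}eP n : e <= mdist (F n p) q.
  by have [i ik ->] := ziter_modn fK gK k0 kp n; apply: eP.
have e2 : 0 < e / 2 by rewrite divr_gt0.
have [N NP] := hom _ e2.
have far n : (N <= `|n|)%N -> e / 2 <= mdist (F n q) q.
  move=> Nn; have [h1 h2] := NP _ Nn; rewrite leNgt; apply/negP => lt.
  have [n0|n0] := leP 0 n.
    rewrite gez0_abs// -ziterD// in h1; rewrite metric_sym in h1.
    by have := mdist_lt_split h1 lt; apply/negP; rewrite -leNgt.
  rewrite ltz0_abs// opprK -ziterD// in h2; rewrite metric_sym in h2.
  by have := mdist_lt_split h2 lt; apply/negP; rewrite -leNgt.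
(* A return at time [n] would recur at time [N * n], where [far] applies. *)
have nper n : n != 0 -> F n q <> q.
  move=> n0 nq; have := ziter_periodic fK gK nq N%:Z => E.
  by have := far (N%:Z * n); rewrite E mdistxx abszM leNgt e2 leq_pmulr ?absz_gt0// => /(_ isT).
have [|e1 e10 e1P] := @lower_bound_iota R (fun i => Num.min (mdist (F i.+1%:Z q) q)
    (mdist (F (- i.+1%:Z) q) q)) N.
  by move=> i _; rewrite lt_min !mdist_gt0; apply/andP; split; apply/eqP/nper.
exists (Num.min (e / 2) e1); first by rewrite lt_min e2.
split => n; first by rewrite ge_min (le_trans _ (eP n))// ler_pdivrMr// ler_pMr// ler1n.
move=> n0; rewrite ge_min; have [Nn|nN] := leqP N `|n|%N; first by rewrite far.
apply/orP; right; have /e1P : (`|n|.-1 < N)%N by lia.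
rewrite le_min prednK ?absz_gt0// => /andP[h1 h2].
by have [n1|n1] := leP 0 n; [rewrite gez0_abs// in h1|rewrite ltz0_abs// opprK in h2].
Qed.

(** Leave along the future of [q], wind around the periodic orbit and come back along the past of
    [q]. Matching the two phases fixes the winding time only modulo [k], so arbitrarily long loops
    are available; they serve both as marker and as tags. *)
Lemma homoclinic_loop (p q : X) (k : nat) (j1 j2 : int) (e : R) :
  (0 < k)%N -> F k%:Z p = p -> homoclinic q (F j1 p) (F j2 p) ->
  (forall n, e <= mdist (F n p) q) -> (forall n, n != 0 -> e <= mdist (F n q) q) ->
  forall d, 0 < d -> exists A : nat, forall i : nat, exists s : seq X,
    [/\ size s = (A + k * i)%N, cycle (jump f d) (q :: s) &
        forall x, x \in s -> e <= mdist x q].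
Proof.
move=> k0 kp hom far1 far2 d d0.
have [N' N'P] := hom _ d0; pose N := N'.+1.
have [h1 h2] := N'P N (leqnSn N').
(* The residue for which the orbit of [F j1 p], joined at time [N], arrives after [L] further steps
   at the phase of [F j2 p] at time [- N]. *)
pose L0 := `|((j2 - j1 - 2 * N%:Z) %% k%:Z)%Z|%N.
exists (N'.+1 + L0 + N')%N => i.
pose L := (L0 + k * i)%N.
have LE : F (N + L)%N%:Z (F j1 p) = F (- N%:Z) (F j2 p).
  rewrite -!(ziterD fK gK).
  have -> : (N + L)%N%:Z + j1 = - N%:Z + j2 + (i%:Z - ((j2 - j1 - 2 * N%:Z) %/ k%:Z)%Z) * k%:Z.
    have := divz_eq (j2 - j1 - 2 * N%:Z) k%:Z.
    have : L0%:Z = ((j2 - j1 - 2 * N%:Z) %% k%:Z)%Z by rewrite gez0_abs// modz_ge0//; lia.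
    rewrite /L; lia.
  by rewrite [LHS](ziterD fK gK) (ziter_periodic fK gK kp).
have trj (j : int) (x : X) (n : nat) (b : X) : mdist (F (j + n%:Z) x) b < d ->
    path (jump f d) (F (j - 1) x) (rcons [seq F (j + m%:Z) x | m <- iota 0 n] b).
  elim: n j => [|n IH] j /= H.
    by rewrite andbT /jump -(ziterS gK) subrK; rewrite addr0 in H.
  rewrite addr0 {1}/jump -(ziterS gK) subrK mdistxx d0 /=.
  have := IH (j + 1); rewrite addrK (iotaDl 1) -map_comp.
  have -> : j + 1 + n%:Z = j + n.+1%:Z by lia.
  move=> /(_ H); congr (path _ _ (rcons _ _)); apply: eq_map => m /=; congr F; lia.
exists ([seq F (1 + m%:Z) q | m <- iota 0 N'] ++
        [seq F (N%:Z + m%:Z) (F j1 p) | m <- iota 0 L.+1] ++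
        [seq F (- N'%:Z + m%:Z) q | m <- iota 0 N']).
split.
- by rewrite !size_cat !size_map !size_iota /L /N; lia.
- have A3E : rcons [seq F (- N'%:Z + m%:Z) q | m <- iota 0 N'] q =
      [seq F (- N'%:Z + m%:Z) q | m <- iota 0 N'.+1].
    by rewrite -addn1 iotaD map_cat cats1 /= add0n addNr.
  have tl (n : nat) (j : int) x : [seq F (j + m%:Z) x | m <- iota 0 n.+1] =
      F j x :: [seq F (j + 1 + m%:Z) x | m <- iota 0 n].
    rewrite /= addr0 (iotaDl 1) -map_comp; congr cons; apply: eq_map => m /=.
    by congr F; lia.
  have cyE s : cycle (jump f d) (q :: s) = path (jump f d) q (rcons s q) by [].
  rewrite cyE !rcons_cat A3E !tl -!cat_rcons !cat_path !last_rcons.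
  apply/and3P; split.
  + have := trj 1 q N' (F N%:Z (F j1 p)); rewrite subrr; apply.
    by rewrite -PoszD add1n.
  + have := trj (N%:Z + 1) (F j1 p) L (F (- N'%:Z) q); rewrite addrK; apply.
    have -> : N%:Z + 1 + L%:Z = 1 + (N + L)%N%:Z by lia.
    rewrite (ziterD fK gK) LE -(ziterD fK gK) metric_sym.
    have -> : 1 - N%:Z = - N'%:Z by lia.
    by have [] := N'P N' (leqnn N').
  + have := trj (- N'%:Z + 1) q N' (F 1 q); rewrite addrK rcons_path.
    move=> H; apply: (proj1 (andP (H _))).
    by rewrite (_ : - N'%:Z + 1 + N'%:Z = 1) ?mdistxx//; lia.
- move=> x; rewrite !mem_cat => /or3P[] /mapP[m]; rewrite mem_iota => /andP[_ mN] ->.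
  + by apply: far2; lia.
  + by rewrite -!(ziterD fK gK).
  + by apply: far2; lia.
Qed.

End Homoclinic.

(** * Subshifts of finite type *)

Section VertexShift.
Variables (k : nat) (e : rel 'I_k).
Implicit Types u v : sequence_space k.

Definition vertex_shift : set (sequence_space k) :=
  [set v | forall i : int, e (v i) (v (i + 1))].
Local Notation S := vertex_shift.

Lemma near_letter v (i : int) : \forall u \near v, u i = v i.
Proof.
have := @proj_continuous int (fun=> discrete_topology 'I_k) i v.
by move=> /(_ [set v i]); apply; apply: discrete_set1.
Qed.

Lemma near_letters v (N : nat) : \forall u \near v, forall i : int, (`|i| <= N)%N -> u i = v i.
Proof.
elim: N => [|N IH].
  by apply: filterS (near_letter v 0) => u h i; rewrite leqn0 absz_eq0 => /eqP->.
have h1 := near_letter v N.+1; have h2 := near_letter v (Negz N).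
apply: filterS (filterI IH (filterI h1 h2)) => u [a1 [a2 a3]] i.
rewrite leq_eqVlt ltnS => /orP[/eqP|]; last exact: a1.
by case: i => i /= []; [move=> ->|move=> ->].
Qed.

Lemma sequence_space_compact : compact [set: sequence_space k].
Proof.
have -> : [set: sequence_space k] =
    [set u : forall i : int, discrete_topology 'I_k | forall i, [set: discrete_topology 'I_k] (u i)].
  by apply/seteqP; split.
apply: (@tychonoff int (fun=> discrete_topology 'I_k) (fun=> setT)) => i.
by apply: finite_compact; exact: finite_finset.
Qed.

Lemma vertex_shift_closed : closed S.
Proof.
move=> v cv i.
have [u [Su [h1 h2]]] := cv _ (filterI (near_letter v i) (near_letter v (i + 1))).
by rewrite -h1 -h2.
Qed.

Lemma vertex_shift_compact : compact S.
Proof. by apply: (subclosed_compact vertex_shift_closed sequence_space_compact). Qed.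

Lemma vertex_shift_shift v : S v -> S (left_shift v).
Proof. by move=> Sv i; rewrite /left_shift addrAC. Qed.

Lemma vertex_shift_unshift v : S v -> S ((fun i => v (i - 1)) : sequence_space k).
Proof. by move=> Sv i; have := Sv (i - 1); rewrite addrAC. Qed.

Lemma left_shift_unshift v : left_shift ((fun i => v (i - 1)) : sequence_space k) = v.
Proof. by apply/funext => i; rewrite /left_shift addrK. Qed.

Lemma vertex_shift_subshift : subshift S.
Proof.
split; first exact: vertex_shift_closed.
apply/seteqP; split => [_ [v Sv <-]|v Sv]; first exact: vertex_shift_shift.
exists ((fun i => v (i - 1)) : sequence_space k); last exact: left_shift_unshift.
exact: vertex_shift_unshift.
Qed.

Lemma vertex_shift_sft : subshift_of_finite_type S.
Proof.
split; first exact: vertex_shift_subshift.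
exists 1%N, [set t : 2.-tuple 'I_k | e (tnth t ord0) (tnth t (lift ord0 ord0))]%SET.
apply/seteqP; split => v Sv i.
  by rewrite inE !tnth_mktuple /= addr0; exact: Sv.
by have := Sv i; rewrite inE !tnth_mktuple /= addr0.
Qed.

Lemma iter_left_shift n v i : iter n (@left_shift k) v i = v (i + n%:Z).
Proof.
elim: n i => [|n IH] i /=; first by rewrite addr0.
by rewrite /left_shift IH; congr (v _); lia.
Qed.

(** Otherwise sequences outside [U] that agree with [v] on growing windows would converge to [v] in
    the product topology. *)
Lemma nbhs_cylinder v (U : set (sequence_space k)) : nbhs v U ->
  exists N : nat, forall u, (forall i : int, (`|i| <= N)%N -> u i = v i) -> U u.
Proof.
move=> vU; apply: contrapT => /forallNP H.
have {}H (N : nat) : exists u, (forall i : int, (`|i| <= N)%N -> u i = v i) /\ ~ U u.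
  have /existsNP[u] := H N; move=> /not_implyP; by exists u.
have [w wP] := choice H.
have : w @ \oo --> v.
  apply/cvg_sup => i; apply/cvg_image; first by apply/seteqP; split => // a _; exists (fun=> a).
  move=> A /= nA; exists [set u | A (u i)]; last first.
    by apply/seteqP; split => [_ [u Au <-]//|a Aa]; exists (fun=> a).
  exists `|i|%N => // n /= iN; rewrite /= (proj1 (wP n) i iN).
  exact: nbhs_singleton nA.
by move=> /(_ U vU) [N _ /(_ N (leqnn N))]; apply: (proj2 (wP N)).
Qed.

(** A letter occurring in a point of the shift has a successor and a predecessor, so connections are
    asked only between such letters. In the tower relation the letters over words outside [C] have
    neither. *)
Lemma vertex_shift_transitive :
  (forall a b, (exists a', e a a') -> (exists b', e b' b) ->
     exists s, path e a (rcons s b)) -> transitive_on S (@left_shift k).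
Proof.
move=> conn U V oU oV [u [Su Uu]] [v [Sv Vv]].
have [Nu uP] : exists N : nat, forall w, (forall i : int, (`|i| <= N)%N -> w i = u i) -> U w.
  by apply: nbhs_cylinder; apply: open_nbhs_nbhs.
have [Nv vP] : exists N : nat, forall w, (forall i : int, (`|i| <= N)%N -> w i = v i) -> V w.
  by apply: nbhs_cylinder; apply: open_nbhs_nbhs.
have [||s sP] := conn (u Nu%:Z) (v (- Nv%:Z)).
  by exists (u (Nu%:Z + 1)); exact: Su.
  by exists (v (- Nv%:Z - 1)); have := Sv (- Nv%:Z - 1); rewrite subrK.
(* [w] follows [u] up to time [Nu], then [s], then [v] from time [-Nv] on. *)
pose m := (Nu + (size s).+1)%N.
pose w : sequence_space k := fun i =>
  if (i <= Nu%:Z)%R then u i else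
  if (i < m%:Z)%R then nth (u 0) s `|(i - Nu%:Z - 1)%R|%N else v (i - m%:Z - Nv%:Z).
have Sw : S w.
  move=> i; rewrite /w.
  have [iN|Ni] := leP (i + 1) Nu%:Z.
    by have -> : (i <= Nu%:Z)%R by lia; exact: Su.
  have [im|mi] := ltP (i + 1) m%:Z.
    have := pathP (u 0) sP `|(i - Nu%:Z)%R|%N; rewrite size_rcons.
    have lt : (`|(i - Nu%:Z)%R|%N < (size s).+1)%N by lia.
    rewrite !nth_rcons => /(_ lt).
    have -> : `|(i + 1 - Nu%:Z - 1)%R|%N = `|(i - Nu%:Z)%R|%N by lia.
    rewrite (_ : (`|(i - Nu%:Z)%R|%N < size s)%N = true); last by lia.
    have [iN|Ni'] := leP i Nu%:Z.
      have -> : i = Nu%:Z by lia.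
      by rewrite subrr.
    rewrite (_ : (i < m%:Z)%R = true); last by lia.
    have -> : `|(i - Nu%:Z)%R|%N = `|(i - Nu%:Z - 1)%R|%N.+1 by lia.
    rewrite /= nth_rcons (_ : (`|(i - Nu%:Z - 1)%R|%N < size s)%N = true)//; lia.
  have [mi'|im] := leP m%:Z i.
    have -> : (i <= Nu%:Z)%R = false by lia.
    have -> : i + 1 - m%:Z - Nv%:Z = i - m%:Z - Nv%:Z + 1 by lia.
    exact: Sv.
  have := pathP (u 0) sP (size s); rewrite size_rcons ltnSn => /(_ isT).
  rewrite nth_rcons ltnn eqxx.
  have -> : i + 1 - m%:Z - Nv%:Z = - Nv%:Z by lia.
  have [iN|Ni'] := leP i Nu%:Z.
    have s0 : size s = 0%N by lia.
    have -> : i = Nu%:Z by lia.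
    by rewrite s0.
  have s0 : size s = `|(i - Nu%:Z - 1)%R|%N.+1 by lia.
  rewrite {1}s0 /= nth_rcons.
  by rewrite (_ : (`|(i - Nu%:Z - 1)%R|%N < size s)%N = true)//; lia.
have Ssw n : S (iter n (@left_shift k) w).
  by elim: n => // n IH; apply: vertex_shift_shift.
exists (m + Nv)%N, (iter (m + Nv) (@left_shift k) w); split.
  exists w => //; split => //; apply: uP => i iN; rewrite /w.
  by have -> : (i <= Nu%:Z)%R by lia.
split => //; apply: vP => i iN; rewrite iter_left_shift /w.
have -> : (i + (m + Nv)%N%:Z <= Nu%:Z)%R = false by rewrite /m; lia.
have -> : (i + (m + Nv)%N%:Z < m%:Z)%R = false by lia.
by congr (v _); lia.
Qed.

End VertexShift.

(** * Coding a vertex shift into the space by shadowing *)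

Section Coding.
Context {R : realType} {X : metricType R} (f g : X -> X).
Hypothesis hX : compact [set: X].
Hypotheses (cf : continuous f) (cg : continuous g) (fK : cancel f g) (gK : cancel g f).
Local Notation F := (ziter f g).
Variable c : R.
Hypothesis hc : forall x y, x <> y -> exists i, c < mdist (F i x) (F i y).
Variables (d r : R).
Hypothesis rc : r + r <= c.
Hypothesis hs : forall u : int -> X, (forall n, mdist (f (u n)) (u (n + 1)) < d) ->
  exists y : X, forall n, mdist (F n y) (u n) < r.
Variables (k : nat) (e : rel 'I_k) (pt : 'I_k -> X).
Hypothesis he : forall a b, e a b -> mdist (f (pt a)) (pt b) < d.
Local Notation S := (vertex_shift e).
Hypothesis hsep : forall u v, S u -> S v -> u <> v ->
  exists i : int, r + r <= mdist (pt (u i)) (pt (v i)).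

Definition shadows (v : sequence_space k) (y : X) :=
  forall i : int, mdist (F i y) (pt (v i)) < r.

Definition coded (C : set (sequence_space k)) : set X :=
  [set y | exists2 v, C v & shadows v y].

Lemma shadows_inj_code u v y : S u -> S v -> shadows u y -> shadows v y -> u = v.
Proof.
move=> Su Sv uy vy; apply: contrapT => /(hsep Su Sv)[i]; apply/negP; rewrite -ltNge.
apply: le_lt_trans (metric_triangle _ (F i y) _) _.
by rewrite ltrD// metric_sym.
Qed.

Lemma shadows_inj_pt v y z : shadows v y -> shadows v z -> y = z.
Proof. exact: (shadow_unique hc rc). Qed.

Lemma shadows_shift v y : shadows v y <-> shadows (left_shift v) (f y).
Proof.
split=> vy i.
  by rewrite -(ziterSr fK gK); exact: vy.
by have := vy (i - 1); rewrite -(ziterSr fK gK) /left_shift subrK.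
Qed.

Lemma exists_shadow v : S v -> exists y, shadows v y.
Proof. by move=> Sv; apply: hs => n; apply/he/Sv. Qed.

Variable sh : sequence_space k -> X.
Hypothesis shP : forall v, S v -> shadows v (sh v).

Lemma codedE C : C `<=` S -> coded C = sh @` C.
Proof.
move=> CS; apply/seteqP; split => [y [v Cv vy]|_ [v Cv <-]].
  by exists v => //; apply: (shadows_inj_pt (shP (CS _ Cv))).
by exists v => //; apply/shP/CS.
Qed.

(** Codes that agree on a window give orbits within [r + r <= c] of each other over that window, and
    [expansive_unif] converts this into closeness of the points. *)
Lemma sh_within_continuous : {within S, continuous sh}.
Proof.
apply/subspace_continuousP => v Sv; apply/metricType_numDomainType.cvgrPdist_lt => eps eps0.
have [N NP] := expansive_unif hX cf cg hc eps0.
apply: filterS (near_letters v N) => u uv Su.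
apply: NP => i iN; apply: le_trans (metric_triangle _ (pt (v i)) _) _.
apply: le_trans rc; rewrite lerD// ltW//; first exact: shP.
by rewrite metric_sym -(uv _ iN); exact: shP.
Qed.

Lemma coded_compact C : closed C -> C `<=` S -> compact (coded C).
Proof.
move=> cC CS; rewrite codedE//; apply: continuous_compact.
  exact: continuous_subspaceW CS sh_within_continuous.
exact: subclosed_compact cC (@vertex_shift_compact k e) CS.
Qed.

Lemma coded_invariant : f @` coded S = coded S.
Proof.
apply/seteqP; split => [_ [y [v Sv vy] <-]|y [v Sv vy]].
  exists (left_shift v); first exact: vertex_shift_shift.
  exact: (proj1 (shadows_shift _ _)).
exists (g y); last exact: gK.
exists ((fun i => v (i - 1)) : sequence_space k); first exact: vertex_shift_unshift.
by apply: (proj2 (shadows_shift _ _)); rewrite left_shift_unshift gK.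
Qed.

Lemma coded_conjugate (v0 : sequence_space k) :
  conjugate (coded S) f S (@left_shift k).
Proof.
(* [v0] is the default value of the coding map [p] off the coded set. *)
have H y : exists v, coded S y -> S v /\ shadows v y.
  by have [[v Sv vy]|n] := pselect (coded S y); [exists v|exists v0].
have [p pP] := choice H.
have psh v : S v -> p (sh v) = v.
  move=> Sv; have [|Sp ps] := pP (sh v); first by exists v => //; exact: shP.
  exact: (shadows_inj_code Sp Sv ps (shP Sv)).
exists p, sh; split.
(* Continuity of the inverse by compactness: the preimage of a closed [C] under [p] is
   [coded (C ∩ S)], a compact and hence closed set. *)
- split; last exact: sh_within_continuous.
  apply/continuous_closedP => C cC; apply/closed_subspaceP.
  exists (coded (C `&` S)).
    apply: compact_closed; first exact: metric_hausdorff.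
    apply: coded_compact; last by move=> v [].
    by apply: closedI => //; exact: vertex_shift_closed.
  apply/seteqP; split => y [].
    move=> [v [Cv Sv] vy] Ly; split => //=; have [Sp ps] := pP y Ly.
    by move: Cv; rewrite (shadows_inj_code Sv Sp vy ps).
  by move=> /= Cy Ly; have [Sp ps] := pP y Ly; split => //; exists (p y).
- by move=> y /pP[].
- by move=> v Sv; exists v => //; exact: shP.
- split => [y Ly|v Sv]; last exact: psh.
  by have [Sp ps] := pP y Ly; exact: (shadows_inj_pt (shP Sp)).
- move=> y Ly; have [Sp ps] := pP y Ly.
  have [|Sq qs] := pP (f y).
    by rewrite -coded_invariant; exists y.
  apply: (shadows_inj_code Sq _ qs); first exact: vertex_shift_shift.
  exact: (proj1 (shadows_shift _ _)).
Qed.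

End Coding.

(** * Towers of constant height over a full shift *)

Section Tower.
Variables (N l : nat).
Notation letter := ('I_N * 'I_l)%type.
Notation K := #|{: letter}|.
Variable C : {set 'I_N}.
Implicit Types (a b : 'I_K).

(** The letter [(w, j)] is phase [j] of tour number [w]. Phases rise deterministically within a
    tour; from the last one the next tour is any member of [C]. *)
Definition tower_letter (x y : letter) : bool :=
  [&& x.1 \in C, y.1 \in C &
   if x.2.+1 == l then y.2 == 0 :> nat else (y.1 == x.1) && (y.2 == x.2.+1 :> nat)].

Definition tower : rel 'I_K := fun a b => tower_letter (enum_val a) (enum_val b).
Local Notation S := (vertex_shift tower).

Section Run.
Variable u : sequence_space K.
Hypothesis Su : S u.
Local Notation w i := (enum_val (u i : 'I_K)).1.
Local Notation j i := (nat_of_ord (enum_val (u i : 'I_K)).2).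

Lemma tower_mem i : w i \in C.
Proof. by have /and3P[] := Su i. Qed.

Lemma tower_step i : (j i).+1 != l -> w (i + 1) = w i /\ j (i + 1) = (j i).+1.
Proof. by move=> /negbTE ne; have /and3P[_ _] := Su i; rewrite ne => /andP[/eqP-> /eqP->]. Qed.

Lemma tower_top i : (j i).+1 = l -> j (i + 1) = 0%N.
Proof. by move=> /eqP ne; have /and3P[_ _] := Su i; rewrite ne => /eqP. Qed.

Lemma tower_fwd i (t : nat) : (j i + t < l)%N -> w (i + t%:Z) = w i /\ j (i + t%:Z) = (j i + t)%N.
Proof.
elim: t => [|t IH] H; first by rewrite addr0 addn0.
have [|E1 E2] := IH; first by lia.
have -> : i + t.+1%:Z = i + t%:Z + 1 by lia.
have [|-> ->] := @tower_step (i + t%:Z); first by rewrite E2; lia.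
by rewrite E1 E2 addnS.
Qed.

Lemma tower_bwd i (t : nat) : (t <= j i)%N -> w (i - t%:Z) = w i /\ j (i - t%:Z) = (j i - t)%N.
Proof.
elim: t => [|t IH] H; first by rewrite subr0 subn0.
have [|E1 E2] := IH; first by lia.
have E3 : i - t%:Z = i - t.+1%:Z + 1 by lia.
have [top|/eqP ntop] := eqVneq (j (i - t.+1%:Z)).+1 l.
  by have := tower_top top; rewrite -E3 E2; lia.
have := tower_step (introN eqP ntop); rewrite -E3 E1 E2 => -[-> ].
by split => //; lia.
Qed.

Lemma tower_start i : exists i0 : int, i = i0 + (j i)%:Z /\ j i0 = 0%N /\ w i0 = w i.
Proof.
exists (i - (j i)%:Z); have [-> ->] := tower_bwd (leqnn (j i)).
by rewrite subrK subnn.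
Qed.

Lemma tower_next_start i0 : j i0 = 0%N -> j (i0 + l%:Z) = 0%N.
Proof.
move=> j0; have l0 : (0 < l)%N by apply: leq_ltn_trans (ltn_ord (enum_val (u i0 : 'I_K)).2).
have [|_ E] := @tower_fwd i0 l.-1; first by rewrite j0; lia.
have -> : i0 + l%:Z = i0 + l.-1%:Z + 1 by lia.
by apply: tower_top; rewrite E j0; lia.
Qed.

End Run.

(** Climb to the top of the current column, drop to the bottom of the target column and climb to the
    wanted level. *)
Lemma tower_connected a b : (exists a', tower a a') -> (exists b', tower b' b) ->
  exists s, path tower a (rcons s b).
Proof.
case=> a' /and3P[aC _ _] [b' /and3P[_ bC _]].
pose conn a b := exists s, path tower a (rcons s b).
have cT x y z : conn x y -> conn y z -> conn x z.
  move=> [s1 p1] [s2 p2]; exists (rcons s1 y ++ s2).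
  by rewrite rcons_cat cat_path p1 last_rcons.
have c1 x y : tower x y -> conn x y by move=> xy; exists [::]; rewrite /= xy.
have l0 : (0 < l)%N by apply: leq_ltn_trans (ltn_ord (enum_val a).2).
have up (w : 'I_N) (j : 'I_l) (t : nat) (jt : (j + t.+1 < l)%N) : w \in C ->
    conn (enum_rank (w, j)) (enum_rank (w, Ordinal jt)).
  move=> wC; elim: t jt => [|t IH] jt.
    apply: c1; rewrite /tower !enum_rankK /tower_letter /= wC /= ifF.
      by rewrite eqxx addn1 /=.
    by apply/eqP; lia.
  have jt' : (j + t.+1 < l)%N by lia.
  apply: (cT _ _ _ (IH jt')); apply: c1; rewrite /tower !enum_rankK /tower_letter /= wC /= ifF.
    by rewrite eqxx /= -addnS.
  by apply/eqP; lia.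
have tp (w w' : 'I_N) (j : 'I_l) : w \in C -> w' \in C ->
    conn (enum_rank (w, j)) (enum_rank (w', Ordinal l0)).
  move=> wC w'C; have t1 (i : 'I_l) : i.+1 = l -> conn (enum_rank (w, i)) (enum_rank (w', Ordinal l0)).
    move=> il; apply: c1; rewrite /tower !enum_rankK /tower_letter /= wC w'C /= ifT //.
    exact/eqP.
  have [jl|/eqP jl] := eqVneq j.+1 l; first exact: t1.
  have jt : (j + (l - j.+2).+1 < l)%N by have := ltn_ord j; lia.
  apply: (cT _ _ _ (up w j _ jt wC)); apply: t1 => /=; have := ltn_ord j; lia.
have ea : a = enum_rank ((enum_val a).1, (enum_val a).2) by rewrite -surjective_pairing enum_valK.
have eb : b = enum_rank ((enum_val b).1, (enum_val b).2) by rewrite -surjective_pairing enum_valK.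
rewrite ea eb; have H := tp (enum_val a).1 (enum_val b).1 (enum_val a).2 aC bC.
have [b0|b0] := posnP (enum_val b).2.
  by rewrite (_ : (enum_val b).2 = Ordinal l0)//; apply/val_inj.
apply: (cT _ _ _ H); have jt : (Ordinal l0 + (enum_val b).2.-1.+1 < l)%N by rewrite /= prednK// ltn_ord.
have := up (enum_val b).1 _ _ jt bC; rewrite (_ : Ordinal jt = (enum_val b).2)//.
by apply/val_inj; rewrite /= prednK.
Qed.

(** The concatenation of the tours [v 0], [v 1], ... (and backwards), with a tour starting at time
    0. *)
Definition tower_code (l0 : (0 < l)%N) (v : int -> 'I_N) : sequence_space K := fun i =>
  enum_rank (v (i %/ l%:Z)%Z, Ordinal (ltn_pmod `|(i %% l%:Z)%Z| l0)).

Lemma tower_code_in l0 (v : int -> 'I_N) : (forall i, v i \in C) -> S (tower_code l0 v).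
Proof.
move=> vC i; rewrite /tower /tower_code !enum_rankK /tower_letter /= !vC /=.
have H (z : int) : (`|(z %% l%:Z)%Z| %% l)%N%:Z = (z %% l%:Z)%Z.
  by rewrite modn_small ?gez0_abs ?modz_ge0//; lia.
set n := (`|(i %% l%:Z)%Z| %% l)%N; set n' := (`|((i + 1) %% l%:Z)%Z| %% l)%N.
have Hn := H i; have Hn' := H (i + 1); rewrite -/n -/n' in Hn Hn'.
have nl : (n < l)%N by apply: ltn_pmod.
have Di := divz_eq i l%:Z; rewrite -Hn in Di.
case: eqP => nl'.
  rewrite -eqz_nat Hn' Di; apply/eqP.
  have -> : (i %/ l%:Z)%Z * l%:Z + n%:Z + 1 = ((i %/ l%:Z)%Z + 1) * l%:Z by lia.
  by rewrite modzMl.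
have E : i + 1 = (i %/ l%:Z)%Z * l%:Z + n.+1%:Z by lia.
rewrite -eqz_nat Hn' E modzMDl divzMDl; last by lia.
have nl2 : (0 <= n.+1%:Z < l%:Z)%R by lia.
by rewrite (modz_small nl2) (@divz_small n.+1%:Z)// addr0 !eqxx.
Qed.

Lemma tower_codeE l0 (v : int -> 'I_N) (m : int) (t : nat) (tl : (t < l)%N) :
  enum_val (tower_code l0 v (m * l%:Z + t%:Z) : 'I_K) = (v m, Ordinal tl).
Proof.
rewrite /tower_code enum_rankK modzMDl divzMDl; last by lia.
rewrite (@divz_small t%:Z) ?addr0; last by lia.
by congr pair; apply/val_inj; rewrite /= modz_nat absz_nat !modn_mod modn_small.
Qed.

End Tower.

(** * Marked pseudo-orbits *)

Section Blocks.
Context {R : realType} {X : metricType R} (f : X -> X).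
Variables (d r : R) (q : X) (T : eqType) (m : seq X) (B : T -> seq X).
Hypothesis mC : cycle (jump f d) (q :: m).
Hypothesis mfar : forall x, x \in m -> r + r <= mdist x q.
Hypothesis BC : forall t, cycle (jump f d) (q :: B t).
Hypothesis Bm : forall t, (size (B t) < size m)%N.
Hypothesis Bsep : forall s t, s != t -> exists i : nat,
  (i < minn (size (q :: B s)) (size (q :: B t)))%N /\
  r + r <= mdist (nth q (q :: B s) i) (nth q (q :: B t) i).
Implicit Types w : seq T.

(** Loops are stored without their base point [q]; prefixing each with [q] makes every block start
    visible as a visit to [q]. *)
Definition body w : seq X := flatten [seq q :: B t | t <- w].
Definition tour w : seq X := q :: m ++ body w.

Lemma cycle_cat e (s1 s2 : seq X) :
  cycle e (q :: s1) -> cycle e (q :: s2) -> cycle e (q :: s1 ++ q :: s2).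
Proof.
rewrite /= !rcons_path => /andP[p1 l1] /andP[p2 l2].
by rewrite cat_path last_cat /= p1 l1 p2 l2.
Qed.

Lemma body_cons t w : body (t :: w) = (q :: B t) ++ body w.
Proof. by []. Qed.

Lemma tour_cycle w : cycle (jump f d) (tour w).
Proof.
rewrite /tour; elim: w m mC => [|t w IH] s sC; first by rewrite cats0.
by rewrite /body /= -cat_cons catA; apply: IH; apply: cycle_cat.
Qed.

Lemma nth_body0 w : nth q (body w) 0 = q.
Proof. by case: w. Qed.

(** The next visit is the start of the following block, reached within [size m] steps because blocks
    are shorter than the marker. After the last block it is the default value [q] of [nth], which
    stands for the first point of the next tour. *)
Lemma body_visit w (i : nat) : (i < size (body w))%N -> exists j : nat,
  [/\ (0 < j <= size m)%N, (i + j <= size (body w))%N & nth q (body w) (i + j) = q].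
Proof.
elim: w i => // t w IH i; rewrite body_cons => iS.
have [it|ti] := ltnP i (size (q :: B t)).
  exists (size (q :: B t) - i)%N; have -> : (i + (size (q :: B t) - i) = size (q :: B t))%N by lia.
  split; last by rewrite nth_cat ltnn subnn nth_body0.
    by rewrite subn_gt0 it /= (leq_trans (leq_subr _ _))// Bm.
  by rewrite size_cat leq_addr.
have [|j [j0 jS jq]] := IH (i - size (q :: B t))%N.
  by move: iS; rewrite size_cat; lia.
exists j; split => //; first by rewrite size_cat; lia.
rewrite nth_cat (_ : (i + j < size (q :: B t))%N = false); last by lia.
by rewrite (_ : (i + j - size (q :: B t))%N = (i - size (q :: B t) + j)%N)//; lia.
Qed.

(** After removal of the common prefix, the first differing blocks start at the same position.
    Equality of sizes excludes that one word is a proper prefix of the other. *)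
Lemma body_sep w w' : size (body w) = size (body w') -> w != w' -> exists i : nat,
  (i < size (body w))%N /\ r + r <= mdist (nth q (body w) i) (nth q (body w') i).
Proof.
elim: w w' => [|t w IH] [|t' w']//; rewrite !body_cons.
have [<-|tt'] := eqVneq t t'.
  rewrite !size_cat => /eqP; rewrite eqn_add2l => /eqP wS ww'.
  have [|i [iS isep]] := IH w' wS; first by apply: contraNneq ww' => ->.
  exists (size (q :: B t) + i)%N; split; first by rewrite ltn_add2l.
  by rewrite !nth_cat ltnNge leq_addr /= addKn.
move=> E _; have [i [iS isep]] := Bsep tt'; exists i; move: iS isep; rewrite leq_min => /andP[h1 h2].
split; first by rewrite (leq_trans h1)// size_cat leq_addr.
by rewrite !nth_cat h1 h2.
Qed.

Lemma tour_marker w (i : nat) : (0 < i <= size m)%N -> r + r <= mdist (nth q (tour w) i) q.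
Proof.
case: i => //= i im; rewrite /tour /= nth_cat im; apply: mfar; exact: mem_nth.
Qed.

Lemma tour_visit w (i : nat) : (size m < i < size (tour w))%N -> exists j : nat,
  [/\ (0 < j <= size m)%N, (i + j <= size (tour w))%N & nth q (tour w) (i + j) = q].
Proof.
move=> /andP[mi iS]; have [|j [j0 jS jq]] := @body_visit w (i - (size m).+1).
  by move: iS; rewrite /= size_cat; lia.
exists j; split => //; first by rewrite /= size_cat; lia.
have -> : (i + j = (size m + (i - (size m).+1 + j)).+1)%N by lia.
by rewrite /tour /= nth_cat ltnNge leq_addr /= addKn.
Qed.

Variables (N l : nat) (W : 'I_N -> seq T).
Hypothesis Wi : injective W.
Hypothesis Wl : forall i, size (tour (W i)) = l.
Notation letter := ('I_N * 'I_l)%type.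
Notation K := #|{: letter}|.

Definition tour_pt (a : 'I_K) : X := nth q (tour (W (enum_val a).1)) (enum_val a).2.

Lemma tour_pt_jump C (a b : 'I_K) : tower C a b -> mdist (f (tour_pt a)) (tour_pt b) < d.
Proof.
move=> /and3P[_ _]; have := @cycle_nth R X f d q _ (enum_val a).2 (tour_cycle (W (enum_val a).1)).
rewrite Wl => /(_ (ltn_ord _)); rewrite /tour_pt; case: eqP => _ H.
  by move=> /eqP->.
by move=> /andP[/eqP-> /eqP->].
Qed.

Section TourSeparation.
Variable C : {set 'I_N}.
Local Notation S := (vertex_shift (@tower N l C)).
Local Notation w u i := (enum_val (u i : 'I_K)).1.
Local Notation j u i := (nat_of_ord (enum_val (u i : 'I_K)).2).

Lemma tour_size_gt (i : 'I_N) : (size m < l)%N.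
Proof. by rewrite -(Wl i) /= size_cat ltnS leq_addr. Qed.

(* A point at phase 0 visits [q] and then stays away from it for [size m] steps,
   whereas from any other phase either the marker has already left [q], or [q] is
   visited again within [size m] steps. *)
Lemma phase_sep (u v : sequence_space K) (i : int) : S u -> S v -> j u i = 0%N -> j v i <> 0%N ->
  exists i : int, r + r <= mdist (tour_pt (u i)) (tour_pt (v i)).
Proof.
move=> Su Sv ui vi; have lm := tour_size_gt (w u i).
have [jm|mj] := leqP (j v i) (size m).
  exists i; rewrite metric_sym {2}/tour_pt ui /=; apply: tour_marker.
  by rewrite jm andbT lt0n; apply/eqP.
have [|t [/andP[t0 tm] tS tq]] := @tour_visit (W (w v i)) (j v i).
  by rewrite mj Wl ltn_ord.
exists (i + t%:Z); have [|Eu1 Eu2] := tower_fwd Su (i := i) (t := t); first by rewrite ui; lia.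
have -> : tour_pt (v (i + t%:Z)) = q.
  (* A visit at position [l] is the bottom of the next tour; an earlier one lies in the current
     tour. *)
  rewrite Wl leq_eqVlt in tS; case/orP: tS => [/eqP tS|tS].
    have [i0 [iE [i00 _]]] := tower_start Sv i.
    have := tower_next_start Sv i00; have -> : i0 + l%:Z = i + t%:Z by lia.
    by rewrite /tour_pt => ->.
  by have [E1 E2] := tower_fwd Sv tS; rewrite /tour_pt E1 E2.
by rewrite /tour_pt Eu1 Eu2 ui add0n; apply: tour_marker; rewrite t0 tm.
Qed.

(** If the phases differ somewhere, [phase_sep] applies at a start of a tour. If they agree
    everywhere, some tours with a common start differ, and their bodies are aligned. *)
Lemma tour_pt_sep (u v : sequence_space K) : S u -> S v -> u <> v ->
  exists i : int, r + r <= mdist (tour_pt (u i)) (tour_pt (v i)).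
Proof.
move=> Su Sv uv.
have [[i ji]|Ej] := pselect (exists i, j u i <> j v i).
  have [i0 [iE [i00 _]]] := tower_start Su i.
  apply: (phase_sep Su Sv i00) => vi0; apply: ji.
  have [|_ E] := tower_fwd Sv (i := i0) (t := j u i); first by rewrite vi0 ltn_ord.
  by move: E; rewrite -iE vi0.
have {}Ej i : j u i = j v i by apply: contrapT => H; apply: Ej; exists i.
have [i wi] : exists i, w u i <> w v i.
  apply: contrapT => H; apply: uv; apply/funext => i; apply: enum_val_inj.
  rewrite [LHS]surjective_pairing [RHS]surjective_pairing; congr pair; last exact/val_inj/Ej.
  by apply: contrapT => H'; apply: H; exists i.
have [i0 [iE [i00 wi0]]] := tower_start Su i.
have vi0 : j v i0 = 0%N by rewrite -Ej.
have wi0' : w v i0 = w v i.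
  have [|E _] := tower_fwd Sv (i := i0) (t := j u i); first by rewrite vi0 ltn_ord.
  by rewrite -E -iE.
have [||t [tS tsep]] := @body_sep (W (w u i)) (W (w v i)).
- by have := Wl (w u i); have := Wl (w v i); rewrite /= !size_cat; lia.
- by apply/eqP => /Wi.
have tl : ((size m + t).+1 < l)%N.
  by rewrite -[ltnRHS](Wl (w u i)) /= size_cat ltnS ltn_add2l.
exists (i0 + (size m + t).+1%:Z).
have [|E1 E2] := tower_fwd Su (i := i0) (t := (size m + t).+1); first by rewrite i00.
have [|E3 E4] := tower_fwd Sv (i := i0) (t := (size m + t).+1); first by rewrite vi0.
rewrite /tour_pt E1 E2 E3 E4 i00 vi0 !add0n wi0 wi0' /tour /=.
by rewrite !nth_cat ltnNge leq_addr /= addKn.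
Qed.

End TourSeparation.
End Blocks.

(** * Borel probability measures *)

Lemma mnormalize1 d (T : measurableType d) (R : realType)
    (mu : {measure set T -> \bar R}) (P : probability T R) (A : set T) :
  mu setT = 1%E -> mnormalize mu P A = mu A.
Proof. by move=> mu1; rewrite /mnormalize mu1 /= onee_eq0 /= invr1 mule1. Qed.

Section BorelProbability.
Context {R : realType} {X : pmetricType R}.
Local Notation bX := (borel X).
Local Notation measures := (probability bX R).
Implicit Types (mu nu : measures) (phi : X -> R).

Lemma open_borel (A : set X) : open A -> measurable (A : set bX).
Proof. by move=> oA; apply: sub_sigma_algebra. Qed.

Lemma closed_borel (A : set X) : closed A -> measurable (A : set bX).
Proof.
by move=> cA; rewrite -[A]setCK; apply: measurableC; apply: open_borel; exact: closed_openC.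
Qed.

Lemma continuous_borel phi : continuous phi -> measurable_fun setT (phi : bX -> R).
Proof.
move=> /continuousP cphi; apply: (measurability _ (RGenOpens.measurableE R)).
move=> _ [_ [a [b ->] <-]]; rewrite setTI; apply: open_borel.
by apply: cphi; exact: interval_open.
Qed.

Lemma continuous_preimage_borel (h : X -> X) (A : set X) : continuous h ->
  measurable (A : set bX) -> measurable (h @^-1` A : set bX).
Proof.
move=> /continuousP ch mA.
have mh : measurable_fun setT (h : bX -> bX).
  apply: (@measurability _ _ bX bX setT h (@open X)) => //.
  by move=> _ [B oB <-]; rewrite setTI; apply: open_borel; exact: ch.
by have := mh measurableT A mA; rewrite setTI.
Qed.

Lemma compact_continuous_bounded (hX : compact [set: X]) phi : continuous phi ->
  exists2 M, 0 <= M & forall x, `|phi x| <= M.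
Proof.
move=> cphi; have [d d0 dP] := @compact_unif_continuous R X R^o hX phi 1 cphi ltr01.
have [s sP] := finite_net hX d0.
exists (\sum_(y <- s) `|phi y| + 1); first by rewrite addr_ge0// sumr_ge0.
move=> x; have [y ys /dP] := sP x; rewrite /mdist/= => h.
have -> : phi x = phi y + (phi x - phi y) by rewrite addrC subrK.
rewrite (le_trans (ler_normD _ _))// lerD//; last exact: ltW.
by rewrite (big_rem y)//= lerDl sumr_ge0.
Qed.

Lemma continuous_integrable (hX : compact [set: X]) mu phi : continuous phi ->
  mu.-integrable [set: bX] (EFin \o phi).
Proof.
move=> cphi; apply: measurable_bounded_integrable => //.
- by rewrite (le_lt_trans (probability_le1 _ _))// ltry.
- exact: continuous_borel.
have [M M0 MP] := compact_continuous_bounded hX cphi.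
exists M; split; first exact: num_real.
by move=> M' MM' x _; apply: le_trans (MP x) (ltW MM').
Qed.

Definition pr mu (A : set X) : R := fine (mu A).

Lemma pr_ge0 mu A : 0 <= pr mu A.
Proof. exact: fine_ge0. Qed.

Lemma prE mu A : measurable (A : set bX) -> (pr mu A)%:E = mu A.
Proof. by move=> mA; rewrite /pr fineK// fin_num_measure. Qed.

Lemma prT mu : pr mu setT = 1.
Proof. by rewrite /pr probability_setT. Qed.

Lemma pr_le mu A B : measurable (A : set bX) -> measurable (B : set bX) ->
  A `<=` B -> pr mu A <= pr mu B.
Proof. by move=> mA mB AB; rewrite -lee_fin !prE// le_measure ?inE. Qed.

Lemma pr_bigcup mu (I : finType) (xi : I -> set X) :
  (forall a, measurable (xi a : set bX)) -> trivIset setT xi ->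
  pr mu (\bigcup_a xi a) = \sum_a pr mu (xi a).
Proof.
move=> mxi txi; apply/EFin_inj; rewrite prE; last first.
  by apply: fin_bigcup_measurable => [|a _]; [exact: finite_finset|exact: mxi].
rewrite measure_fin_bigcup//; last exact: finite_finset.
have -> : [set: I] = [set` (xpredT : pred I)] by apply/seteqP.
rewrite -(@bigfs _ _ _ _ (index_enum I)) ?index_enum_uniq// => [|i _]; last first.
  by rewrite mem_index_enum.
by rewrite -sumEFin; apply: eq_bigr => a _; exact/esym/prE.
Qed.

Definition measurable_partition (I : finType) (xi : I -> set X) : Prop :=
  [/\ forall a, measurable (xi a : set bX), trivIset setT xi & \bigcup_a xi a = setT].

Lemma pr_partition mu (I : finType) (xi : I -> set X) (A : set X) :
  measurable_partition xi -> measurable (A : set bX) ->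
  pr mu A = \sum_a pr mu (A `&` xi a).
Proof.
move=> [mxi txi cxi] mA; rewrite -{1}(setIT A) -cxi setI_bigcupr pr_bigcup//.
  by move=> a; apply: measurableI => //; exact: mxi.
exact: trivIset_setIl.
Qed.

Lemma pr_partition1 mu (I : finType) (xi : I -> set X) :
  measurable_partition xi -> \sum_a pr mu (xi a) = 1.
Proof.
move=> pxi; rewrite -(prT mu) (pr_partition mu pxi measurableT).
by apply: eq_bigr => a _; rewrite setTI.
Qed.

Lemma pr_sum mu (I : finType) (xi : I -> set X) (P : pred I) :
  measurable_partition xi ->
  pr mu (\bigcup_(a in [set` P]) xi a) = \sum_(a | P a) pr mu (xi a).
Proof.
move=> pxi; have [mxi txi cxi] := pxi.
rewrite (pr_partition mu pxi); last first.
  by apply: fin_bigcup_measurable => [|a _]; [exact: finite_finset|exact: mxi].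
rewrite [RHS]big_mkcond; apply: eq_bigr => a _; case: ifPn => Pa.
  by congr pr; apply/seteqP; split => [x []//|x xa]; split => //; exists a.
rewrite (_ : _ `&` _ = set0); first by rewrite /pr measure0.
apply/seteqP; split => // x [[b Pb xb] xa]; move: Pa.
have -> : a = b by apply: txi => //; exists x.
by rewrite (Pb : P b).
Qed.

(** Integrals are handled through such Riemann sums. Null cells are exempt so that the complement of
    a horseshoe can be one of the cells. *)
Lemma Rintegral_approx (hX : compact [set: X]) mu (I : finType) (xi : I -> set X) phi c theta :
  measurable_partition xi -> continuous phi ->
  (forall a, pr mu (xi a) = 0 \/ forall x, xi a x -> `|phi x - c a| <= theta) ->
  `|\int[mu]_x phi x - \sum_a c a * pr mu (xi a)| <= theta.
Proof.
move=> pxi cphi H; have [mxi txi cxi] := pxi.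
have iphi := continuous_integrable hX mu cphi.
have iphia a : mu.-integrable (xi a) (EFin \o phi).
  by apply: integrableS iphi => //; exact: mxi.
have -> : \int[mu]_x phi x = \sum_a \int[mu]_(x in xi a) phi x.
  have E : setT = \big[setU/set0]_(a <- index_enum I) xi a.
    rewrite -cxi; apply/seteqP; split => [x [a _ xa]|x _].
      by rewrite -bigcup_seq; exists a => //=; rewrite mem_index_enum.
    by rewrite cxi.
  rewrite /Rintegral [in LHS]E integral_bigsetU_EFin/= ?index_enum_uniq//.
  - rewrite (eq_bigr (fun a => (fine (\int[mu]_(x in xi a) (phi x)%:E))%:E)) ?sumEFin// => a _.
    by rewrite fineK//; exact: (integrable_fin_num _ (iphia a)).
  - exact: sub_trivIset txi.
  - by rewrite -E; apply/measurable_EFinP; exact: continuous_borel.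
rewrite -sumrB; apply: le_trans (ler_norm_sum _ _ _) _.
rewrite -[leRHS]mulr1 -(pr_partition1 mu pxi) mulr_sumr; apply: ler_sum => a _.
have [p0|Ha] := H a.
  rewrite p0 !mulr0 subr0 /Rintegral null_set_integral ?normr0//.
  - exact: measurable_int (iphia a).
  - by have := prE mu (mxi a); rewrite p0 => /esym E; exact: E.
have ic (z : R) : mu.-integrable (xi a) (EFin \o cst z).
  exact: (finite_measure_integrable_cst mu z (mxi a)).
have Ec (z : R) : z * pr mu (xi a) = \int[mu]_(x in xi a) z.
  exact/esym/(Rintegral_cst mu (mxi a)).
rewrite !Ec -(RintegralB (mxi a) (iphia a) (ic _)).
have iB : mu.-integrable (xi a) (EFin \o (fun x => phi x - c a)).
  exact: (integrableB (mxi a) (iphia a) (ic (c a))).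
apply: le_trans (le_normr_Rintegral (mxi a) iB) _.
exact: (le_Rintegral (mxi a) (integrable_norm iB) (ic theta)).
Qed.

Lemma first_hit_partition n (U : 'I_n -> set X) :
  (forall i, measurable (U i : set bX)) -> \bigcup_i U i = setT ->
  exists xi : 'I_n -> set X, measurable_partition xi /\ forall i, xi i `<=` U i.
Proof.
move=> mU cU.
pose V i := \bigcup_(j in [set j : 'I_n | (j < i)%N]) U j.
exists (fun i => U i `\` V i); split; last by move=> i x [].
split.
- move=> i; apply: measurableD => //.
  by apply: fin_bigcup_measurable => //; exact: finite_finset.
- move=> i j _ _ [x [[Ui Vi] [Uj Vj]]]; apply/val_inj/eqP; rewrite eqn_leq.
  apply/andP; split; rewrite leqNgt; apply/negP => h; [apply: Vi|apply: Vj].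
    by exists j.
  by exists i.
- apply/seteqP; split => // x _.
  have /cid2[i _ Ui] : (\bigcup_i U i) x by rewrite cU.
  have [k /asboolP Uk kmin] := @arg_minnP _ i (fun i => `[< U i x >]) val (asboolT Ui).
  exists k => //; split => // -[j /= jk Uj].
  by have := kmin j (asboolT Uj); rewrite /= leqNgt jk.
Qed.

Lemma fine_partition (hX : compact [set: X]) phi theta : continuous phi -> 0 < theta ->
  exists n (xi : 'I_n -> set X) (c : 'I_n -> R), measurable_partition xi /\
    forall i x, xi i x -> `|phi x - c i| <= theta.
Proof.
move=> cphi th0; have [d d0 dP] := @compact_unif_continuous R X R^o hX phi theta cphi th0.
have [s sP] := finite_net hX d0.
have [||xi [pxi xiU]] := @first_hit_partition (size s) (fun i => [set y | mdist (tnth (in_tuple s) i) y < d]).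
- by move=> i; apply: open_borel; exact: open_mdist.
- apply/seteqP; split => // x _; have [y ys yx] := sP x.
  by have /tnthP[i yi] : y \in in_tuple s by []; exists i => //=; rewrite -yi.
exists (size s), xi, (fun i => phi (tnth (in_tuple s) i)); split => // i x /xiU /= /dP.
by rewrite /mdist/= => /ltW.
Qed.

(** Both sides are within [th / 2] of the same Riemann sum over cells on which [phi] is almost
    constant, and the masses of the cells combine linearly. *)
Lemma Rintegral_lincomb (hX : compact [set: X]) n (mu : 'I_n -> measures) (t : 'I_n -> R) nu phi :
  continuous phi -> (forall i, 0 <= t i) -> \sum_i t i = 1 ->
  (forall A : set bX, measurable A -> nu A = (\sum_i (t i)%:E * mu i A)%E) ->
  \int[nu]_x phi x = \sum_i t i * \int[mu i]_x phi x.
Proof.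
move=> cphi t0 t1 nuE; apply/eqP; rewrite -subr_eq0 -normr_le0.
apply/ler_addgt0Pl => th th0; rewrite addr0.
have th2 : 0 < th / 2 by rewrite divr_gt0.
have [k [xi [c [pxi xic]]]] := fine_partition hX cphi th2.
have [mxi _ _] := pxi.
have H (m : measures) := Rintegral_approx hX pxi cphi (fun a => or_intror (xic a) : pr m (xi a) = 0 \/ _).
have nuE' a : pr nu (xi a) = \sum_i t i * pr (mu i) (xi a).
  apply/EFin_inj; rewrite prE ?nuE//; try exact: mxi.
  by rewrite -sumEFin; apply: eq_bigr => i _; rewrite EFinM prE//; exact: mxi.
have E : \sum_a c a * pr nu (xi a) = \sum_i t i * \sum_a c a * pr (mu i) (xi a).
  under [RHS]eq_bigr do rewrite mulr_sumr.
  rewrite exchange_big; apply: eq_bigr => a _; rewrite nuE' mulr_sumr.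
  by apply: eq_bigr => i _; rewrite mulrCA.
rewrite (splitr th) -(subrKA (\sum_a c a * pr nu (xi a))).
apply: le_trans (ler_normD _ _) _; apply: lerD; first exact: H.
rewrite distrC E -sumrB; apply: le_trans (ler_norm_sum _ _ _) _.
rewrite -[leRHS]mulr1 -[X in _ <= _ * X]t1 mulr_sumr; apply: ler_sum => i _.
by rewrite -mulrBr normrM (ger0_norm (t0 i)) mulrC ler_wpM2r// H.
Qed.

Lemma exists_mixture n (mu : 'I_n -> measures) (t : 'I_n -> R) :
  (forall i, 0 <= t i) -> \sum_i t i = 1 ->
  exists nu : measures, forall A : set bX, nu A = (\sum_i (t i)%:E * mu i A)%E.
Proof.
move=> t0 t1.
pose m (k : nat) : {measure set bX -> \bar R} :=
  if insub k is Some i then mscale (NngNum (t0 i)) (mu i) else mzero.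
have E (A : set bX) : msum m n A = (\sum_i (t i)%:E * mu i A)%E.
  by apply: eq_bigr => i _; rewrite /m valK.
have E1 : msum m n setT = 1%E.
  rewrite E -[RHS]/(1%:E) -t1 -sumEFin; apply: eq_bigr => i _.
  by rewrite probability_setT mule1.
(* The total mass is already 1, so normalising changes no value and only yields the probability
   structure. *)
exists (mnormalize (msum m n) point) => A.
exact: etrans (mnormalize1 _ _ E1) (E A).
Qed.

Lemma pr_iter mu (f : X -> X) n (A : set X) : continuous f -> invariant_measure f mu ->
  measurable (A : set bX) -> pr mu (iter n f @^-1` A) = pr mu A.
Proof.
move=> cf inv mA; elim: n => // n IH; rewrite -IH.
have -> : iter n.+1 f @^-1` A = f @^-1` (iter n f @^-1` A).
  by apply/funext => x; rewrite /preimage/= -iterS iterSr.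
congr fine; apply: inv.
exact: continuous_preimage_borel (iter_continuous (n := n) cf) mA.
Qed.

(** A fine partition and its preimage under the iterate have cells of equal mass, so both integrals
    share a Riemann sum. *)
Lemma Rintegral_invariant (hX : compact [set: X]) mu (f : X -> X) phi n :
  continuous f -> continuous phi -> invariant_measure f mu ->
  \int[mu]_x phi (iter n f x) = \int[mu]_x phi x.
Proof.
move=> cf cphi inv; have cfn := iter_continuous (n := n) cf.
apply/eqP; rewrite -subr_eq0 -normr_le0.
apply/ler_addgt0Pl => th th0; rewrite addr0.
have th2 : 0 < th / 2 by rewrite divr_gt0.
have [k [xi [c [pxi xic]]]] := fine_partition hX cphi th2.
have [mxi txi cxi] := pxi.
have pxi' : measurable_partition (fun a => iter n f @^-1` xi a).
  split.
  - by move=> a; apply: continuous_preimage_borel => //; exact: mxi.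
  - move=> a b _ _ [x [xa xb]]; apply: (txi a b I I); by exists (iter n f x).
  - by rewrite -preimage_bigcup cxi.
rewrite (splitr th) -(subrKA (\sum_a c a * pr mu (xi a))).
apply: le_trans (ler_normD _ _) _; apply: lerD; last first.
  by rewrite distrC; apply: Rintegral_approx => // a; right; exact: xic.
under [X in _ - X]eq_bigr => a _ do rewrite -(pr_iter n cf inv (mxi a)).
apply: Rintegral_approx => //; last by move=> a; right => x /xic.
by move=> x; apply: continuous_comp; [exact: cfn|exact: cphi].
Qed.

End BorelProbability.

(** * Topological entropy and the weak distance *)

Section Entropy.
Context {R : realType} {X : metricType R} (f : X -> X) (L : set X).

Lemma separated_number_ge0 n (e : R) : (0 <= separated_number f L n e)%E.
Proof.
apply: ereal_sup_ubound; exists fset0; last by rewrite cardfs0.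
by split => [x|x y] /=; rewrite inE.
Qed.

Lemma separated_number_le n (e e' : R) : e <= e' ->
  (separated_number f L n e' <= separated_number f L n e)%E.
Proof.
move=> ee; apply: ereal_sup_le => _ [E [EL Es] <-]; exists E => //; split => // x y Ex Ey xy.
exact: le_lt_trans ee (Es x y Ex Ey xy).
Qed.

Let h (e : R) := limn_esup (fun n : nat =>
  ((n%:R : R)^-1)%:E * lne (separated_number f L n e))%E.

Let h_noninc e e' : e <= e' -> (h e' <= h e)%E.
Proof.
move=> ee; apply: le_ereal_inf_tmp => _ [V FV <-]; apply: ge_ereal_inf.
exists (ereal_sup ((fun n : nat =>
  ((n%:R : R)^-1)%:E * lne (separated_number f L n e'))%E @` V)); first by exists V.
apply: ge_ereal_sup => _ [n Vn <-]; apply: le_trans (ereal_sup_ubound _); last by exists n.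
apply: lee_wpmul2l; first by rewrite lee_fin invr_ge0.
rewrite lee_lne ?in_itv/= ?separated_number_ge0 ?leey//.
exact: separated_number_le.
Qed.

(** Times that are multiples of [l] lie beyond every threshold, so they bound the limsup at scale
    [e] from below; that limsup grows as [e] decreases, so its limit at 0 is at least its value at
    [e]. *)
Lemma htop_ge (l m : nat) (e : R) : 0 < e -> (0 < l)%N -> (0 < m)%N ->
  (forall k : nat, exists E : {fset X}, [/\ #|` E|%fset = (m ^ k)%N, [set` E] `<=` L &
     bowen_separated f (l * k) e [set` E]]) ->
  ((ln m%:R / l%:R)%:E <= htop f L)%E.
Proof.
move=> e0 l0 m0 H.
have he : ((ln m%:R / l%:R)%:E <= h e)%E.
  apply: le_ereal_inf_tmp => _ [V [n0 _ n0V] <-].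
  apply: le_trans (ereal_sup_ubound _); last first.
    exists (l * n0.+1)%N; last by [].
    by apply: n0V => /=; rewrite (leq_trans (leqnSn n0))// leq_pmull.
  have [E [cE EL Es]] := H n0.+1.
  have le1 : (((m ^ n0.+1)%N%:R : R)%:E <= separated_number f L (l * n0.+1) e)%E.
    by apply: ereal_sup_ubound; exists E => //; rewrite cE.
  have mn0 : 0 < (m ^ n0.+1)%N%:R :> R by rewrite ltr0n expn_gt0 m0.
  have le2 : ((ln (m ^ n0.+1)%N%:R)%:E <= lne (separated_number f L (l * n0.+1) e))%E.
    by rewrite -lne_EFin// lee_lne// in_itv/= leey andbT ?separated_number_ge0// lee_fin ltW.
  apply: le_trans (lee_wpmul2l _ le2); last by rewrite lee_fin invr_ge0.
  rewrite -EFinM lee_fin natrX lnXn ?ltr0n// natrM -mulr_natr le_eqVlt; apply/orP; left; apply/eqP.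
  by field; rewrite nat1r !pnatr_eq0 -!lt0n l0.
apply: le_trans he _.
have ab : (BRight (0 : R) < BInfty R false)%O by [].
have := @nonincreasing_at_right_cvge R h 0 (BInfty R false) ab.
move=> /(_ (fun x y _ _ xy => h_noninc xy)) /cvg_lim => lE.
rewrite /htop lE//; apply: ereal_sup_ubound; exists e => //=.
by rewrite in_itv/= e0.
Qed.

End Entropy.

Section WeakDistance.
Context {R : realType} {X : pmetricType R}.
Local Notation bX := (borel X).
Local Notation measures := (probability bX R).
Hypothesis hX : compact [set: X].

Lemma sup_norm_ge phi x : continuous phi -> `|phi x| <= sup_norm (phi : X -> R).
Proof.
move=> cphi; have [M M0 MP] := compact_continuous_bounded hX cphi.
by apply: ub_le_sup; [exists M => _ [y _ <-]|exists x].
Qed.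

Lemma Rintegral_le_sup_norm (mu : measures) phi : continuous phi ->
  `|\int[mu]_x phi x| <= sup_norm (phi : X -> R).
Proof.
move=> cphi; have := @Rintegral_approx R X hX mu unit (fun=> setT) phi (fun=> 0) (sup_norm phi).
rewrite big1 ?subr0; last by move=> i _; rewrite mul0r.
apply => //.
  split => //; last by apply/seteqP; split => // x _; exists tt.
  by move=> [] [].
by move=> a; right => x _; rewrite subr0; exact: sup_norm_ge.
Qed.

(** Term [j] is at most [2 ^- j], so the tail from [J] on is at most [2 * 2 ^- J <= zeta / 2]. The
    weights of the first [J] terms sum to less than 1, which leaves [zeta / 2] for them. *)
Lemma weak_dist_le (phi : nat -> X -> R) (zeta : R) : (forall j, continuous (phi j)) -> 0 < zeta ->
  exists (J : nat) (theta : R), 0 < theta /\ forall xi tau : measures,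
    (forall j, (j < J)%N -> `|\int[xi]_x phi j x - \int[tau]_x phi j x| <= theta) ->
    weak_dist phi xi tau <= zeta.
Proof.
move=> cphi z0; have z2 : 0 < zeta / 2 by rewrite divr_gt0.
pose J := Num.bound (4 / zeta).
have JP : 2 * (2 ^+ J)^-1 <= zeta / 2.
  have h : 4 / zeta < 2 ^+ J.
    apply: lt_trans (archi_boundP _) _; first by rewrite divr_ge0// ltW.
    by rewrite -natrX ltr_nat ltn_expl.
  by rewrite ler_pdivrMr ?exprn_gt0//; rewrite ltr_pdivrMr// in h; lra.
(* A function of norm 0 contributes nothing, so 1 replaces its norm in the minimum. *)
have [|th th0 thP] := @lower_bound_iota R (fun j => if sup_norm (phi j) > 0 then sup_norm (phi j) else 1) J.
  by move=> j _; case: ifPn.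
exists J, (zeta / 2 * th); split; first by rewrite mulr_gt0.
move=> xi tau H; rewrite /weak_dist.
set a := (fun j => _ / _).
have sn0 j : 0 <= sup_norm (phi j) by apply: le_trans (normr_ge0 _) (sup_norm_ge point (cphi j)).
have a0 j : 0 <= a j by rewrite divr_ge0// mulr_ge0// exprn_ge0.
have aE j : a j = `|\int[xi]_x phi j x - \int[tau]_x phi j x| / sup_norm (phi j) * (2 ^+ j.+1)^-1.
  by rewrite /a invfM mulrA mulrAC.
have a1 j : a j <= (2 ^+ j)^-1.
  rewrite aE exprS invfM mulrA ler_piMl ?invr_ge0 ?exprn_ge0//.
  rewrite ler_pdivrMr// mul1r; have [->|sn] := eqVneq (sup_norm (phi j)) 0; first by rewrite invr0 mulr0.
  rewrite ler_pdivrMr ?lt_neqAle 1?eq_sym ?sn ?sn0// mulrC mulr_natr mulr2n.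
  apply: le_trans (ler_normB _ _) _.
  by rewrite lerD// Rintegral_le_sup_norm.
have a2 j : (j < J)%N -> a j <= zeta / 2 * (2 ^+ j.+1)^-1.
  move=> jJ; rewrite aE ler_pM2r ?invr_gt0 ?exprn_gt0//.
  have [->|sn] := eqVneq (sup_norm (phi j)) 0; first by rewrite invr0 mulr0 ltW.
  have sp : 0 < sup_norm (phi j) by rewrite lt_neqAle eq_sym sn sn0.
  rewrite ler_pdivrMr//; apply: le_trans (H j jJ) _; rewrite ler_pM2l//.
  by have := thP j jJ; rewrite sp.
have S n : series a n <= zeta / 2 * (1 - (2 ^+ n)^-1) +
    (if (n <= J)%N then 0 else 2 * (2 ^+ J)^-1 - 2 * (2 ^+ n)^-1).
  elim: n => [|n IH].
    by rewrite /series/= big_geq// expr0 invr1 subrr mulr0 addr0.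
  rewrite /series/= big_nat_recr//=; apply: le_trans (lerD IH (lexx _)) _.
  have p0 : 0 < (2 ^+ n : R)^-1 by rewrite invr_gt0 exprn_gt0.
  have E2 : (2 ^+ n.+1)^-1 = (2 ^+ n)^-1 / 2 :> R by rewrite exprS invfM mulrC.
  rewrite E2; have [nJ|Jn] := ltnP n J.
    by rewrite ltnW//; have := a2 n nJ; rewrite E2; lra.
  have := a1 n; have [nJ|_] := leqP n J; last by nra.
  have -> : n = J by lia.
  have JJ0 : 0 < (2 ^+ J : R)^-1 by rewrite invr_gt0 exprn_gt0.
  move=> h; have h2 : 0 < zeta * (2 ^+ J)^-1 by rewrite mulr_gt0.
  lra.
have nd : {homo series a : m n / (m <= n)%N >-> m <= n}.
  by apply: nondecreasing_series => i _ _; exact: a0.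
have Sz n : series a n <= zeta.
  apply: le_trans (S n) _; have p0 : 0 < (2 ^+ n : R)^-1 by rewrite invr_gt0 exprn_gt0.
  case: ifP => _; last by nra.
  by nra.
apply: limr_le; last by near=> n; exact: Sz.
apply: nondecreasing_is_cvgn => //; exists zeta => _ [n _ <-]; exact: Sz.
Unshelve. all: by end_near. Qed.

End WeakDistance.

(** * Horseshoes *)

Section PeriodicMeasure.
Context {R : realType} {X : pmetricType R} (f : X -> X).
Local Notation bX := (borel X).
Local Notation measures := (probability bX R).

(** The uniform measure on a periodic orbit. It gives each horseshoe an invariant measure, without
    which the Hausdorff distances would be infinite. *)
Lemma exists_periodic_measure (n : nat) y : (0 < n)%N -> iter n f y = y ->
  exists nu : measures, invariant_measure f nu /\
    forall A : set X, (forall j, A (iter j f y)) -> nu A = 1%E.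
Proof.
move=> n0 ny; pose t := fun _ : 'I_n => (n%:R : R)^-1.
have [||nu nuE] := @exists_mixture R X n (fun j => @dirac _ bX (iter j f y) R : measures) t.
- by move=> i; rewrite invr_ge0.
- by rewrite sumr_const card_ord -[_ *+ n]mulr_natr mulVf// pnatr_eq0 -lt0n.
have {}nuE (A : set bX) :
  nu A = (\sum_(j < n) ((n%:R : R)^-1)%:E * ((iter j f y \in A)%:R : R)%:E)%E := nuE A.
exists nu; split => [A mA|A Ay].
  rewrite !nuE -!ge0_sume_distrr//; congr (_ * _)%E.
  case: n n0 ny t nuE => // n _ ny _ _.
  rewrite big_ord_recr big_ord_recl /= addeC.
  congr adde; congr EFin; congr ((nat_of_bool _)%:R); apply/idP/idP => /set_mem H;
     apply/mem_set; move: H; rewrite /preimage /= ?add0n -?iterS ?ny //.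
rewrite nuE (eq_bigr (fun=> ((n%:R : R)^-1)%:E)) => [|j _].
  by rewrite sumEFin sumr_const card_ord -[_ *+ n]mulr_natr mulVf// pnatr_eq0 -lt0n.
by rewrite mem_set ?mule1.
Qed.

End PeriodicMeasure.

Section Horseshoe.
Context {R : realType} {X : pmetricType R} (f g : X -> X).
Hypothesis hX : compact [set: X].
Hypotheses (cf : continuous f) (cg : continuous g) (fK : cancel f g) (gK : cancel g f).
Local Notation F := (ziter f g).
Variable c : R.
Hypothesis hc : forall x y, x <> y -> exists i, c < mdist (F i x) (F i y).
Variables (d r : R).
Hypothesis r0 : 0 < r.
Hypothesis rc : r + r <= c.
Hypothesis hs : forall u : int -> X, (forall n, mdist (f (u n)) (u (n + 1)) < d) ->
  exists y : X, forall n, mdist (F n y) (u n) < r.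
Variables (q : X) (T : eqType) (m : seq X) (B : T -> seq X).
Hypothesis mC : cycle (jump f d) (q :: m).
Hypothesis mfar : forall x, x \in m -> r + r <= mdist x q.
Hypothesis BC : forall t, cycle (jump f d) (q :: B t).
Hypothesis Bm : forall t, (size (B t) < size m)%N.
(* One [r] would suffice to make the coding injective; the margin keeps different
   orbits [2 r]-separated. *)
Hypothesis Bsep : forall s t, s != t -> exists i : nat,
  (i < minn (size (q :: B s)) (size (q :: B t)))%N /\
  r + r + (r + r) <= mdist (nth q (q :: B s) i) (nth q (q :: B t) i).
Variables (N l : nat) (W : 'I_N -> seq T).
Hypothesis Wi : injective W.
Hypothesis Wl : forall i, size (tour q m B (W i)) = l.
Notation letter := ('I_N * 'I_l)%type.
Notation K := #|{: letter}|.
Local Notation pt := (@tour_pt R X q T m B N l W).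
Local Notation shadows := (@shadows R X f g r K pt).
Local Notation S C := (vertex_shift (@tower N l C)).

Definition horseshoe (C : {set 'I_N}) : set X := @coded R X f g r K pt (S C).

Implicit Types (C : {set 'I_N}) (w : 'I_N).

Let Bsep2 s t : s != t -> exists i : nat,
  (i < minn (size (q :: B s)) (size (q :: B t)))%N /\
  r + r <= mdist (nth q (q :: B s) i) (nth q (q :: B t) i).
Proof.
move=> /Bsep[i [iS isep]]; exists i; split => //; apply: le_trans isep.
have := r0; lra.
Qed.

Let he C a b : tower C a b -> mdist (f (pt a)) (pt b) < d.
Proof. exact: (@tour_pt_jump R X f d q T m B mC BC N l W Wl). Qed.

Let hsep C u v : S C u -> S C v -> u <> v ->
  exists i : int, r + r <= mdist (pt (u i)) (pt (v i)).
Proof. exact: (tour_pt_sep mC mfar Bm Bsep2 Wi Wl). Qed.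

Let sh_ex C : exists sh : sequence_space K -> X, forall v, S C v -> shadows v (sh v).
Proof.
have H v : exists y : X, S C v -> shadows v y.
  have [Sv|nSv] := pselect (S C v); last by exists point.
  by have [y yP] := exists_shadow hs (@he C) Sv; exists y.
by have [sh shP] := choice H; exists sh.
Qed.

Let coded_cpt C (D : set (sequence_space K)) : closed D -> D `<=` S C ->
  compact (@coded R X f g r K pt D).
Proof.
have [sh shP] := sh_ex C.
exact: (coded_compact hX cf cg hc rc shP).
Qed.

Lemma horseshoe_compact C : compact (horseshoe C).
Proof. by apply: (@coded_cpt C) => //; exact: vertex_shift_closed. Qed.

Lemma horseshoe_invariant C : f @` horseshoe C = horseshoe C.
Proof. exact: coded_invariant. Qed.

Lemma tour_length_gt0 (w : 'I_N) : (0 < l)%N.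
Proof. by rewrite -(Wl w). Qed.

Lemma horseshoe_sft C w : w \in C -> conjugate_to_transitive_sft (horseshoe C) f.
Proof.
move=> wC; have [sh shP] := sh_ex C.
exists K, (S C); split; first exact: vertex_shift_sft.
  by apply: vertex_shift_transitive; exact: tower_connected.
exact: (coded_conjugate hX cf cg fK gK hc rc (@hsep C) shP (tower_code (tour_length_gt0 w) (fun=> w))).
Qed.

Lemma horseshoe_sub C C' : C \subset C' -> horseshoe C `<=` horseshoe C'.
Proof.
move=> /fintype.subsetP CC' y [v Sv vy]; exists v => // i; have /and3P[h1 h2 h3] := Sv i.
by rewrite /tower /tower_letter !CC'.
Qed.

(** Each orbit in the horseshoe comes within [r] of [q] at the start of a tour; this makes the
    horseshoe a proper subset. *)
Lemma horseshoe_far C p : (forall n, r <= mdist (F n p) q) -> ~ horseshoe C p.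
Proof.
move=> pq [v Sv vp]; have [i0 [_ [i00 _]]] := tower_start Sv 0.
have := vp i0; rewrite /tour_pt i00 /= => lt.
by have := pq i0; rewrite leNgt lt.
Qed.

Lemma horseshoe_periodic C w : w \in C -> exists nu : probability (borel X) R,
  invariant_measures f (horseshoe C) nu.
Proof.
move=> wC; have l0 := tour_length_gt0 w; pose v := tower_code l0 (fun=> w).
have Sv : S C v by apply: tower_code_in.
have [y yP] := exists_shadow hs (@he C) Sv.
have per : iter l f y = y.
  apply: (shadows_inj_pt hc rc (v := v)); last exact: yP.
  move=> i; rewrite -(ziter_nat f g) -(ziterD fK gK); have := yP (i + l%:Z).
  by rewrite /v /tower_code modzDr.
have [nu [inu nuA]] := exists_periodic_measure l0 per.
exists nu; split => //; apply: nuA; elim => [|j IH]; first by exists v.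
by rewrite iterS -horseshoe_invariant; exists (iter j f y).
Qed.

(** The free choices of [k] consecutive tours give separated points: two different bodies are at
    least [4 r] apart somewhere, and shadowing loses less than [r] on either side. *)
Lemma horseshoe_htop C : (0 < #|C|)%N ->
  ((ln #|C|%:R / l%:R)%:E <= htop f (horseshoe C))%E.
Proof.
move=> C0; have /card_gt0P[w0 w0C] := C0; have l0 := tour_length_gt0 w0.
apply: (@htop_ge R X f _ l #|C| (r + r)) => //; first by rewrite addr_gt0.
move=> k.
pose v (u : {ffun 'I_k -> 'I_N}) : int -> 'I_N := fun i =>
  if i is Posz j then if insub j is Some j' then u j' else w0 else w0.
have vE u (j : 'I_k) : v u (nat_of_ord j)%:Z = u j by rewrite /v valK.
have [sh shP] := sh_ex C.
pose y u := sh (tower_code l0 (v u)).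
have Sv u : u \in ffun_on (mem C) -> S C (tower_code l0 (v u)).
  move=> /ffun_onP uC; apply: tower_code_in => -[j|j] //=.
  by case: insubP => // j' _ _; exact: uC.
have yS u : u \in ffun_on (mem C) -> shadows (tower_code l0 (v u)) (y u).
  by move=> /Sv; exact: shP.
have sep u u' : u \in ffun_on (mem C) -> u' \in ffun_on (mem C) -> u <> u' ->
    r + r < bowen_dist f (l * k) (y u) (y u').
  move=> uC u'C uu'; have [j uj] : exists j, u j <> u' j.
    by apply: contrapT => H; apply: uu'; apply/ffunP => j; apply: contrapT => H'; apply: H; exists j.
  have [||t [tS tsep]] := @body_sep R X (r + r) q T B Bsep (W (u j)) (W (u' j)).
  - by have := Wl (u j); have := Wl (u' j); rewrite /= !size_cat; lia.
  - by apply/eqP => /Wi.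
  have tl : ((size m + t).+1 < l)%N.
    by rewrite -[ltnRHS](Wl (u j)) /= size_cat ltnS ltn_add2l.
  (* Tour number [j] starts at time [j * l], and its body follows [q] and the marker. *)
  pose i := (j * l + (size m + t).+1)%N.
  have ilk : (i < l * k)%N.
    have : (j.+1 * l <= k * l)%N by rewrite leq_mul2r ltn_ord orbT.
    by move: tl; rewrite /i mulSn (mulnC l k); lia.
  have ptE u1 : u1 \in ffun_on (mem C) -> mdist (iter i f (y u1)) (nth q (body q B (W (u1 j))) t) < r.
    move=> /yS /(_ i%:Z); rewrite (ziter_nat f g) /tour_pt.
    rewrite /i PoszD PoszM tower_codeE vE /tour /=.
    by rewrite nth_cat ltnNge leq_addr /= addKn.
  apply: lt_le_trans (le_bigmax _ _ (Ordinal ilk)) => /=.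
  have := ptE u uC; have := ptE u' u'C => h1 h2.
  have := metric_triangle (nth q (body q B (W (u j))) t) (iter i f (y u)) (nth q (body q B (W (u' j))) t).
  have := metric_triangle (iter i f (y u)) (iter i f (y u')) (nth q (body q B (W (u' j))) t).
  rewrite (metric_sym _ (iter i f (y u))); lra.
have rr : 0 <= r + r by rewrite ltW// addr_gt0.
exists [fset y u | u in ffun_on (mem C)]%fset; split.
- rewrite card_in_imfset /= => [|u u' uC u'C yE].
    by rewrite -cardE card_ffun_on card_ord.
  apply: contrapT => /(sep _ _ uC u'C); rewrite yE ltNge => /negP; apply.
  by apply: bigmax_le => // i _; rewrite mdistxx.
- by move=> _ /= /imfsetP[u /= uC ->]; exists (tower_code l0 (v u)); [exact: Sv|exact: yS].
- move=> _ _ /= /imfsetP[u /= uC ->] /imfsetP[u' /= u'C ->] yy.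
  by apply: sep => // uu; apply: yy; rewrite uu.
Qed.

Section InvariantMeasures.
Variables (C : {set 'I_N}) (nu : probability (borel X) R).
Hypothesis nuL : invariant_measures f (horseshoe C) nu.

(** The cylinder of the letter [a] at time 0, transported to [X]. *)
Let La (a : 'I_K) : set X := @coded R X f g r K pt [set v | S C v /\ v 0 = a].

Let La_borel a : measurable (La a : set (borel X)).
Proof.
apply: closed_borel; apply: compact_closed; first exact: metric_hausdorff.
apply: (@coded_cpt C) => [|v []//].
have -> : [set v | S C v /\ v 0 = a] = S C `&` [set v | v 0 = a] by [].
apply: closedI; first exact: vertex_shift_closed.
move=> v /(_ _ (near_letter v 0))[u [/= <-]].
by move=> ->.
Qed.

Let La_triv : trivIset setT La.
Proof.
move=> a b _ _ [y [[u [Su <-] uy] [v [Sv <-] vy]]].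
by rewrite (shadows_inj_code (@hsep C) Su Sv uy vy).
Qed.

Let La_cover : \bigcup_a La a = horseshoe C.
Proof.
apply/seteqP; split => [y [a _ [v [Sv _] vy]]|y [v Sv vy]]; first by exists v.
by exists (v 0) => //; exists v.
Qed.

(** Inside a column, level [j + 1] is preceded only by level [j] and level [j] followed only by
    level [j + 1]; hence one cell is the preimage of the other under [f], and invariance applies. *)
Let La_next (w : 'I_N) (j : nat) (jl : (j < l)%N) (jl' : (j.+1 < l)%N) :
  pr nu (La (enum_rank (w, Ordinal jl'))) = pr nu (La (enum_rank (w, Ordinal jl))).
Proof.
case: nuL => inu _; rewrite /pr -inu; last exact: La_borel.
congr (fine (nu _)); apply/seteqP; split => y.
  move=> [v [Sv v0] vy].
  pose v' : sequence_space K := fun i => v (i - 1).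
  have Sv' : S C v' by exact: vertex_shift_unshift.
  have vE : v = left_shift v' by rewrite left_shift_unshift.
  exists v'; last by apply: (proj2 (shadows_shift fK gK _ _ _ _)); rewrite -vE.
  split => //; apply: enum_val_inj; rewrite enum_rankK.
  have [|] := @tower_bwd _ _ C v Sv 0 1%N; first by rewrite v0 enum_rankK.
  rewrite v0 enum_rankK /= sub0r => E1 E2; rewrite [LHS]surjective_pairing; congr pair => //.
  by apply/val_inj; rewrite /= /v' sub0r E2 subn1.
move=> [v [Sv v0] vy]; exists (left_shift v); last exact: (proj1 (shadows_shift fK gK _ _ _ _)).
split; first exact: vertex_shift_shift.
apply: enum_val_inj; rewrite enum_rankK /left_shift.
have [|] := @tower_step _ _ C v Sv 0.
  by rewrite v0 enum_rankK /=; apply/eqP; lia.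
rewrite v0 enum_rankK /= => E1 E2; rewrite [LHS]surjective_pairing; congr pair => //.
by apply/val_inj.
Qed.

(** The [l] levels of a column have equal mass, so [alpha w] is [l] times the mass of the bottom
    level. Points of a cylinder lie within [r] of its tour point, and the Riemann sum over cylinders
    becomes a combination of averages along tours. *)
Lemma horseshoe_measure : exists alpha : 'I_N -> R,
  [/\ forall w, 0 <= alpha w, forall w, w \notin C -> alpha w = 0, \sum_w alpha w = 1 &
   forall (phi : X -> R) theta, continuous phi ->
     (forall x y, mdist x y < r -> `|phi x - phi y| <= theta) ->
     `|\int[nu]_x phi x -
       \sum_w alpha w * ((\sum_(x <- tour q m B (W w)) phi x) / l%:R)| <= theta].
Proof.
have [N0|N0] := posnP N.
  have : horseshoe C = set0.
    apply/seteqP; split => // y [v _ _]; have := (enum_val (v 0 : 'I_K)).1.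
    by rewrite N0 => -[].
  by case: nuL => _ + H; rewrite H measure0 => /eqP; rewrite eq_sym onee_eq0.
have l0 : (0 < l)%N := tour_length_gt0 (Ordinal N0).
pose beta w := pr nu (La (enum_rank (w, Ordinal l0))).
have betaE w (j : 'I_l) : pr nu (La (enum_rank (w, j))) = beta w.
  case: j => j jl; elim: j jl => [|j IH] jl; first by congr (pr nu (La (enum_rank (w, _)))); apply/val_inj.
  by rewrite (La_next w (ltnW jl) jl) IH.
have reindexK (h : 'I_K -> R) : \sum_a h a = \sum_w \sum_(j < l) h (enum_rank (w, j)).
  rewrite pair_bigA /= (reindex (@enum_rank _)) /=; last first.
    by exists enum_val => x _; [exact: enum_rankK|exact: enum_valK].
  by apply: eq_bigr => -[].
pose xi (o : option 'I_K) := if o is Some a then La a else ~` horseshoe C.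
have hsm : measurable (horseshoe C : set (borel X)).
  apply: closed_borel; apply: compact_closed; first exact: metric_hausdorff.
  exact: horseshoe_compact.
have pxi : measurable_partition xi.
  split.
  - by case=> [a|]; [exact: La_borel|exact: measurableC].
  - move=> [a|] [b|] _ _ [y [ya yb]] //.
    + by congr Some; apply: La_triv => //; exists y.
    + by exfalso; apply: yb; rewrite -La_cover; exists a.
    + by exfalso; apply: ya; rewrite -La_cover; exists b.
  - apply/seteqP; split => // y _; have [|ny] := pselect (horseshoe C y); last by exists None.
    by rewrite -La_cover => -[a _ ya]; exists (Some a).
have nuC : pr nu (~` horseshoe C) = 0.
  by case: nuL => _ H; rewrite /pr probability_setC// H subee.
have big_opt (h : option 'I_K -> R) : \sum_o h o = h None + \sum_a h (Some a).
  rewrite (bigD1 None)//= (@reindex_omap _ _ _ _ _ Some id) /=; last by case.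
  by congr (_ + _); apply: eq_bigl => a; rewrite eqxx.
exists (fun w => l%:R * beta w); split.
- by move=> w; rewrite mulr_ge0// pr_ge0.
- move=> w wC; rewrite (_ : beta w = 0) ?mulr0// /beta (_ : La _ = set0) ?/pr ?measure0//.
  apply/seteqP; split => // y [v [Sv v0] _]; have := tower_mem Sv 0.
  by rewrite v0 enum_rankK (negbTE wC).
- have := pr_partition1 nu pxi; rewrite big_opt /= nuC add0r reindexK => H; rewrite -[RHS]H.
  apply: eq_bigr => w _; rewrite (eq_bigr (fun=> beta w)) ?sumr_const ?card_ord ?mulr_natl//.
move=> phi theta cphi osc.
pose co (o : option 'I_K) := if o is Some a then phi (pt a) else 0.
have := @Rintegral_approx R X hX nu _ xi phi co theta pxi cphi; rewrite big_opt /= mul0r add0r.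
rewrite reindexK; set s1 := \sum_w _ => H; set s2 := \sum_w _.
have -> : s2 = s1.
  apply: eq_bigr => w _; rewrite mulrC mulrA.
  rewrite (_ : _ / l%:R * l%:R = \sum_(x <- tour q m B (W w)) phi x); last first.
    by rewrite mulfVK// pnatr_eq0 -lt0n.
  rewrite (big_nth q) Wl big_mkord mulr_suml; apply: eq_bigr => j _.
  by rewrite betaE /tour_pt enum_rankK.
apply: H => -[a|]; last by left.
right => y [v [Sv va] vy]; apply: osc; rewrite -va; exact: (vy 0).
Qed.

End InvariantMeasures.
End Horseshoe.

(** * Metric entropy at a small scale *)

Section Regularity.
Context {R : realType} {X : pmetricType R}.
Local Notation bX := (borel X).
Variable mu : probability bX R.
Implicit Types A K U : set X.

(** Closed inner and open outer approximation at once: a form that passes to complements and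
    countable unions, so that it reaches all Borel sets. *)
Definition regular A := forall e : R, 0 < e -> exists K U,
  [/\ closed K, open U, K `<=` A, A `<=` U & pr mu (U `\` K) <= e].

Lemma pr_cvg0 (A : nat -> set X) (e : R) : 0 < e -> (forall n, measurable (A n : set bX)) ->
  (forall m n, (m <= n)%N -> A n `<=` A m) -> \bigcap_n A n = set0 ->
  exists n, pr mu (A n) <= e.
Proof.
move=> e0 mA dA A0.
have := @nonincreasing_cvg_mu _ bX R mu A.
rewrite A0 measure0 => /(_ _ mA _ _) H.
have {}H : mu \o A @ \oo --> (0 : \bar R).
  apply: H => //.
  - by rewrite (le_lt_trans (probability_le1 mu (mA 0%N)))// ltry.
  - by move=> m n mn; apply/subsetPset; exact: dA.
have /fine_cvgP[_ H2] := H.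
move/cvgrPdist_le : H2 => /(_ e e0)[n _ /(_ n (leqnn n))] /=.
by rewrite sub0r normrN => h; exists n; exact: le_trans (ler_norm _) h.
Qed.

Lemma open_regular A : open A -> regular A.
Proof.
move=> oA e e0.
pose K n := [set x : X | forall y, mdist x y < n.+1%:R^-1 -> A y].
have cK n : closed (K n).
  rewrite -openC openE => x /= /existsNP[y /not_implyP[xy nAy]].
  have xy0 : 0 < n.+1%:R^-1 - mdist x y by rewrite subr_gt0.
  apply: filterS (near_mdist x xy0) => z /= xz; apply/existsNP; exists y.
  apply/not_implyP; split => //; apply: le_lt_trans (metric_triangle z x y) _.
  by rewrite (metric_sym z x) -ltrBrDr.
have KA n : K n `<=` A by move=> x; apply; rewrite mdistxx.
have [|||n nP] := @pr_cvg0 (fun n => A `\` K n) e e0.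
- by move=> n; apply: measurableD; [exact: open_borel|exact: closed_borel].
- move=> m n mn x [Ax nKx]; split => // Kx; apply: nKx => y xy; apply: Kx.
  by apply: lt_le_trans xy _; rewrite lef_pV2 ?posrE// ler_nat.
- apply/seteqP; split => // x Hx; have [Ax _] := Hx 0%N Logic.I.
  have [r r0 rA] := nbhs_mdist_ex (open_nbhs_nbhs (conj oA Ax)).
  have [n nr] : exists n : nat, n.+1%:R^-1 < r.
    exists (Num.bound r^-1); rewrite -[ltRHS]invrK ltf_pV2 ?posrE ?invr_gt0//.
    by apply: lt_trans (archi_boundP _) _; rewrite ?invr_ge0 ?ltW// ltr_nat.
  by have [_] := Hx n Logic.I; apply => y xy; apply: rA; apply: lt_trans xy nr.
by exists (K n), A; split.
Qed.

Lemma regularC A : regular A -> regular (~` A).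
Proof.
move=> rA e e0; have [K [U [cK oU KA AU pe]]] := rA e e0.
exists (~` U), (~` K); split.
- exact: open_closedC.
- exact: closed_openC.
- exact: subsetC.
- exact: subsetC.
by rewrite (_ : ~` K `\` ~` U = U `\` K)// setDE setCK setIC.
Qed.

Lemma pr_bigcup_le (A : nat -> set X) (e : R) : 0 < e -> (forall n, measurable (A n : set bX)) ->
  (forall n, pr mu (A n) <= e * (2 ^+ n.+1)^-1) -> pr mu (\bigcup_n A n) <= e.
Proof.
move=> e0 mA H; rewrite -lee_fin prE; last exact: bigcup_measurable.
have := @measure_sigma_subadditive _ _ _ mu _ A mA (bigcup_measurable (fun n _ => mA n)) (@subset_refl _ _).
move=> h; apply: le_trans h _.
apply: (@le_trans _ _ (\sum_(n <oo) (e * (2 ^+ n.+1)^-1)%:E)%E).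
  by apply: lee_nneseries => n _ //; have := H n; rewrite -lee_fin prE.
apply: lime_le.
  by apply: is_cvg_nneseries => n _ _; rewrite lee_fin mulr_ge0// ?invr_ge0 ?exprn_ge0// ltW.
apply: nearW => n; rewrite sumEFin lee_fin -mulr_sumr -[leRHS]mulr1 ler_wpM2l ?(ltW e0)//.
have -> : \sum_(0 <= i < n) (2 ^+ i.+1)^-1 = 1 - (2 ^+ n)^-1 :> R.
  elim: n => [|n IH]; first by rewrite big_geq// expr0 invr1 subrr.
  rewrite big_nat_recr//= IH exprS invfM; lra.
by rewrite gerBl invr_ge0 exprn_ge0.
Qed.

Lemma regular_bigcup (A : nat -> set X) : (forall n, regular (A n)) -> regular (\bigcup_n A n).
Proof.
move=> rA e e0; have e2 : 0 < e / 2 by rewrite divr_gt0.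
have H n : exists KU : set X * set X, [/\ closed KU.1, open KU.2, KU.1 `<=` A n, A n `<=` KU.2 &
    pr mu (KU.2 `\` KU.1) <= e / 2 * (2 ^+ n.+1)^-1].
  have [|K [U [h1 h2 h3 h4 h5]]] := rA n (e / 2 * (2 ^+ n.+1)^-1).
    by rewrite mulr_gt0// invr_gt0 exprn_gt0.
  by exists (K, U).
have [KU KUP] := choice H.
(* An infinite union of the closed parts may fail to be closed, so [K n] stops at [n]; one half of
   [e] pays for the approximations [D], the other for the missing tail. *)
pose U := \bigcup_n (KU n).2; pose K n := \bigcup_(i in [set i | (i < n)%N]) (KU i).1.
have oU : open U by apply: bigcup_open => n _; have [] := KUP n.
have cK n : closed (K n).
  rewrite /K; apply: closed_bigcup => [|i _]; last by have [] := KUP i.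
  exact: finite_II.
pose D := \bigcup_n ((KU n).2 `\` (KU n).1).
have mD : measurable (D : set bX).
  apply: bigcup_measurable => n _; have [h1 h2 _ _ _] := KUP n.
  by apply: measurableD; [exact: open_borel|exact: closed_borel].
have DP : pr mu D <= e / 2.
  apply: pr_bigcup_le => // n; have [h1 h2 _ _ h] := KUP n => //.
  by apply: measurableD; [exact: open_borel|exact: closed_borel].
have mUK n : measurable (U `\` K n : set bX).
  by apply: measurableD; [exact: open_borel|exact: closed_borel].
have [|||n nP] := @pr_cvg0 (fun n => (U `\` K n) `\` D) (e / 2) e2.
- by move=> n; apply: measurableD.
- move=> m n mn x [[Ux nKx] nDx]; split => //; split => // -[i im Ki]; apply: nKx.
  by exists i => //=; rewrite (leq_trans im).
- apply/seteqP; split => // x Hx; have [[[i _ Ui] _] nD] := Hx 0%N Logic.I.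
  have [Ki|nKi] := pselect ((KU i).1 x); last by apply: nD; exists i.
  by have [[_ +] _] := Hx i.+1 Logic.I; apply; exists i => /=.
exists (K n), U; split => //.
- by move=> x [i _ Ki]; exists i => //; have [_ _ h _ _] := KUP i; exact: h.
- by move=> x [i _ Ai]; exists i => //; have [_ _ _ h _] := KUP i; exact: h.
have : pr mu (U `\` K n) <= pr mu (((U `\` K n) `\` D) `|` D).
  apply: pr_le => //; first by apply: measurableU => //; apply: measurableD.
  by move=> x xU; have [xD|xD] := pselect (D x); [right|left].
move=> h; apply: le_trans h _; rewrite [leRHS]splitr.
apply: le_trans (lerD nP DP).
rewrite -lee_fin EFinD !prE//; last 2 first.
- by apply: measurableD.
- by apply: measurableU => //; apply: measurableD.
by apply: measureU2 => //; apply: measurableD.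
Qed.

Lemma borel_regular A : measurable (A : set bX) -> regular A.
Proof.
move: A; apply: smallest_sub; last by move=> A; exact: open_regular.
split => [|A rA|A rA].
- by apply: open_regular; exact: open0.
- by rewrite setTD; exact: regularC.
- exact: regular_bigcup.
Qed.

Lemma closed_inner A (e : R) : measurable (A : set bX) -> 0 < e ->
  exists K, [/\ closed K, K `<=` A & pr mu (A `\` K) <= e].
Proof.
move=> mA e0; have [K [U [cK oU KA AU pe]]] := borel_regular mA e0.
exists K; split => //; apply: le_trans pe; apply: pr_le.
- by apply: measurableD => //; exact: closed_borel.
- by apply: measurableD; [exact: open_borel|exact: closed_borel].
- by move=> x [Ax nK]; split => //; exact: AU.
Qed.

End Regularity.

Lemma closed_disjoint_dist {R : realType} {X : metricType R} (K K' : set X) :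
  compact [set: X] -> closed K -> closed K' -> K `&` K' = set0 ->
  exists2 e : R, 0 < e & forall x y, K x -> K' y -> e <= mdist x y.
Proof.
move=> hX cK cK' KK'.
have cptK : compact K by apply: (subclosed_compact cK hX).
move/compact_near_coveringP : cptK.
move=> /(_ _ (nbhs (0 : R)^'+) (fun d x => forall y, K' y -> d <= mdist x y)) [].
  move=> x Kx.
  have nK' : ~ K' x by move=> K'x; have : (K `&` K') x by []; rewrite KK'.
  have oK' : open (~` K') by exact: closed_openC.
  have [d d0 dP] := nbhs_mdist_ex (open_nbhs_nbhs (conj oK' nK')).
  exists ([set y | mdist x y < d / 2], [set r | r < d / 2]) => /=.
    split; first by apply: near_mdist; rewrite divr_gt0.
    by apply: nbhs_right_lt; rewrite divr_gt0.
  move=> [y r] /= [h1 h2] z K'z; rewrite leNgt; apply/negP => h3.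
  by apply: (dP z) => //; apply: mdist_lt_split h1 (lt_trans h3 h2).
move=> d /= d0 dP; exists (d / 2); first by rewrite divr_gt0.
have d2 : 0 < d / 2 by rewrite divr_gt0.
move=> x y Kx K'y; apply: (dP (d / 2)) => //=.
by rewrite /ball_ sub0r normrN gtr0_norm// ltr_pdivrMr// ltr_pMr// ltr1n.
Qed.

Lemma finite_lower_bound {R : realType} (I : finType) (h : I -> R) : (forall i, 0 < h i) ->
  exists2 e, 0 < e & forall i, e <= h i.
Proof.
move=> h0; have S0 : 0 <= \sum_i (h i)^-1 by apply: sumr_ge0 => i _; rewrite invr_ge0 ltW.
(* The [+ 1] keeps the bound positive when [I] is empty. *)
exists (\sum_i (h i)^-1 + 1)^-1; first by rewrite invr_gt0 ltr_wpDl.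
move=> i; rewrite -[leRHS]invrK lef_pV2 ?posrE ?invr_gt0// ?ltr_wpDl//.
rewrite (bigD1 i)//= -addrA lerDl addr_ge0// sumr_ge0// => j _.
by rewrite invr_ge0 ltW.
Qed.

(** * Shannon entropy and the Gibbs inequality *)

Section ShannonEntropy.
Context {R : realType}.

Definition shannon (I : finType) (p : I -> R) : R := - \sum_i p i * ln (p i).

(** Termwise from [ln t <= t - 1] at [t = Q i / P i]. *)
Lemma gibbs (I : finType) (P Q : I -> R) :
  (forall i, 0 <= P i) -> (forall i, 0 <= Q i) -> \sum_i Q i <= \sum_i P i ->
  (forall i, 0 < P i -> 0 < Q i) -> shannon P <= - \sum_i P i * ln (Q i).
Proof.
move=> P0 Q0 QP PQ; rewrite lerN2.
have H i : P i * ln (Q i) <= P i * ln (P i) + (Q i - P i).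
  have [<-|Pn] := eqVneq 0 (P i); first by rewrite !mul0r subr0 add0r.
  have Pi : 0 < P i by rewrite lt_neqAle Pn P0.
  have Qi := PQ i Pi; rewrite -lerBlDl -mulrBr -ln_div ?posrE//.
  rewrite -[X in ln X](subrK 1) addrC.
  have : ln (1 + (Q i / P i - 1)) <= Q i / P i - 1.
    by apply: le_ln1Dx; rewrite ltrBrDl subrr divr_gt0.
  move=> /(ler_wpM2l (P0 i)) h; apply: le_trans h _.
  by rewrite mulrBr mulr1 mulrC divfK// gt_eqF.
apply: le_trans (ler_sum _ (fun i _ => H i)) _.
by rewrite big_split /= sumrB gerDl subr_le0.
Qed.

Lemma ln_prod (I : finType) (h : I -> R) : (forall i, 0 < h i) ->
  ln (\prod_i h i) = \sum_i ln (h i).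
Proof.
move=> h0; suff: 0 < \prod_i h i /\ ln (\prod_i h i) = \sum_i ln (h i) by case.
apply: (big_rec2 (fun x y => 0 < x /\ ln x = y)); first by rewrite ln1.
by move=> i x y _ [x0 <-]; rewrite mulr_gt0// lnM // posrE.
Qed.

Lemma shannon_le_ln (I : finType) (p : I -> R) : (forall i, 0 <= p i) -> \sum_i p i = 1 ->
  shannon p <= ln #|I|%:R.
Proof.
move=> p0 p1; have I0 : 0 < #|I|%:R :> R.
  rewrite ltr0n lt0n; apply/eqP => /card0_eq I0.
  by move: p1; rewrite big1 => [/eqP|i _]; [rewrite eq_sym oner_eq0|have := I0 i].
apply: le_trans (@gibbs _ p (fun=> #|I|%:R^-1) p0 _ _ _) _.
- by move=> _; rewrite invr_ge0.
- by rewrite p1 sumr_const -[_ *+ _]mulr_natr mulVf// gt_eqF.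
- by move=> _ _; rewrite invr_gt0.
by rewrite -mulr_suml p1 mul1r lnV// opprK.
Qed.

End ShannonEntropy.

Section NameEntropy.
Context {R : realType} {X : pmetricType R} (f : X -> X).
Hypotheses (hX : compact [set: X]) (cf : continuous f).
Local Notation bX := (borel X).
Variable mu : probability bX R.
Hypothesis inv : invariant_measure f mu.

Lemma join_partition k (xi : 'I_k -> set X) n : finite_partition xi ->
  measurable_partition (join_atom f xi (n := n)).
Proof.
move=> [mxi txi cxi]; split.
- move=> w; apply: fin_bigcap_measurable; first exact: finite_finset.
  by move=> j _; apply: continuous_preimage_borel (mxi _); exact: iter_continuous.
- move=> w w' _ _ [x [xw xw']]; apply/ffunP => j; apply: (txi _ _ Logic.I Logic.I).
  by exists (iter j f x); split; [exact: xw|exact: xw'].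
- apply/seteqP; split => // x _.
  have H (j : 'I_n) : exists a, xi a (iter j f x).
    by have : (\bigcup_a xi a) (iter j f x); [rewrite cxi|move=> [a _ xa]; exists a].
  have [w wP] := choice H; exists (finfun w) => // j _ /=.
  by rewrite /preimage /= ffunE.
Qed.

(* Given the cell of the second partition containing [x], the name of [x] is guessed
   correctly at all times at which the orbit of [x] meets the compact cores of the
   atoms; comparing with the product law of such guesses bounds the entropy. *)
Lemma name_entropy_le k (xi : 'I_k -> set X) (theta : R) : finite_partition xi ->
  0 < theta -> theta < 1 ->
  exists2 e : R, 0 < e & forall (n s : nat) (ys : 'I_s -> X) (eta : 'I_s -> set X),
    measurable_partition eta ->
    (forall i x, eta i x -> forall t : 'I_n, mdist (iter t f x) (iter t f (ys i)) <= e) ->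
    join_entropy mu f n xi <=
      shannon (fun i => pr mu (eta i)) + n%:R * (- ln (1 - theta) + theta * ln (k%:R / theta)).
Proof.
move=> pxi th0 th1; have [mxi txi cxi] := pxi.
have k0 : (0 < k)%N.
  have : (\bigcup_a xi a) point by rewrite cxi.
  by move=> [[a ak] _ _]; apply: leq_ltn_trans ak.
have kR : 0 < k%:R :> R by rewrite ltr0n.
have H a : exists K, [/\ closed K, K `<=` xi a & pr mu (xi a `\` K) <= theta / k%:R].
  by apply: closed_inner => //; rewrite divr_gt0.
have [K KP] := choice H.
have Hab (ab : 'I_k * 'I_k) : exists e : R, 0 < e /\
    (ab.1 != ab.2 -> forall x y, K ab.1 x -> K ab.2 y -> e <= mdist x y).
  have [->|ne] := eqVneq ab.1 ab.2; first by exists 1.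
  have [|||e e0 eP] := @closed_disjoint_dist R X (K ab.1) (K ab.2) hX.
  - by have [] := KP ab.1.
  - by have [] := KP ab.2.
  - apply/seteqP; split => // x [x1 x2]; have [_ h1 _] := KP ab.1; have [_ h2 _] := KP ab.2.
    move/eqP : ne => [] //; apply: txi => //.
    by exists x; split; [exact: h1|exact: h2].
  by exists e.
have [h hP] := choice Hab.
have [e0 e00 e0P] := finite_lower_bound (fun ab => proj1 (hP ab)).
(* Two points within [e0 / 3] of a third are less than [e0] apart, so at most one core meets the
   ball around a point; its index is the guess [b]. *)
exists (e0 / 3); first by rewrite divr_gt0.
move=> n s ys eta peta etaP; have [meta teta ceta] := peta.
have Hb (ti : 'I_n * 'I_s) : exists b : 'I_k, forall a x, K a x ->
    mdist x (iter ti.1 f (ys ti.2)) <= e0 / 3 -> a = b.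
  have [[b [x [Kx xb]]]|nb] := pselect (exists b x, K b x /\ mdist x (iter ti.1 f (ys ti.2)) <= e0 / 3).
    exists b => a z Kz za; apply: contrapT => /eqP ab.
    have := (proj2 (hP (a, b))) ab z x Kz Kx; have := e0P (a, b).
    have := metric_triangle z (iter ti.1 f (ys ti.2)) x.
    rewrite (metric_sym (iter ti.1 f (ys ti.2)) x); have := e00; lra.
  by exists (Ordinal k0) => a x Kx xa; exfalso; apply: nb; exists a, x.
have [b bP] := choice Hb.
have pjoin := join_partition n pxi; have [mj tj cj] := pjoin.
pose P (z : {ffun 'I_n -> 'I_k} * 'I_s) := pr mu (join_atom f xi z.1 `&` eta z.2).
(* A guess has weight [1 - theta] if right and [theta / k] for each wrong letter, hence total weight
   at most 1. *)
pose kap (a b : 'I_k) : R := if a == b then 1 - theta else theta / k%:R.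
pose Q (z : {ffun 'I_n -> 'I_k} * 'I_s) :=
  pr mu (eta z.2) * \prod_(t < n) kap (z.1 t) (b (t, z.2)).
have kap0 a a' : 0 < kap a a' by rewrite /kap; case: ifP => _; rewrite ?subr_gt0// divr_gt0.
have P0 z : 0 <= P z by exact: pr_ge0.
have Pw w : pr mu (join_atom f xi w) = \sum_i P (w, i) by rewrite (pr_partition mu peta (mj w)).
have Pi i : pr mu (eta i) = \sum_w P (w, i).
  by rewrite (pr_partition mu pjoin (meta i)); apply: eq_bigr => w _; rewrite setIC.
have P1 : \sum_z P z = 1.
  rewrite -(pr_partition1 mu peta) -(pair_bigA _ (fun w i => P (w, i)))/= exchange_big.
  by apply: eq_bigr => i _; rewrite Pi.
have step1 : join_entropy mu f n xi <= shannon P.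
  rewrite /join_entropy /shannon lerN2 -(pair_bigA _ (fun w i => P (w, i) * ln (P (w, i))))/=.
  apply: ler_sum => w _; rewrite -/(pr mu (join_atom f xi w)) {1}Pw mulr_suml.
  apply: ler_sum => i _; have [<-|Pn] := eqVneq 0 (P (w, i)); first by rewrite !mul0r.
  have Pwi : 0 < P (w, i) by rewrite lt_neqAle Pn P0.
  have le : P (w, i) <= pr mu (join_atom f xi w).
    by rewrite Pw (bigD1 i)//= lerDl sumr_ge0.
  by rewrite ler_wpM2l// ler_ln// posrE (lt_le_trans Pwi).
have step2 : shannon P <= - \sum_z P z * ln (Q z).
  apply: gibbs => //.
  - by move=> z; rewrite mulr_ge0 ?pr_ge0// prodr_ge0// => t _; rewrite ltW.
  - rewrite P1 -(pr_partition1 mu peta).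
    rewrite -(pair_bigA _ (fun w i => Q (w, i)))/= exchange_big /=.
    apply: ler_sum => i _; rewrite /Q /= -mulr_sumr -[leRHS]mulr1 ler_wpM2l ?pr_ge0//.
    rewrite -(bigA_distr_bigA (fun (t : 'I_n) a => kap a (b (t, i)))) /=.
    apply: prodr_ile1 => t _; apply/andP; split.
      by apply: sumr_ge0 => a _; rewrite ltW.
    rewrite (bigD1 (b (t, i)))//= {1}/kap eqxx.
    rewrite (eq_bigr (fun=> theta / k%:R)) => [|a /negbTE]; last by rewrite /kap => ->.
    rewrite sumr_const cardC1 card_ord -[_ *+ _]mulr_natr.
    rewrite -lerBrDl opprB addrC subrK -mulrA ger_pMr// mulrC ler_pdivrMr// mul1r.
    by rewrite ler_nat leq_pred.
  - move=> [w i] Pz; rewrite mulr_gt0//; last by apply: prodr_gt0.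
    by rewrite Pi (bigD1 w)//= ltr_wpDr// sumr_ge0.
apply: le_trans step1 (le_trans step2 _).
have QE z : P z * ln (Q z) = P z * ln (pr mu (eta z.2)) +
    \sum_(t < n) P z * ln (kap (z.1 t) (b (t, z.2))).
  have [<-|Pn] := eqVneq 0 (P z).
    by rewrite !mul0r add0r big1// => t _; rewrite mul0r.
  have Pz : 0 < P z by rewrite lt_neqAle Pn P0.
  have pe : 0 < pr mu (eta z.2).
    by rewrite Pi (bigD1 z.1)//= -surjective_pairing ltr_wpDr// sumr_ge0.
  by rewrite lnM ?posrE//; [rewrite mulrDr ln_prod// mulr_sumr|apply: prodr_gt0].
rewrite (eq_bigr _ (fun z _ => QE z)) big_split /= opprD; apply: lerD.
  rewrite /shannon lerN2 -(pair_bigA _ (fun w i => P (w, i) * ln (pr mu (eta i))))/= exchange_big /=.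
  by apply: ler_sum => i _; rewrite Pi mulr_suml.
rewrite exchange_big /= -sumrN -[n in n%:R]card_ord mulr_natl -sumr_const.
apply: ler_sum => t _.
have c1 : 0 <= - ln (1 - theta) by rewrite oppr_ge0 ln_le0// gerBl ltW.
have c2 : 0 <= ln (k%:R / theta).
  by rewrite ln_ge0// ler_pdivlMr// mul1r (le_trans (ltW th1))// ler1n.
have kapE (z : {ffun 'I_n -> 'I_k} * 'I_s) : - (P z * ln (kap (z.1 t) (b (t, z.2)))) <=
    P z * (- ln (1 - theta)) + (if z.1 t != b (t, z.2) then P z else 0) * ln (k%:R / theta).
  rewrite -mulrN /kap; case: eqP => _ /=; first by rewrite mul0r addr0.
  have -> : ln (k%:R / theta) = - ln (theta / k%:R).
    by rewrite -lnV ?posrE ?divr_gt0// invf_div.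
  by rewrite lerDr mulr_ge0.
rewrite -sumrN; apply: le_trans (ler_sum _ (fun z _ => kapE z)) _.
rewrite big_split /= -!mulr_suml P1 mul1r lerD2l ler_wpM2r//.
rewrite -big_mkcond /=.
(* A wrong guess at time [t] means that the orbit is then outside all cores, an event of mass at
   most [theta] by invariance. *)
pose D := ~` \bigcup_a K a.
have mK : measurable (\bigcup_a K a : set bX).
  by apply: fin_bigcup_measurable => [|a _]; [exact: finite_finset|apply: closed_borel; have [] := KP a].
have mD : measurable (D : set bX) by exact: measurableC.
have DP : pr mu D <= theta.
  have -> : D = \bigcup_a (xi a `\` K a).
    apply/seteqP; split => x.
      move=> nx; have : (\bigcup_a xi a) x by rewrite cxi.
      by move=> [a _ xa]; exists a => //; split => // Ka; apply: nx; exists a.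
    move=> [a _ [xa nKa]] [a' _ Ka']; apply: nKa.
    rewrite (_ : a = a')//; apply: txi => //; exists x; split => //.
    by have [_ h1 _] := KP a'; exact: h1.
  rewrite pr_bigcup; last 2 first.
  - by move=> a; apply: measurableD => //; apply: closed_borel; have [] := KP a.
  - by move=> a a' _ _ [x [[x1 _] [x2 _]]]; apply: txi => //; exists x.
  apply: (@le_trans _ _ (\sum_(a : 'I_k) theta / k%:R)).
    by apply: ler_sum => a _; have [] := KP a.
  by rewrite sumr_const card_ord -[_ *+ _]mulr_natr divfK// gt_eqF.
pose xi2 (z : {ffun 'I_n -> 'I_k} * 'I_s) := join_atom f xi z.1 `&` eta z.2.
have pxi2 : measurable_partition xi2.
  split.
  - by move=> z; apply: measurableI.
  - move=> [w i] [w' i'] _ _ [x [[/= h1 h2] [h3 h4]]]; congr pair.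
      by apply: tj => //; exists x.
    by apply: teta => //; exists x.
  - apply/seteqP; split => // x _.
    have /seteqP[_ /(_ x Logic.I)[w _ xw]] := cj.
    have /seteqP[_ /(_ x Logic.I)[i _ xi']] := ceta.
    by exists (w, i).
rewrite -(pr_sum mu (fun z : {ffun 'I_n -> 'I_k} * 'I_s => z.1 t != b (t, z.2)) pxi2).
apply: le_trans DP; rewrite -(pr_iter t cf inv mD); apply: pr_le.
- by apply: fin_bigcup_measurable => [|z _]; [exact: finite_finset|apply: measurableI].
- by apply: continuous_preimage_borel mD; exact: iter_continuous.
move=> x [[w i] /= wt [xw xi']] [a _ Ka]; move/eqP: wt; apply.
have [_ Kxi _] := KP a.
have -> : w t = a.
  by apply: txi => //; exists (iter t f x); split; [exact: xw|exact: Kxi].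
by apply: (bP (t, i) a (iter t f x)) => //=; exact: etaP.
Qed.

End NameEntropy.

Section Limits.
Context {R : realType}.
Implicit Types u : nat -> R.

Lemma limn_dvg u : ~ cvgn u -> limn u = 0.
Proof. by move=> ncu; rewrite dvgP. Qed.

(** [limn] is 0 on a divergent sequence, so for nonnegative sequences the bound holds in any case
    and convergence of the entropy rates is never discussed. *)
Lemma eventually_ge_limn u e : (forall n, 0 <= u n) -> 0 < e ->
  exists n0 : nat, forall n, (n0 <= n)%N -> limn u - e <= u n.
Proof.
move=> u0 e0; have [cu|ncu] := pselect (cvgn u).
  have /cvgrPdist_le /(_ e e0)[n0 _ n0P] := cu.
  exists n0 => n n0n; have := n0P n n0n; rewrite /= ler_norml => /andP[_]; lra.
exists 0%N => n _; rewrite limn_dvg// sub0r; apply: le_trans (u0 n).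
by rewrite oppr_le0 ltW.
Qed.

Lemma limn_le_eventually u M n0 : 0 <= M -> (forall n, (n0 <= n)%N -> u n <= M) -> limn u <= M.
Proof.
move=> M0 uM; have [cu|ncu] := pselect (cvgn u); last by rewrite limn_dvg.
by apply: limr_le => //; exists n0.
Qed.

Lemma small_entropy_defect (k : nat) (kap : R) : (0 < k)%N -> 0 < kap ->
  exists theta : R, [/\ 0 < theta, theta < 1 &
    - ln (1 - theta) + theta * ln (k%:R / theta) <= kap].
Proof.
move=> k0 kap0; have lk : 0 <= ln (k%:R : R) by rewrite ln_ge0// ler1n.
(* With [theta = s ^+ 2] the logarithm of [1 / theta] is at most [2 / s], so both terms are of order
   [s]; the sum is at most [s * (4 + ln k)]. *)
pose s := Num.min 2^-1 (kap / (4 + ln k%:R)).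
have d0 : 0 < 4 + ln k%:R :> R by rewrite ltr_wpDr.
have s0 : 0 < s by rewrite lt_min invr_gt0 ltr0n /= divr_gt0.
have s2 : s <= 2^-1 by rewrite ge_min lexx.
have sk : s * (4 + ln k%:R) <= kap by rewrite -ler_pdivlMr// ge_min lexx orbT.
have ss : s ^+ 2 <= s / 2 by rewrite expr2 ler_wpM2l// ltW.
have th0 : 0 < s ^+ 2 by rewrite exprn_gt0.
have th1 : s ^+ 2 < 1 by apply: le_lt_trans ss _; lra.
exists (s ^+ 2); split => //.
have h1 : - ln (1 - s ^+ 2) <= 2 * s ^+ 2.
  rewrite -lnV ?posrE ?subr_gt0//.
  have v0 : 0 < 1 - s ^+ 2 by rewrite subr_gt0.
  have := @le_ln1Dx R (s ^+ 2 / (1 - s ^+ 2)).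
  have -> : 1 + s ^+ 2 / (1 - s ^+ 2) = (1 - s ^+ 2)^-1 by field; rewrite gt_eqF.
  have h0 : 0 <= s ^+ 2 / (1 - s ^+ 2) by rewrite divr_ge0// ltW.
  move=> /(_ (lt_le_trans _ h0)) h; apply: le_trans (h _) _; first by rewrite ltrN10.
  by rewrite ler_pdivrMr//; nra.
have h2 : ln (k%:R / s ^+ 2) <= ln k%:R + 2 / s.
  rewrite ln_div ?posrE ?ltr0n// lerD2l -lnV ?posrE// -exprVn lnXn ?invr_gt0//.
  by rewrite -[leLHS]mulr_natl ler_pM2l// ltW// ln_sublinear// invr_gt0.
have h3 : s ^+ 2 * ln (k%:R / s ^+ 2) <= s * ln k%:R + 2 * s.
  apply: le_trans (ler_wpM2l (ltW th0) h2) _.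
  rewrite mulrDr lerD//; first by rewrite ler_wpM2r//; apply: le_trans ss _; lra.
  by rewrite expr2 mulrAC mulrA mulrAC -mulrA divff ?gt_eqF// mulr1 mulrC.
by apply: le_trans (lerD h1 h3) (le_trans _ sk); nra.
Qed.

End Limits.

(** * Separated and spanning families, and bounds on metric entropy *)

Section SpanningEntropy.
Context {R : realType} {X : pmetricType R} (f g : X -> X).
Hypotheses (hX : compact [set: X]) (cf : continuous f) (cg : continuous g).
Hypotheses (fK : cancel f g) (gK : cancel g f).
Local Notation F := (ziter f g).
Variable c : R.
Hypothesis c0 : 0 < c.
Hypothesis hc : forall x y, x <> y -> exists i, c < mdist (F i x) (F i y).

Definition separated_family (n : nat) (e : R) (s : nat) (ys : 'I_s -> X) :=
  forall i j, i != j -> exists t : 'I_n, e < mdist (iter t f (ys i)) (iter t f (ys j)).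

Definition spanning_family (n : nat) (e : R) (s : nat) (ys : 'I_s -> X) :=
  forall x, exists i, forall t : 'I_n, mdist (iter t f x) (iter t f (ys i)) <= e.

(** Itineraries through a finite [c / 2]-net over the times from [- N] to [n + N] tell separated
    points apart: equal ones would keep the orbits within [c], hence the points within [e]. The base
    [A] is independent of the scale [e]. *)
Lemma separated_card : exists A : nat, (0 < A)%N /\ forall e : R, 0 < e -> exists N : nat,
  forall n s (ys : 'I_s -> X), separated_family n e ys -> (s <= A ^ (n + N))%N.
Proof.
have c2 : 0 < c / 2 by rewrite divr_gt0.
have [cs csP] := finite_net hX c2; pose A := size cs.
have A0 : (0 < A)%N by have [y] := csP point; rewrite /A; case: (cs).
exists A; split => // e e0; have [N NP] := expansive_unif hX cf cg hc e0.
exists (N + N)%N => n s ys sep.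
have H x : exists i : 'I_A, mdist (tnth (in_tuple cs) i) x < c / 2.
  have [y ycs yx] := csP x; have /tnthP[i yi] : y \in in_tuple cs by [].
  by exists i; rewrite -yi.
have [a aP] := choice H.
pose code i := [ffun t : 'I_(n + (N + N)) => a (F (t%:Z - N%:Z) (ys i))].
have code_inj : injective code.
  move=> i j ij; apply/eqP/contraT => /sep[t]; rewrite ltNge => /negP[]; apply/ltW/NP => z zN.
  have tl : (`|(t%:Z + z + N%:Z)%R|%N < n + (N + N))%N by have := ltn_ord t; lia.
  have /ffunP /(_ (Ordinal tl)) := ij; rewrite !ffunE /=.
  have -> : `|(t%:Z + z + N%:Z)%R|%N%:Z - N%:Z = z + t%:Z by lia.
  rewrite !(ziterD fK gK) !ziter_nat => aE.
  apply/ltW; apply: (@mdist_lt_split _ _ _ (tnth (in_tuple cs) (a (F z (iter t f (ys i)))))).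
    by rewrite metric_sym.
  by rewrite aE.
have := leq_card code code_inj.
by rewrite card_ord card_ffun !card_ord.
Qed.

(** A separated family of maximal size spans; the previous count guarantees a maximum. *)
Lemma exists_spanning (n : nat) (e : R) : 0 < e ->
  exists s (ys : 'I_s -> X), separated_family n e ys /\ spanning_family n e ys.
Proof.
move=> e0; have [A [A0 AP]] := separated_card; have [N NP] := AP e e0.
pose P s := `[< exists ys : 'I_s -> X, separated_family n e ys >].
have exP : exists s, P s by exists 0%N; apply/asboolP; exists (fun=> point) => -[].
have bndP s : P s -> (s <= A ^ (n + N))%N by move=> /asboolP[ys]; exact: NP.
have [s /asboolP[ys sep] smax] := ex_maxnP exP bndP.
exists s, ys; split => // x; apply: contrapT => nx.
have : P s.+1.
  apply/asboolP; exists (fun i => if unlift ord_max i is Some j then ys j else x).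
  have H i : exists t : 'I_n, e < mdist (iter t f x) (iter t f (ys i)).
    apply: contrapT => nt; apply: nx; exists i => t; rewrite leNgt; apply/negP => lt.
    by apply: nt; exists t.
  move=> i j; case: unliftP => [i' ->|->]; case: unliftP => [j' ->|->] //.
  - by rewrite (inj_eq (@lift_inj _ _)); exact: sep.
  - by move=> _; have [t tP] := H i'; exists t; rewrite metric_sym.
  - by rewrite eqxx.
by move=> /smax; rewrite ltnn.
Qed.

Lemma spanning_partition (n : nat) (e : R) s (ys : 'I_s -> X) : spanning_family n e ys ->
  exists eta : 'I_s -> set X, measurable_partition eta /\
    forall i x, eta i x -> forall t : 'I_n, mdist (iter t f x) (iter t f (ys i)) <= e.
Proof.
move=> span.
pose U (i : 'I_s) := \bigcap_(t : 'I_n) (iter t f @^-1` [set x | mdist (iter t f (ys i)) x <= e]).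
have [||eta [peta etaU]] := @first_hit_partition R X s U.
- move=> i; apply: fin_bigcap_measurable; first exact: finite_finset.
  move=> t _; apply: continuous_preimage_borel; first exact: iter_continuous.
  by apply: closed_borel; exact: closed_mdist.
- apply/seteqP; split => // x _; have [i ix] := span x; exists i => // t _.
  by rewrite /preimage /= metric_sym.
exists eta; split => // i x /etaU Ux t; rewrite metric_sym; exact: Ux.
Qed.

Lemma join_entropy_ge0 (mu : probability (borel X) R) n k (xi : 'I_k -> set X) :
  finite_partition xi -> 0 <= join_entropy mu f n xi.
Proof.
move=> pxi; rewrite /join_entropy oppr_ge0; apply: sumr_le0 => w _.
have [mj _ _] := join_partition cf n pxi.
apply: mulr_ge0_le0; first exact: fine_ge0.
apply: ln_le0; rewrite -/(pr mu _) -lee_fin prE//; exact: probability_le1.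
Qed.

Lemma partition_size_gt0 k (xi : 'I_k -> set X) : finite_partition xi -> (0 < k)%N.
Proof.
move=> [_ _ /seteqP[_ /(_ point Logic.I)]].
by move=> [[a ak] _ _]; apply: leq_ltn_trans ak.
Qed.

(** The base [A] serves all scales and all measures. Of the extra 2, one unit absorbs the defect of
    the name estimate, the other [N * ln A] for large [n]. *)
Lemma metric_entropy_bounded : exists M : R, forall mu : probability (borel X) R,
  invariant_measure f mu -> (metric_entropy mu f <= M%:E)%E.
Proof.
have [A [A0 AP]] := separated_card.
have lA : 0 <= ln (A%:R : R) by rewrite ln_ge0// ler1n.
exists (ln A%:R + 2) => mu inv; apply: ge_ereal_sup => _ [k [xi [pxi ->]]].
rewrite lee_fin; have [theta [th0 th1 thP]] := small_entropy_defect (partition_size_gt0 pxi) (@ltr01 R).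
have [e e0 eP] := name_entropy_le hX cf inv pxi th0 th1.
have [N NP] := AP e e0.
apply: (@limn_le_eventually _ _ _ (Num.bound (N%:R * ln (A%:R : R))).+1); first by rewrite addr_ge0.
move=> n nN; have n0 : 0 < n%:R :> R by rewrite ltr0n; apply: leq_trans nN.
rewrite ler_pdivrMr//.
have [s [ys [sep span]]] := exists_spanning n e0.
have [eta [peta etaP]] := spanning_partition span.
apply: le_trans (eP n s ys eta peta etaP) _.
have h1 : shannon (fun i => pr mu (eta i)) <= (n + N)%N%:R * ln A%:R.
  apply: le_trans (shannon_le_ln _ (pr_partition1 mu peta)) _; first by move=> i; exact: pr_ge0.
  rewrite card_ord mulr_natl -lnXn ?ltr0n// -natrX.
  have s0 : (0 < s)%N by have [i _] := span point; apply: leq_ltn_trans (ltn_ord i).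
  by rewrite ler_ln ?posrE ?ltr0n ?expn_gt0 ?A0// ler_nat; exact: NP sep.
have h2 : N%:R * ln A%:R <= n%:R :> R.
  apply: ltW; apply: lt_le_trans (archi_boundP _) _; first by rewrite mulr_ge0.
  by rewrite ler_nat ltnW.
have h3 : n%:R * (- ln (1 - theta) + theta * ln (k%:R / theta)) <= n%:R.
  by rewrite ler_piMr// ltW.
apply: le_trans (lerD h1 h3) _; rewrite natrD; lra.
Qed.

Lemma metric_entropy_fin (mu : probability (borel X) R) : invariant_measure f mu ->
  metric_entropy mu f \is a fin_num.
Proof.
move=> inv; have [M MP] := metric_entropy_bounded; rewrite fin_numE; apply/andP; split; last first.
  by rewrite -ltey (le_lt_trans (MP mu inv))// ltry.
rewrite -ltNye; apply: lt_le_trans (ereal_sup_ubound _); last first.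
  exists 1%N, (fun=> setT); split; last by [].
  split => //; last by apply/seteqP; split => // x _; exists ord0.
  by move=> a b _ _ _; rewrite !ord1.
by rewrite ltNyr.
Qed.

(** Three losses of [eta0 / 3]: an almost optimal partition, an almost attained limit, and the
    defect in [name_entropy_le]. *)
Lemma shannon_spanning_ge m (mu : 'I_m -> probability (borel X) R) (eta0 : R) :
  (forall i, invariant_measure f (mu i)) -> 0 < eta0 ->
  exists2 e0 : R, 0 < e0 & forall e, e <= e0 -> exists n0 : nat, forall n, (n0 <= n)%N ->
    forall s (ys : 'I_s -> X) (eta : 'I_s -> set X), measurable_partition eta ->
    (forall i x, eta i x -> forall t : 'I_n, mdist (iter t f x) (iter t f (ys i)) <= e) ->
    forall i, n%:R * (fine (metric_entropy (mu i) f) - eta0) <= shannon (fun a => pr (mu i) (eta a)).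
Proof.
move=> inv eta00; have e3 : 0 < eta0 / 3 by rewrite divr_gt0.
have H i : exists en : R * nat, 0 < en.1 /\ forall e, e <= en.1 -> forall n, (en.2 <= n)%N ->
    forall s (ys : 'I_s -> X) (eta : 'I_s -> set X), measurable_partition eta ->
    (forall i x, eta i x -> forall t : 'I_n, mdist (iter t f x) (iter t f (ys i)) <= e) ->
    n%:R * (fine (metric_entropy (mu i) f) - eta0) <= shannon (fun a => pr (mu i) (eta a)).
  have fin := metric_entropy_fin (inv i).
  have [_ [k [xi [pxi ->]]] hk] := ub_ereal_sup_adherent e3 fin.
  have [theta [th0 th1 thP]] := small_entropy_defect (partition_size_gt0 pxi) e3.
  have [e e0 eP] := name_entropy_le hX cf (inv i) pxi th0 th1.
  have u0 n : 0 <= join_entropy (mu i) f n xi / n%:R by rewrite divr_ge0// join_entropy_ge0.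
  have [n0 n0P] := eventually_ge_limn u0 e3.
  exists (e, n0); split => // e' ee' n n0n s ys eta peta etaP.
  have := eP n s ys eta peta (fun i x xi t => le_trans (etaP i x xi t) ee').
  have [->|n00] := posnP n; first by rewrite !mul0r addr0; apply: le_trans; exact: join_entropy_ge0.
  have nR : 0 < n%:R :> R by rewrite ltr0n.
  have := n0P n n0n; rewrite ler_pdivlMr// -/(partition_entropy _ _ _) => h1 h2.
  rewrite -/(metric_entropy (mu i) f) -(fineK fin) -EFinB lte_fin in hk.
  have h3 : n%:R * (- ln (1 - theta) + theta * ln (k%:R / theta)) <= n%:R * (eta0 / 3).
    by rewrite ler_pM2l.
  have h4 : n%:R * (fine (metric_entropy (mu i) f) - eta0 / 3) <= n%:R * partition_entropy (mu i) f xi.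
    by rewrite ler_pM2l// ltW.
  nra.
have [en enP] := choice H.
have [e0 e00 e0P] := finite_lower_bound (fun i => proj1 (enP i)).
exists e0 => // e ee0; exists (\max_i (en i).2) => n nmax s ys eta peta etaP i.
apply: (proj2 (enP i) e _ n _ s ys eta peta etaP); first exact: le_trans (e0P i).
by apply: leq_trans nmax; exact: (leq_bigmax (F := fun i => (en i).2)).
Qed.

End SpanningEntropy.

(** * Counting words with given letter frequencies *)

Section Types.
Context {R : realType}.

(** Crude Stirling bounds suffice: the logarithmic error occurs once per letter of a fixed alphabet
    while the word grows. *)
Lemma ln_fact_ge (n : nat) : n%:R * ln n%:R - n%:R <= ln (n`!)%:R :> R.
Proof.
elim: n => [|n IH]; first by rewrite mul0r subrr fact0 ln1.
have nR : 0 < n.+1%:R :> R by rewrite ltr0n.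
rewrite factS natrM lnM ?posrE ?ltr0n ?fact_gt0//.
have [->|n0] := posnP n; first by rewrite fact0 ln1 mul1r addr0 lerBlDr lerDl.
have n0R : 0 < n%:R :> R by rewrite ltr0n.
have h : n%:R * (ln n.+1%:R - ln n%:R) <= 1 :> R.
  rewrite -ln_div ?posrE// -natr1 mulrDl divff ?gt_eqF// mul1r.
  have := @le_ln1Dx R (n%:R^-1); rewrite (lt_le_trans (ltrN10 _)) ?invr_ge0// => /(_ isT) h.
  by apply: le_trans (ler_wpM2l (ltW n0R) h) _; rewrite divff ?gt_eqF.
rewrite -natr1 in IH h *; nra.
Qed.

Lemma ln_fact_le (n : nat) : ln (n`!)%:R <= n%:R * ln n%:R - n%:R + 1 + ln n%:R :> R.
Proof.
case: n => [|n]; first by rewrite fact0 ln1 mul0r subrr add0r ln0// addr0.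
elim: n => [|n IH]; first by rewrite (_ : 1`! = 1)%N// ln1; lra.
have nR : 0 < n.+1%:R :> R by rewrite ltr0n.
have nR2 : 0 < n.+2%:R :> R by rewrite ltr0n.
rewrite factS natrM lnM ?posrE ?ltr0n ?fact_gt0//.
have h : 1 <= n.+2%:R * (ln n.+2%:R - ln n.+1%:R) :> R.
  have := @le_ln1Dx R (- n.+2%:R^-1).
  have -> : 1 + - n.+2%:R^-1 = n.+1%:R / n.+2%:R :> R.
    by rewrite -[n.+2%:R]natr1; field; rewrite nat1r gt_eqF.
  rewrite ln_div ?posrE// ltrN2 invf_lt1// ltr1n => /(_ isT) h.
  have := ler_wpM2l (ltW nR2) h; rewrite mulrN divff ?gt_eqF//; lra.
have E : n.+2%:R = n.+1%:R + 1 :> R by rewrite natr1.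
rewrite E in h *; nra.
Qed.

Lemma size_count (s : nat) (w : seq 'I_s) : (\sum_y count_mem y w)%N = size w.
Proof.
elim: w => [|x w IH]; first by rewrite big1.
rewrite /= big_split /= IH -[RHS]add1n; congr addn.
by rewrite (bigD1 x)//= eqxx big1 ?addn0// => y; rewrite eq_sym => /negbTE->.
Qed.

(** The multinomial coefficient, by induction on the removal of the first letter of a
    permutation. *)
Lemma size_permutations_count (s : nat) (w : seq 'I_s) :
  (size (permutations w) * \prod_y (count_mem y w)`! = (size w)`!)%N.
Proof.
move: {2}(size w) (leqnn (size w)) => n; elim: n w => [|n IH] w.
  rewrite leqn0 size_eq0 => /eqP->.
  by rewrite big1.
have [->|w0] := eqVneq w [::]; first by move=> _; rewrite big1.
move=> wn; have sw : (0 < size w)%N by rewrite lt0n size_eq0.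
rewrite (perm_size (permutationsE sw)) size_allpairs_dep sumnE big_map big_distrl /=.
have H x : x \in w -> (size (permutations (rem x w)) * \prod_y (count_mem y w)`! =
    count_mem x w * (size w).-1`!)%N.
  move=> xw; have cx : (0 < count_mem x w)%N by rewrite -has_count has_pred1.
  have := IH (rem x w); rewrite size_rem// -ltnS prednK// => /(_ wn) <-.
  rewrite mulnCA; congr muln.
  rewrite (bigD1 x)//= [in RHS](bigD1 x)//= mulnA; congr muln.
    by rewrite count_rem xw /= eqxx subn1 -[X in X`! = _](prednK cx) factS prednK.
  by apply: eq_bigr => y yx; rewrite count_rem xw /= eq_sym (negbTE yx) subn0.
rewrite (eq_big_seq (fun x => count_mem x w * (size w).-1`!)%N) => [|x]; last first.
  by rewrite mem_undup; exact: H.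
rewrite -big_distrl /= -[in RHS](prednK sw) factS prednK//; congr muln.
rewrite big_uniq ?undup_uniq//= -[RHS]size_count big_mkcond /=; apply: eq_bigr => x _.
by rewrite mem_undup; case: ifPn => // xw; apply/esym/count_memPn.
Qed.

Lemma exists_word (s : nat) (k : 'I_s -> nat) : exists w : seq 'I_s,
  forall y, count_mem y w = k y.
Proof.
exists (flatten [seq nseq (k y) y | y <- index_enum 'I_s]) => y.
rewrite count_flatten sumnE !big_map (bigD1 y)//= count_nseq /= eqxx mul1n big1 ?addn0// => z zy.
by rewrite count_nseq /= (negbTE zy).
Qed.

Lemma ln_permutations_ge (s : nat) (w : seq 'I_s) : (0 < size w)%N ->
  (size w)%:R * shannon (fun y => (count_mem y w)%:R / (size w)%:R) -
    s%:R * (1 + ln (size w)%:R) <= ln (size (permutations w))%:R :> R.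
Proof.
move=> w0; set M := size w; have MR : 0 < M%:R :> R by rewrite ltr0n.
have pos y : 0 < ((count_mem y w)`!)%:R :> R by rewrite ltr0n fact_gt0.
have N0 : 0 < (size (permutations w))%:R :> R.
  rewrite ltr0n lt0n size_eq0; apply/eqP => E.
  by have := mem_permutations w w; rewrite E perm_refl.
have E : ln (size (permutations w))%:R = ln (M`!)%:R - \sum_y ln ((count_mem y w)`!)%:R :> R.
  rewrite -(size_permutations_count w) natrM lnM ?posrE//; last first.
    by rewrite ltr0n; apply: prodn_gt0 => y; exact: fact_gt0.
  by rewrite natr_prod ln_prod// addrK.
rewrite E.
have ME : M%:R = \sum_y (count_mem y w)%:R :> R by rewrite -natr_sum size_count.
have h1 := ln_fact_ge M.
have h2 : \sum_y ln ((count_mem y w)`!)%:R <=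
    \sum_y ((count_mem y w)%:R * ln (count_mem y w)%:R) - M%:R + s%:R * (1 + ln M%:R) :> R.
  have -> : s%:R * (1 + ln M%:R) = \sum_(y : 'I_s) (1 + ln M%:R) :> R.
    by rewrite sumr_const card_ord mulr_natl.
  rewrite [X in _ - X + _]ME -sumrB -big_split /=.
  apply: ler_sum => y _; apply: le_trans (ln_fact_le _) _; rewrite -addrA lerD2l lerD2l.
  have [->|c0] := posnP (count_mem y w); first by rewrite ln0// ln_ge0// ler1n.
  by rewrite ler_ln ?posrE ?ltr0n// ler_nat count_size.
have h3 : M%:R * shannon (fun y => (count_mem y w)%:R / M%:R) =
    M%:R * ln M%:R - \sum_y ((count_mem y w)%:R * ln (count_mem y w)%:R) :> R.
  rewrite /shannon mulrN [X in X * ln _]ME mulr_suml -sumrB.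
  rewrite mulr_sumr -sumrN; apply: eq_bigr => y _.
  have [->|c0] := posnP (count_mem y w); first by rewrite !mul0r mulr0 subrr oppr0.
  rewrite ln_div ?posrE ?ltr0n// mulrA (mulrC M%:R) divfK ?gt_eqF//; lra.
rewrite h3; lra.
Qed.

(** Round [D * p i] down for a large [D]. The total then drops by at most [s], and the rounding of
    the weights costs [L / D] of entropy; masses 0 do not enter [L] because [ln 0 = 0]. *)
Lemma type_approx (s : nat) (p : 'I_s -> R) (kap : R) :
  (forall i, 0 <= p i) -> \sum_i p i = 1 -> 0 < kap ->
  exists k : 'I_s -> nat, let M := (\sum_i k i)%N in
    [/\ (0 < M)%N, \sum_i `|(k i)%:R / M%:R - p i| <= kap &
      shannon p - kap <= shannon (fun i => (k i)%:R / M%:R)].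
Proof.
move=> p0 p1 kap0.
have p1' i : p i <= 1 by rewrite -p1 (bigD1 i)//= lerDl sumr_ge0.
have lp i : 0 <= - ln (p i) by rewrite oppr_ge0 ln_le0.
pose L := \sum_i (- ln (p i)); have L0 : 0 <= L by apply: sumr_ge0.
have sR : 0 <= s%:R :> R by [].
have q0 : 0 <= (L + 2 * s%:R) / kap by rewrite divr_ge0 ?addr_ge0 ?mulr_ge0// ltW.
have B0 : 0 <= (L + 2 * s%:R) / kap + 2 * s%:R + 1.
  by rewrite addr_ge0// addr_ge0// mulr_ge0.
(* The first summand makes the total error [(L + 2 s) / D] at most [kap]; the others give [2 s < D],
   hence [M >= D / 2]. *)
pose D := Num.bound ((L + 2 * s%:R) / kap + 2 * s%:R + 1).
have DP := archi_boundP B0; rewrite -/D in DP.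
have D0 : 0 < D%:R :> R by apply: le_lt_trans DP.
have Dk : (L + 2 * s%:R) <= kap * D%:R.
  rewrite [leRHS]mulrC -ler_pdivrMr//; lra.
have Ds : 2 * s%:R + 1 <= D%:R :> R by lra.
pose k i := Num.truncn (D%:R * p i).
have kE i : (k i)%:R <= D%:R * p i < (k i)%:R + 1.
  have Dp : 0 <= D%:R * p i by rewrite mulr_ge0// ltW.
  by have := truncn_itv Dp; rewrite natr1.
exists k => M.
have MR : M%:R = \sum_i (k i)%:R :> R by rewrite natr_sum.
have DE : D%:R = \sum_i D%:R * p i by rewrite -mulr_sumr p1 mulr1.
have MD : M%:R <= D%:R :> R.
  by rewrite MR [leRHS]DE; apply: ler_sum => i _; have /andP[] := kE i.
have DM : D%:R - s%:R <= M%:R :> R.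
  rewrite MR [X in X - _ <= _]DE.
  have -> : s%:R = \sum_(i : 'I_s) 1 :> R by rewrite sumr_const card_ord.
  by rewrite -sumrB; apply: ler_sum => i _; have /andP[_ h] := kE i; lra.
have M0 : 0 < M%:R :> R by lra.
have iMD : D%:R^-1 <= M%:R^-1 :> R by rewrite lef_pV2 ?posrE.
split; first by rewrite -(ltr0n R).
- apply: (@le_trans _ _ (2 * s%:R / D%:R)); last by rewrite ler_pdivrMr//; lra.
  have H i : `|(k i)%:R / M%:R - p i| <= (k i)%:R * (M%:R^-1 - D%:R^-1) + D%:R^-1.
    have -> : (k i)%:R / M%:R - p i = (k i)%:R * (M%:R^-1 - D%:R^-1) + ((k i)%:R / D%:R - p i) by ring.
    apply: le_trans (ler_normD _ _) _; apply: lerD.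
      by rewrite ger0_norm// mulr_ge0// subr_ge0.
    rewrite ler_norml; have /andP[h1 h2] := kE i.
    have E : (k i)%:R / D%:R - p i = ((k i)%:R - D%:R * p i) / D%:R.
      by rewrite mulrBl mulrAC divff ?gt_eqF// mul1r.
    rewrite E; apply/andP; split.
      by rewrite ler_pdivlMr// mulNr mulVf ?gt_eqF//; lra.
    by rewrite ler_pdivrMr// mulVf ?gt_eqF//; lra.
  apply: le_trans (ler_sum _ (fun i _ => H i)) _.
  rewrite big_split /= -mulr_suml -MR sumr_const card_ord -[_ *+ s]mulr_natl mulrBr divff ?gt_eqF//.
  have -> : 1 - M%:R / D%:R = (D%:R - M%:R) / D%:R :> R by rewrite mulrBl divff ?gt_eqF.
  by rewrite -mulrDl ler_pM2r ?invr_gt0//; lra.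
have lDM : ln (D%:R / M%:R) <= s%:R / M%:R :> R.
  have := @le_ln1Dx R (D%:R / M%:R - 1); rewrite (addrC 1) subrK => h.
  apply: le_trans (h _) _; first by rewrite ltrBrDl subrr divr_gt0.
  have -> : D%:R / M%:R - 1 = (D%:R - M%:R) / M%:R :> R by rewrite mulrBl divff ?gt_eqF.
  by rewrite ler_pM2r ?invr_gt0//; lra.
have lDM0 : 0 <= ln (D%:R / M%:R) :> R by rewrite ln_ge0// ler_pdivlMr// mul1r.
have H i : p i * (- ln (p i)) - (- ln (p i)) / D%:R - (k i)%:R / M%:R * ln (D%:R / M%:R) <=
    - ((k i)%:R / M%:R * ln ((k i)%:R / M%:R)).
  have /andP[h1 h2] := kE i.
  have h3 : p i - D%:R^-1 <= (k i)%:R / M%:R.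
    apply: (@le_trans _ _ ((k i)%:R / D%:R)); last by rewrite ler_wpM2l.
    rewrite ler_pdivlMr// mulrBl mulVf ?gt_eqF//; lra.
  have h4 := ler_wpM2r (lp i) h3.
  have [k0|k0] := posnP (k i).
    rewrite k0 mulr0n !mul0r oppr0 addr0; rewrite k0 mulr0n !mul0r in h4; apply: le_trans h4.
    by rewrite mulrBl (mulrC D%:R^-1).
  have kR : 0 < (k i)%:R :> R by rewrite ltr0n.
  have pi0 : 0 < p i by rewrite -(pmulr_rgt0 _ D0); apply: lt_le_trans h1.
  have h5 : ln ((k i)%:R / M%:R) <= ln (p i) + ln (D%:R / M%:R).
    have dm0 : 0 < D%:R / M%:R :> R by rewrite divr_gt0.
    have km0 : 0 < (k i)%:R / M%:R :> R by rewrite divr_gt0.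
    have pd0 : 0 < p i * (D%:R / M%:R) by rewrite mulr_gt0.
    rewrite -lnM ?posrE// ler_ln ?posrE// mulrA ler_pM2r ?invr_gt0//.
    by rewrite mulrC.
  have h6 : 0 <= (k i)%:R / M%:R :> R by rewrite divr_ge0// ltW.
  have h7 := ler_wpM2l h6 h5.
  have h8 : (p i - D%:R^-1) * - ln (p i) = p i * (- ln (p i)) - (- ln (p i)) / D%:R by ring.
  rewrite h8 in h4; lra.
rewrite /shannon -!sumrN; have := ler_sum (index_enum _) (P := xpredT) (fun i _ => H i).
rewrite big_split big_split /= !sumrN -!mulr_suml -MR divff ?gt_eqF// mul1r => h.
have E : \sum_i p i * - ln (p i) = - \sum_i (p i * ln (p i)).
  by rewrite -sumrN; apply: eq_bigr => i _; rewrite mulrN.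
rewrite E in h.
have h1 : L / D%:R + ln (D%:R / M%:R) <= kap.
  have h2 : s%:R / M%:R <= 2 * s%:R / D%:R :> R.
    rewrite ler_pdivrMr// mulrAC ler_pdivlMr//; nra.
  apply: le_trans (lerD (lexx _) (le_trans lDM h2)) _.
  by rewrite -mulrDl ler_pdivrMr.
apply: le_trans h; rewrite -/L; lra.
Qed.

Lemma permutations_growth (s : nat) (k : 'I_s -> nat) (kap : R) :
  let M := (\sum_i k i)%N in (0 < M)%N -> 0 < kap ->
  exists C0 : nat, forall (C : nat) (w : seq 'I_s), (C0 <= C)%N -> (0 < C)%N ->
    (forall y, count_mem y w = (C * k y)%N) ->
    (size w)%:R * (shannon (fun y => (k y)%:R / M%:R) - kap) <= ln (size (permutations w))%:R.
Proof.
move=> M M0 kap0.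
(* Since [1 + ln x <= 3 * sqrt x], the error [s * (1 + ln x)] is below [kap * x] as soon as
   [sqrt x >= 3 * s / kap]. *)
pose b := (3 * s%:R / kap) ^+ 2.
have b0 : 0 <= b by rewrite exprn_ge0// divr_ge0 ?mulr_ge0// ltW.
exists (Num.bound b) => C w CC C0 cw.
have sw : size w = (C * M)%N by rewrite -size_count (eq_bigr _ (fun y _ => cw y)) big_distrr.
have w0 : (0 < size w)%N by rewrite sw muln_gt0 C0.
have CR : 0 < C%:R :> R by rewrite ltr0n.
have MR : 0 < M%:R :> R by rewrite ltr0n.
apply: le_trans _ (ln_permutations_ge w0).
have -> : shannon (fun y => (count_mem y w)%:R / (size w)%:R) = shannon (fun y => (k y)%:R / M%:R) :> R.
  congr (- _); apply: eq_bigr => y _.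
  by rewrite cw sw !natrM -mulf_div divff ?gt_eqF// mul1r.
rewrite mulrBr lerD2l lerN2.
set x := (size w)%:R.
have x1 : 1 <= x by rewrite ler1n.
have x0 : 0 < x by apply: lt_le_trans x1.
pose r := Num.sqrt x; have rx : r ^+ 2 = x by rewrite sqr_sqrtr// ltW.
have r0 : 0 < r by rewrite sqrtr_gt0.
have r1 : 1 <= r by rewrite -(@expr_ge1 _ 2)// ?rx// ltW.
have lx : 1 + ln x <= 3 * r.
  have := ln_sublinear r0; have -> : ln x = ln r *+ 2 by rewrite -rx lnXn.
  by rewrite -[_ *+ 2]mulr_natl; lra.
apply: le_trans (ler_wpM2l (ler0n R s) lx) _.
have bx : b <= x.
  apply: le_trans (ltW (archi_boundP b0)) _; rewrite ler_nat sw.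
  by apply: leq_trans CC _; rewrite leq_pmulr.
have br : 3 * s%:R / kap <= r.
  have h0 : 0 <= 3 * s%:R / kap by rewrite divr_ge0 ?mulr_ge0// ltW.
  by rewrite -(@ler_pXn2r _ 2) ?nnegrE ?rx// ltW.
rewrite -rx expr2; rewrite ler_pdivrMr// in br; nra.
Qed.

End Types.

(** * Construction of the blocks *)

Section BlockConstruction.
Context {R : realType} {X : metricType R} (f : X -> X).
Variables (d e : R) (q : X) (A k T : nat) (tag : nat -> seq X).
Hypothesis d0 : 0 < d.
Hypothesis k0 : (0 < k)%N.
Hypothesis tagS : forall i, size (tag i) = (A + k * i)%N.
Hypothesis tagC : forall i, cycle (jump f d) (q :: tag i).
Hypothesis tagF : forall i x, x \in tag i -> e <= mdist x q.
Hypothesis conn : forall a b, exists s, (size s <= T)%N /\ path (jump f d) a (rcons s b).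

Lemma path_orbit x n : path (jump f d) x (traject f (f x) n).
Proof. by elim: n x => //= n IH x; rewrite /jump mdistxx d0 /=; exact: IH. Qed.

(* The blocks are loops at [q] containing the orbit segments of length [n] of the
   points [ys]. The connection from [q] to [ys i] is preceded by a tag whose length,
   the return time to [q], encodes the length of that connection; hence two blocks
   with equal tags run through their orbit segments simultaneously. *)
Lemma exists_blocks (n s : nat) (ys : 'I_s -> X) : (0 < n)%N ->
  (forall i j, i != j -> exists t : 'I_n, e <= mdist (iter t f (ys i)) (iter t f (ys j))) ->
  exists B : 'I_s -> seq X,
  [/\ forall i, cycle (jump f d) (q :: B i),
      forall i j, i != j -> exists t : nat,
        (t < minn (size (q :: B i)) (size (q :: B j)))%N /\
        e <= mdist (nth q (q :: B i) t) (nth q (q :: B j) t)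
    & forall i, exists pre post, [/\ q :: B i = pre ++ traject f (ys i) n ++ post &
        (size pre + size post <= (A + k * T).+1 + T.+1 + T)%N]].
Proof.
move=> n0 sep; have [s1 s1P] := choice (fun i => conn q (ys i)).
have [s2 s2P] := choice (fun i => conn (iter n.-1 f (ys i)) q).
pose B i := tag (size (s1 i)) ++ (q :: s1 i) ++ traject f (ys i) n ++ s2 i.
exists B; split.
- have cyE l : cycle (jump f d) (q :: l) = path (jump f d) q (rcons l q) by [].
  move=> i; rewrite /B cat_cons; apply: cycle_cat; first exact: tagC.
  have [_ p1] := s1P i; have [_ p2] := s2P i.
  have -> : traject f (ys i) n = ys i :: traject f (f (ys i)) n.-1 by rewrite -(prednK n0).
  rewrite cyE !rcons_cat cat_cons -cat_rcons cat_path p1 last_rcons cat_path path_orbit /=.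
  rewrite (_ : last _ _ = iter n.-1 f (ys i))//.
  by rewrite -[RHS](@last_traject _ f (ys i) n.-1).
(* When the shorter tag has returned to [q], the longer one is still away from it. *)
- have tagcase i j : (size (s1 i) < size (s1 j))%N ->
      let t := (size (tag (size (s1 i)))).+1 in
      [/\ (t < size (q :: B i))%N, (t < size (q :: B j))%N, nth q (q :: B i) t = q &
          e <= mdist (nth q (q :: B j) t) q].
    move=> lt t; have tj : (size (tag (size (s1 i))) < size (tag (size (s1 j))))%N.
      by rewrite !tagS ltn_add2l ltn_mul2l k0.
    split.
    + by rewrite /B /= size_cat /= ltnS -addSnnS leq_addr.
    + by rewrite /B /= size_cat ltnS (leq_trans tj)// leq_addr.
    + by rewrite /B /t /= nth_cat ltnn subnn.
    + by rewrite /B /t /= nth_cat tj; apply: tagF; exact: mem_nth.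
  move=> i j ij; have [lt|gt|eq] := ltngtP (size (s1 i)) (size (s1 j)).
  + have [h1 h2 h3 h4] := tagcase _ _ lt; exists (size (tag (size (s1 i)))).+1; rewrite leq_min h1 h2; split=> //.
    by rewrite h3 metric_sym.
  + have [h1 h2 h3 h4] := tagcase _ _ gt; exists (size (tag (size (s1 j)))).+1; rewrite leq_min h1 h2; split=> //.
    by rewrite h3.
  have [t tP] := sep _ _ ij.
  exists ((size (tag (size (s1 i)))).+1 + (size (s1 i)).+1 + t)%N.
  have E i' : size (s1 i') = size (s1 i) ->
      nth q (q :: B i') ((size (tag (size (s1 i)))).+1 + (size (s1 i)).+1 + t) = iter t f (ys i') /\
      ((size (tag (size (s1 i)))).+1 + (size (s1 i)).+1 + t < size (q :: B i'))%N.
    move=> Ei; have -> : q :: B i' = ((q :: tag (size (s1 i'))) ++ (q :: s1 i')) ++ traject f (ys i') n ++ s2 i'.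
      by rewrite -catA.
    have Es : size ((q :: tag (size (s1 i'))) ++ (q :: s1 i')) =
        ((size (tag (size (s1 i)))).+1 + (size (s1 i)).+1)%N by rewrite size_cat /= Ei.
    rewrite -Es; split.
      rewrite nth_cat ltnNge leq_addr /= addKn nth_cat size_traject ltn_ord.
      by rewrite (set_nth_default (ys i')) ?size_traject// nth_traject.
    rewrite [ltnRHS]size_cat ltn_add2l size_cat size_traject.
    by apply: leq_trans (ltn_ord t) _; exact: leq_addr.
  have [E1 E2] := E i erefl; have [E3 E4] := E j (esym eq).
  by rewrite leq_min E2 E4 E1 E3.
move=> i; exists ((q :: tag (size (s1 i))) ++ (q :: s1 i)), (s2 i); split.
  by rewrite /B -catA.
have [h1 _] := s1P i; have [h2 _] := s2P i.
rewrite size_cat /= tagS; have : (k * size (s1 i) <= k * T)%N by rewrite leq_mul2l h1 orbT.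
lia.
Qed.

End BlockConstruction.

Lemma sum_flatten_count {R : realType} {X : Type} (phi : X -> R) (s : nat)
    (B : 'I_s -> seq X) (w : seq 'I_s) :
  \sum_(x <- flatten [seq B y | y <- w]) phi x =
  \sum_y (count_mem y w)%:R * \sum_(x <- B y) phi x.
Proof.
elim: w => [|z w IH]; first by rewrite big_nil big1// => y _; rewrite mul0r.
rewrite /= big_cat /= IH [RHS](eq_bigr (fun y => (z == y)%:R * \sum_(x <- B y) phi x +
  (count_mem y w)%:R * \sum_(x <- B y) phi x)); last by move=> y _; rewrite natrD mulrDl.
rewrite big_split /=; congr (_ + _); rewrite (bigD1 z)//= eqxx mul1r [X in _ + X]big1 ?addr0// => y.
by rewrite eq_sym => /negbTE->; rewrite mul0r.
Qed.

(** * Averages along tours *)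

Section TourAverage.
Context {R : realType} {X : Type}.
Variables (phi : X -> R) (Phi : R).
Hypothesis phiP : forall x, `|phi x| <= Phi.

Lemma norm_sum_seq (l : seq X) : `|\sum_(x <- l) phi x| <= (size l)%:R * Phi.
Proof.
elim: l => [|x l IH]; first by rewrite big_nil normr0 mul0r.
rewrite big_cons; apply: le_trans (ler_normD _ _) _.
by rewrite /= -addn1 natrD mulrDl mul1r addrC lerD.
Qed.

Lemma tour_average (f : X -> X) (s n O : nat) (ys : 'I_s -> X) (B : 'I_s -> seq X) (mk : seq X)
    (w : seq 'I_s) (p : 'I_s -> R) (kap : R) :
  (0 < n)%N -> (0 < size w)%N -> 0 <= kap ->
  (forall i, 0 <= p i) -> \sum_i p i = 1 ->
  (forall i, exists pre post, B i = pre ++ traject f (ys i) n ++ post /\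
     (size pre + size post <= O)%N) ->
  \sum_y `|(count_mem y w)%:R / (size w)%:R - p y| <= kap ->
  2 * O%:R <= kap * n%:R -> 2 * (size mk)%:R <= kap * (size w * n)%N%:R ->
  let tour := mk ++ flatten [seq B y | y <- w] in
  (size tour)%:R <= (1 + kap) * (size w * n)%N%:R :> R /\
  `|(\sum_(x <- tour) phi x) / (size tour)%:R -
    \sum_y p y * (n%:R^-1 * \sum_(t < n) phi (iter t f (ys y)))| <= 3 * kap * Phi.
Proof.
move=> n0 w0 kap0 p0 p1 BP cw On mn tour.
set M := size w; have MR : 0 < M%:R :> R by rewrite ltr0n.
have nR : 0 < n%:R :> R by rewrite ltr0n.
have Phi0 : 0 <= Phi.
  by have [[y0 _]|] := pselect (exists y : 'I_s, True); [exact: le_trans (normr_ge0 _) (phiP (ys y0))|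
     case: (w) w0 => // y0 w' _ []; exists y0].
have H y : exists o : nat, size (B y) = (n + o)%N /\ (o <= O)%N /\
    `|\sum_(x <- B y) phi x - \sum_(t < n) phi (iter t f (ys y))| <= O%:R * Phi.
  have [pre [post [E sz]]] := BP y; exists (size pre + size post)%N; split.
    by rewrite E !size_cat size_traject; lia.
  split => //; rewrite E !big_cat /=.
  have -> : \sum_(x <- traject f (ys y) n) phi x = \sum_(t < n) phi (iter t f (ys y)).
    rewrite (big_nth (ys y)) size_traject big_mkord; apply: eq_bigr => t _.
    by rewrite nth_traject.
  rewrite addrCA addrAC subrr add0r.
  apply: le_trans (ler_normD _ _) _; apply: le_trans (lerD (norm_sum_seq _) (norm_sum_seq _)) _.
  by rewrite -mulrDl -natrD ler_wpM2r// ler_nat.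
have [ext extP] := choice H.
pose a y := \sum_(t < n) phi (iter t f (ys y)).
have aB y : `|a y| <= n%:R * Phi.
  apply: le_trans (ler_norm_sum _ _ _) _.
  by rewrite -[n in n%:R]card_ord mulr_natl -sumr_const; apply: ler_sum.
have cM : \sum_y (count_mem y w)%:R = M%:R :> R by rewrite -natr_sum size_count.
have sB : (size tour)%:R = (size mk)%:R + M%:R * n%:R + \sum_y (count_mem y w)%:R * (ext y)%:R :> R.
  rewrite size_cat natrD -addrA; congr (_ + _).
  have S1 (l : seq X) : (size l)%:R = \sum_(x <- l) 1 :> R.
    by rewrite big_const_seq count_predT iter_addr_0.
  rewrite S1 sum_flatten_count -cM mulr_suml -big_split /=; apply: eq_bigr => y _.
  by have [E _] := extP y; rewrite -S1 E natrD mulrDr.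
have o1 : 0 <= \sum_y (count_mem y w)%:R * (ext y)%:R :> R by apply: sumr_ge0 => y _; rewrite mulr_ge0.
have o2 : \sum_y (count_mem y w)%:R * (ext y)%:R <= M%:R * O%:R :> R.
  rewrite -cM mulr_suml; apply: ler_sum => y _; rewrite ler_wpM2l// ler_nat.
  by have [_ []] := extP y.
have MO : 2 * (M%:R * O%:R) <= kap * (M%:R * n%:R) by nra.
rewrite natrM in mn *.
split; first by rewrite sB; lra.
set V := \sum_y _ * _.
have VE : V = (\sum_y p y * a y) / n%:R.
  by rewrite mulr_suml; apply: eq_bigr => y _; rewrite -/(a y) mulrA mulrAC.
have S0 : 0 < (size tour)%:R :> R.
  by rewrite sB; have := mulr_gt0 MR nR; have h : 0 <= (size mk)%:R :> R by []; lra.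
have V1 : `|V| <= Phi.
  rewrite VE normrM normfV (ger0_norm (ltW nR)) ler_pdivrMr//.
  apply: le_trans (ler_norm_sum _ _ _) _.
  apply: (@le_trans _ _ (\sum_y p y * (n%:R * Phi))); last by rewrite -mulr_suml p1 mul1r mulrC.
  by apply: ler_sum => y _; rewrite normrM (ger0_norm (p0 y)) ler_wpM2l.
(* Three deviations: the marker, the connections and the letter frequencies. Each is at most
   [kap * Phi] times the length [M * n] of the orbit segments, which explains the factor 3. *)
have tE : \sum_(x <- tour) phi x - V * (size tour)%:R =
    (\sum_(x <- mk) phi x - V * (size mk)%:R) +
    (\sum_y (count_mem y w)%:R * (\sum_(x <- B y) phi x - a y) -
      V * \sum_y (count_mem y w)%:R * (ext y)%:R) +
    (\sum_y (count_mem y w)%:R * a y - M%:R * (V * n%:R)).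
  rewrite big_cat /= sum_flatten_count sB.
  have -> : \sum_y (count_mem y w)%:R * (\sum_(x <- B y) phi x - a y) =
      \sum_y (count_mem y w)%:R * \sum_(x <- B y) phi x - \sum_y (count_mem y w)%:R * a y.
    by rewrite -sumrB; apply: eq_bigr => y _; rewrite mulrBr.
  by ring.
have b1 : `|\sum_(x <- mk) phi x - V * (size mk)%:R| <= 2 * (size mk)%:R * Phi.
  apply: le_trans (ler_normB _ _) _; rewrite normrM normr_nat.
  have := norm_sum_seq mk; have := ler_wpM2r (ler0n R (size mk)) V1; lra.
have b2 : `|\sum_y (count_mem y w)%:R * (\sum_(x <- B y) phi x - a y) -
      V * \sum_y (count_mem y w)%:R * (ext y)%:R| <= 2 * (M%:R * O%:R) * Phi.
  apply: le_trans (ler_normB _ _) _.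
  have h1 : `|\sum_y (count_mem y w)%:R * (\sum_(x <- B y) phi x - a y)| <= M%:R * O%:R * Phi.
    apply: le_trans (ler_norm_sum _ _ _) _; rewrite -mulrA -cM mulr_suml.
    apply: ler_sum => y _; rewrite normrM normr_nat ler_wpM2l//.
    by have [_ []] := extP y.
  have h2 : `|V * \sum_y (count_mem y w)%:R * (ext y)%:R| <= M%:R * O%:R * Phi.
    by rewrite normrM (ger0_norm o1) mulrC ler_pM.
  lra.
have b3 : `|\sum_y (count_mem y w)%:R * a y - M%:R * (V * n%:R)| <= M%:R * kap * (n%:R * Phi).
  rewrite VE divfK ?gt_eqF//.
  have -> : \sum_y (count_mem y w)%:R * a y - M%:R * \sum_y p y * a y =
      M%:R * \sum_y ((count_mem y w)%:R / M%:R - p y) * a y.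
    rewrite !mulr_sumr -sumrB; apply: eq_bigr => y _.
    by field; rewrite gt_eqF.
  rewrite normrM normr_nat -mulrA ler_wpM2l//.
  apply: le_trans (ler_norm_sum _ _ _) _.
  apply: (@le_trans _ _ ((\sum_y `|(count_mem y w)%:R / M%:R - p y|) * (n%:R * Phi))).
    by rewrite mulr_suml; apply: ler_sum => y _; rewrite normrM ler_wpM2l.
  by rewrite ler_wpM2r// mulr_ge0// ltW.
rewrite -[X in _ - X](mulfK (lt0r_neq0 S0)) -mulrBl normrM normfV (ger0_norm (ltW S0)) ler_pdivrMr//.
rewrite tE; apply: le_trans (ler_normD _ _) _; apply: le_trans (lerD (ler_normD _ _) (lexx _)) _.
apply: le_trans (lerD (lerD b1 b2) b3) _.
apply: (@le_trans _ _ (3 * kap * Phi * (M%:R * n%:R))).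
  have := ler_wpM2r Phi0 mn; have := ler_wpM2r Phi0 MO; lra.
rewrite ler_wpM2l ?mulr_ge0// sB.
have h : 0 <= (size mk)%:R :> R by [].
lra.
Qed.

End TourAverage.

Section OrbitAverage.
Context {R : realType} {X : pmetricType R} (f : X -> X).
Hypotheses (hX : compact [set: X]) (cf : continuous f).

(** Average over [t < n] the Riemann estimates for [phi] composed with the iterates; by invariance
    they all concern the same integral. *)
Lemma orbit_average (mu : probability (borel X) R) (phi : X -> R) (theta e : R) (n s : nat)
    (ys : 'I_s -> X) (eta : 'I_s -> set X) :
  invariant_measure f mu -> continuous phi -> (0 < n)%N ->
  (forall x y, mdist x y <= e -> `|phi x - phi y| <= theta) ->
  measurable_partition eta ->
  (forall i x, eta i x -> forall t : 'I_n, mdist (iter t f x) (iter t f (ys i)) <= e) ->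
  `|\int[mu]_x phi x -
    \sum_y pr mu (eta y) * (n%:R^-1 * \sum_(t < n) phi (iter t f (ys y)))| <= theta.
Proof.
move=> inv cphi n0 osc peta etaP; have nR : 0 < n%:R :> R by rewrite ltr0n.
have H (t : 'I_n) : `|\int[mu]_x phi x - \sum_y phi (iter t f (ys y)) * pr mu (eta y)| <= theta.
  rewrite -(Rintegral_invariant hX t cf cphi inv).
  apply: (@Rintegral_approx R X hX mu _ eta (fun x => phi (iter t f x))
    (fun y => phi (iter t f (ys y))) theta peta).
    by move=> x; apply: continuous_comp; [exact: iter_continuous|exact: cphi].
  by move=> y; right => x yx; apply: osc; exact: etaP.
have -> : \int[mu]_x phi x - \sum_y pr mu (eta y) * (n%:R^-1 * \sum_(t < n) phi (iter t f (ys y))) =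
    n%:R^-1 * \sum_(t < n) (\int[mu]_x phi x - \sum_y phi (iter t f (ys y)) * pr mu (eta y)).
  rewrite sumrB sumr_const card_ord -[(\int[mu]_x phi x) *+ n]mulr_natl mulrBr mulKf ?gt_eqF//; congr (_ - _).
  rewrite exchange_big /= mulr_sumr; apply: eq_bigr => y _.
  by rewrite -mulr_suml mulrCA; congr (_ * _); rewrite mulrC.
rewrite normrM normfV (ger0_norm (ltW nR)) mulrC ler_pdivrMr//.
apply: le_trans (ler_norm_sum _ _ _) _.
by rewrite mulr_natr -[n in _ *+ n]card_ord -sumr_const; apply: ler_sum.
Qed.

End OrbitAverage.

Lemma size_flatten_count (T : Type) (s : nat) (B : 'I_s -> seq T) (w : seq 'I_s) :
  size (flatten [seq B y | y <- w]) = (\sum_y count_mem y w * size (B y))%N.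
Proof.
elim: w => [|z w IH]; first by rewrite big1.
rewrite /= size_cat IH [RHS](eq_bigr (fun y => (z == y) * size (B y) + count_mem y w * size (B y))%N);
  last by move=> y _; rewrite mulnDl.
rewrite big_split /=; congr addn; rewrite (bigD1 z)//= eqxx mul1n [X in (_ + X)%N]big1 ?addn0// => y.
by rewrite eq_sym => /negbTE->.
Qed.

(** One alphabet without repetition for all classes, so [W] stays injective even when some [v i] are
    permutations of each other. *)
Lemma exists_word_classes (T : eqType) (m : nat) (v : 'I_m -> seq T) :
  exists N (W : 'I_N -> seq T) (C : 'I_m -> {set 'I_N}),
  [/\ injective W, forall j, exists i, j \in C i,
      forall i j, (j \in C i) = perm_eq (W j) (v i) &
      forall i, (size (permutations (v i)) <= #|C i|)%N].
Proof.
pose Ws := undup (flatten [seq permutations (v i) | i <- enum 'I_m]).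
pose W (j : 'I_(size Ws)) := nth [::] Ws j.
have WsP w : w \in Ws -> exists i, perm_eq w (v i).
  rewrite mem_undup => /flattenP[l /mapP[i _ ->]]; rewrite mem_permutations => h.
  by exists i.
have PW i w : perm_eq w (v i) -> exists j, W j = w.
  move=> wi; have wW : w \in Ws.
    rewrite mem_undup; apply/flattenP; exists (permutations (v i)).
      by apply/mapP; exists i => //; rewrite mem_enum.
    by rewrite mem_permutations.
  have wl : (index w Ws < size Ws)%N by rewrite index_mem.
  by exists (Ordinal wl); rewrite /W nth_index.
exists (size Ws), W, (fun i => [set j | perm_eq (W j) (v i)]%SET); split.
- move=> j j' /eqP; rewrite nth_uniq ?undup_uniq ?ltn_ord// => /eqP E.
  exact: val_inj.
- move=> j; have [i ij] := WsP (W j) (mem_nth _ (ltn_ord j)).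
  by exists i; rewrite inE.
- by move=> i j; rewrite inE.
- move=> i; rewrite cardE -(size_map W).
  apply: uniq_leq_size; first exact: permutations_uniq.
  move=> w; rewrite mem_permutations => wi; have [j jw] := PW i w wi.
  by apply/mapP; exists j => //; rewrite mem_enum inE jw.
Qed.

(** * Proof of the theorem *)

Section Families.
Context {R : realType} {X : pmetricType R}.
Hypothesis hX : compact [set: X].
Local Notation measures := (probability (borel X) R).
Variable phi : nat -> X -> R.
Hypothesis cphi : forall j, continuous (phi j).

Lemma common_modulus (J : nat) (theta : R) : 0 < theta -> exists2 d : R, 0 < d &
  forall j, (j < J)%N -> forall x y, mdist x y < d -> `|phi j x - phi j y| <= theta.
Proof.
move=> th0.
have H j : exists d : R, 0 < d /\ forall x y, mdist x y < d -> `|phi j x - phi j y| <= theta.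
  have [d d0 dP] := @compact_unif_continuous R X R^o hX (phi j) theta (@cphi j) th0.
  by exists d; split => // x y /dP; rewrite /mdist /= distrC => /ltW.
have [d dP] := choice H.
have [e e0 eP] := @lower_bound_iota R d J (fun j _ => proj1 (dP j)).
exists e => // j jJ x y xy; apply: (proj2 (dP j)); exact: lt_le_trans xy (eP j jJ).
Qed.

Lemma common_bound (J : nat) : exists2 Phi : R, 1 <= Phi &
  forall j, (j < J)%N -> forall x, `|phi j x| <= Phi.
Proof.
elim: J => [|J [Phi Phi1 PhiP]]; first by exists 1.
have [M M0 MP] := compact_continuous_bounded hX (@cphi J).
exists (Phi + M); first by rewrite (le_trans Phi1)// lerDl.
move=> j; rewrite ltnS leq_eqVlt => /orP[/eqP->|jJ] x.
  by rewrite (le_trans (MP x))// lerDr (le_trans _ Phi1).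
by rewrite (le_trans (PhiP j jJ x))// lerDl.
Qed.

Lemma hausdorff_dist_le (A B : set measures) (z : R) :
  (forall xi, A xi -> exists2 tau, B tau & weak_dist phi xi tau <= z) ->
  (forall tau, B tau -> exists2 xi, A xi & weak_dist phi tau xi <= z) ->
  (hausdorff_dist phi A B <= z%:E)%E.
Proof.
move=> AB BA; rewrite /hausdorff_dist ge_max; apply/andP; split; apply: ge_ereal_sup => _ [xi xiA <-].
  have [tau tauB le] := AB xi xiA; apply: ge_ereal_inf; exists (weak_dist phi xi tau)%:E => //.
  by exists tau.
have [tau tauB le] := BA xi xiA; apply: ge_ereal_inf; exists (weak_dist phi xi tau)%:E => //.
by exists tau.
Qed.

End Families.

(** The extra tour length costs [kap * M <= eta / 4], the spanning estimate [eta / 4], and [kap],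
    subtracted twice, another [eta / 4]; the last quarter makes the inequality strict. *)
Lemma rate_bound (K : realFieldType) (h eta kap M n S a b : K) :
  0 < S -> 1 <= n -> 0 < kap -> 0 < eta -> h <= M -> kap * M <= eta / 4 -> kap <= eta / 8 ->
  n * (h - eta / 4) <= a -> a - kap <= b ->
  (h - eta) * ((1 + kap) * (S * n)) < S * (b - kap).
Proof.
move=> S0 n1 kap0 eta0 hM kapM kap8 na ab.
have h1 : (h - eta) * (1 + kap) <= h - 3 * (eta / 4).
  have : (h - eta) * kap <= eta / 4.
    by apply: le_trans kapM; rewrite mulrC ler_pM2l//; lra.
  lra.
have n0 : 0 < n by exact: lt_le_trans n1.
rewrite (_ : (h - eta) * _ = S * (n * ((h - eta) * (1 + kap)))); last by ring.
rewrite ltr_pM2l//; apply: (@le_lt_trans _ _ (n * (h - 3 * (eta / 4)))); first by rewrite ler_pM2l.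
have : eta / 4 <= n * (eta / 4) by rewrite ler_peMl// divr_ge0// ltW.
lra.
Qed.

Section HorseshoeData.
Context {R : realType} {X : pmetricType R} (f g : X -> X).
Hypothesis hX : compact [set: X].
Hypotheses (cf : continuous f) (cg : continuous g) (fK : cancel f g) (gK : cancel g f).
Local Notation F := (ziter f g).
Local Notation measures := (probability (borel X) R).
Variable c : R.
Hypothesis c0 : 0 < c.
Hypothesis hc : forall x y, x <> y -> exists i, c < mdist (F i x) (F i y).
Hypothesis hs : shadowing f g.
Hypothesis tr : transitive_on [set: X] f.
Hypothesis infX : infinite_set [set: X].
Variables (m : nat) (mu : 'I_m -> measures).
Hypothesis inv : forall i, invariant_measure f (mu i).
Variable phi : nat -> X -> R.
Hypothesis cphi : forall j, continuous (phi j).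

Lemma exists_horseshoe_data (J : nat) (theta eta0 : R) : 0 < theta -> 0 < eta0 ->
  exists (r d : R) (p q : X) (s : nat) (mk : seq X) (B : 'I_s -> seq X)
    (v : 'I_m -> seq 'I_s) (l : nat),
  [/\ [/\ 0 < r, r + r <= c,
        forall u : int -> X, (forall n, mdist (f (u n)) (u (n + 1)) < d) ->
          exists y : X, forall n, mdist (F n y) (u n) < r &
        forall n, r <= mdist (F n p) q],
      [/\ cycle (jump f d) (q :: mk), forall x, x \in mk -> r + r <= mdist x q,
        forall y, cycle (jump f d) (q :: B y), forall y, (size (B y) < size mk)%N &
        forall y z, y != z -> exists t : nat,
          (t < minn (size (q :: B y)) (size (q :: B z)))%N /\
          r + r + (r + r) <= mdist (nth q (q :: B y) t) (nth q (q :: B z) t)],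
      forall j, (j < J)%N -> forall x y, mdist x y < r -> `|phi j x - phi j y| <= theta,
      forall i w, perm_eq w (v i) -> size (tour q mk B w) = l /\
        forall j, (j < J)%N ->
          `|(\sum_(x <- tour q mk B w) phi j x) / l%:R - \int[mu i]_x phi j x| <= theta &
      forall i, fine (metric_entropy (mu i) f) - eta0 <
        ln (size (permutations (v i)))%:R / l%:R].
Proof.
move=> th0 eta00.
have [p [q [k [j1 [j2 [k0 kp pq hom]]]]]] := exists_homoclinic hX cf cg fK gK c0 hc hs tr point infX.
have [eq eq0 [far1 far2]] := homoclinic_isolated fK gK c0 k0 kp pq hom.
have [Phi Phi1 PhiP] := common_bound hX (@cphi) J.
have Phi0 : 0 < Phi by apply: lt_le_trans Phi1.
have [M0 M0P] := metric_entropy_bounded hX cf cg fK gK c0 hc.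
pose Mh := `|M0| + 1; have Mh0 : 0 < Mh by rewrite ltr_wpDl.
have hM i : fine (metric_entropy (mu i) f) <= Mh.
  have fin := metric_entropy_fin hX cf cg fK gK c0 hc (inv i).
  have := M0P _ (inv i); rewrite -(fineK fin) lee_fin => h; apply: le_trans h _.
  by rewrite /Mh; have := ler_norm M0; lra.
have eta4 : 0 < eta0 / 4 by rewrite divr_gt0.
have [e0 e00 e0P] := shannon_spanning_ge hX cf cg fK gK c0 hc inv eta4.
have th2 : 0 < theta / 2 by rewrite divr_gt0.
have [d0 d00 d0P] := common_modulus hX (@cphi) J th2.
(* The coding needs [2 r <= c]; separation by [4 r] must be available both near [q] ([eq]) and at
   the scale of the entropy estimate ([e0]); below [d0] the test functions vary by at most
   [theta / 2]. *)
pose r := Num.min (Num.min (c / 2) (eq / 4)) (Num.min (e0 / 4) (d0 / 8)).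
have r0 : 0 < r by rewrite !lt_min !divr_gt0.
have rc : r + r <= c.
  have : r <= c / 2 by rewrite !ge_min lexx.
  lra.
have re : r + r + (r + r) <= eq.
  have : r <= eq / 4 by rewrite !ge_min lexx orbT.
  lra.
have re0 : r + r + (r + r) <= e0.
  have : r <= e0 / 4 by rewrite !ge_min lexx !orbT.
  lra.
have rd0 : r + r + (r + r) < d0.
  have : r <= d0 / 8 by rewrite !ge_min lexx !orbT.
  lra.
have rr_eq : r + r <= eq by lra.
have r_eq : r <= eq by lra.
have r_d0 : r < d0 by lra.
have th21 : theta / 2 <= theta by lra.
set e2 := r + r + (r + r) in re re0 rd0 *.
have e20 : 0 < e2 by rewrite !addr_gt0.
have [d dd0 dP] := hs r0.
have [T TP] := chain_connect hX tr dd0.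
have [A AP] := homoclinic_loop fK gK c0 k0 kp hom far1 far2 dd0.
have [tag tagP] := choice AP.
pose O := ((A + k * T).+1 + T.+1 + T)%N.
pose kap := Num.min (theta / (6 * Phi)) (Num.min (eta0 / (4 * Mh)) (eta0 / 8)).
have kap0 : 0 < kap by rewrite !lt_min !divr_gt0 ?mulr_gt0.
have kap1 : 3 * kap * Phi <= theta / 2.
  have : kap <= theta / (6 * Phi) by rewrite !ge_min lexx.
  rewrite ler_pdivlMr ?mulr_gt0//; lra.
have kap2 : kap * Mh <= eta0 / 4.
  have : kap <= eta0 / (4 * Mh) by rewrite !ge_min lexx orbT.
  rewrite ler_pdivlMr ?mulr_gt0//; lra.
have kap3 : kap <= eta0 / 8 by rewrite !ge_min lexx !orbT.
have [n0 n0P] := e0P e2 re0.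
pose n := (maxn n0 (Num.bound (2 * O%:R / kap))).+1.
have n_gt0 : (0 < n)%N by [].
have n0n : (n0 <= n)%N by rewrite leqW// leq_maxl.
have On : 2 * O%:R <= kap * n%:R.
  have h0 : 0 <= 2 * O%:R / kap by rewrite divr_ge0 ?mulr_ge0// ltW.
  rewrite [leRHS]mulrC -ler_pdivrMr//; apply: le_trans (ltW (archi_boundP h0)) _.
  by rewrite ler_nat leqW// leq_maxr.
have [s [ys [sep span]]] := exists_spanning hX cf cg fK gK c0 hc n e20.
have [eta [peta etaP]] := spanning_partition cf span.
have [|B [BC Bsep BO]] := @exists_blocks R X f d e2 q A k T tag dd0 k0
    (fun i => let: And3 h _ _ := tagP i in h) (fun i => let: And3 _ h _ := tagP i in h)
    (fun i x xi => let: And3 _ _ h := tagP i in le_trans re (h x xi)) TP n s ys n_gt0.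
  by move=> i j /sep[t tP]; exists t; exact: ltW.
(* A tag of index [n + O] has at least [n + O] points, and no [q :: B y] has more. *)
pose mk := tag (n + O)%N.
have [mkS mkC mkF] := tagP (n + O)%N; rewrite -/mk in mkS mkC mkF.
have Bm y : (size (B y) < size mk)%N.
  have [pre [post [E sz]]] := BO y.
  have sB : (size (q :: B y) <= n + O)%N by rewrite E !size_cat size_traject addnCA leq_add2l.
  apply: leq_trans sB _; rewrite mkS; apply: leq_trans (leq_addl _ _).
  exact: leq_pmull.
have p0 i y : 0 <= pr (mu i) (eta y) by exact: pr_ge0.
have p1 i : \sum_y pr (mu i) (eta y) = 1 by exact: pr_partition1.
have [kk kkP] := choice (fun i => type_approx (p0 i) (p1 i) kap0).
have [C0 C0P] := choice (fun i => permutations_growth (let: And3 h _ _ := kkP i in h) kap0).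
pose Lk i := (\sum_y kk i y * size (q :: B y))%N.
have Lk0 i : (0 < Lk i)%N.
  have [h _ _] := kkP i; apply: leq_trans h _; apply: leq_sum => y _.
  by rewrite leq_pmulr.
(* With letter counts [C * P i * kk i y], the body of class [i] has length [C * P i * Lk i], the
   same product for every [i]. *)
pose P i := (\prod_(i' | i' != i) Lk i')%N.
have P0 i : (0 < P i)%N by apply: prodn_cond_gt0.
pose C := (\max_i C0 i + Num.bound (2 * (size (q :: mk))%:R / kap)).+1.
have [v vP] := choice (fun i => exists_word (fun y => (C * P i) * kk i y)%N).
pose l := ((size mk).+1 + C * \prod_i Lk i)%N.
have vS i : size (v i) = (C * P i * (\sum_y kk i y))%N.
  by rewrite -size_count (eq_bigr _ (fun y _ => vP i y)) big_distrr.
have v0 i : (0 < size (v i))%N.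
  by have [h _ _] := kkP i; rewrite vS !muln_gt0 P0 h.
have vC i : (C <= size (v i))%N.
  by have [h _ _] := kkP i; rewrite vS -mulnA leq_pmulr// muln_gt0 P0 h.
have wl i w : perm_eq w (v i) -> size (tour q mk B w) = l.
  move=> wv; rewrite /= size_cat /l addSn; congr (_ + _).+1.
  rewrite size_flatten_count (eq_bigr (fun y => C * P i * (kk i y * size (q :: B y)))%N); last first.
    by move=> y _; rewrite (permP wv) vP mulnA.
  by rewrite -big_distrr /= -/(Lk i) (bigD1 i)//= -/(P i) -mulnA (mulnC (P i)).
have Cm i : 2 * (size (q :: mk))%:R <= kap * (size (v i) * n)%N%:R.
  have h0 : 0 <= 2 * (size (q :: mk))%:R / kap by rewrite divr_ge0 ?mulr_ge0// ltW.
  rewrite [leRHS]mulrC -ler_pdivrMr//; apply: le_trans (ltW (archi_boundP h0)) _.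
  rewrite ler_nat; apply: leq_trans (_ : C <= _)%N; first by rewrite /C leqW// leq_addl.
  by apply: leq_trans (vC i) _; rewrite leq_pmulr.
have cnt i : \sum_y `|(count_mem y (v i))%:R / (size (v i))%:R - pr (mu i) (eta y)| <= kap.
  have [h1 h2 _] := kkP i; apply: le_trans h2; apply: ler_sum => y _.
  rewrite vP vS !natrM -mulf_div divff ?mul1r//.
  by rewrite mulf_neq0// pnatr_eq0 -lt0n.
(* Stated for any bounded function, so that the zero function gives the length bound alone. *)
have TA (ps : X -> R) (Ps : R) i w : (forall x, `|ps x| <= Ps) -> perm_eq w (v i) ->
    l%:R <= (1 + kap) * (size (v i) * n)%N%:R /\
    `|(\sum_(x <- tour q mk B w) ps x) / l%:R -
      \sum_y pr (mu i) (eta y) * (n%:R^-1 * \sum_(t < n) ps (iter t f (ys y)))| <= 3 * kap * Ps.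
  move=> psP wv.
  have [|||h1 h2] := @tour_average R X ps Ps psP f s n O ys (fun y => q :: B y) (q :: mk) w
    (fun y => pr (mu i) (eta y)) kap n_gt0 _ (ltW kap0) (p0 i) (p1 i) BO _ On.
  - by rewrite (perm_size wv).
  - by rewrite (perm_size wv); under eq_bigr do rewrite (permP wv); exact: cnt.
  - by rewrite (perm_size wv); exact: Cm.
  by rewrite -(wl i w wv); split => //; rewrite -(perm_size wv).
exists r, d, p, q, s, mk, B, v, l; split.
- by split => // i0; exact: le_trans r_eq (far1 i0).
- by split => // x /mkF; exact: le_trans.
- by move=> j jJ x y xy; apply: le_trans th21; apply: d0P => //; exact: lt_trans r_d0.
- move=> i w wv; split; first exact: (wl i).
  move=> j jJ; have [_ h1] := TA (phi j) Phi i w (PhiP j jJ) wv.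
  have h2 : `|\int[mu i]_x phi j x - \sum_y pr (mu i) (eta y) *
      (n%:R^-1 * \sum_(t < n) phi j (iter t f (ys y)))| <= theta / 2.
    apply: (orbit_average hX cf (inv i) (@cphi j) n_gt0 _ peta etaP) => x y xy.
    by apply: d0P => //; exact: le_lt_trans xy rd0.
  rewrite -(subrKA (\sum_y pr (mu i) (eta y) * (n%:R^-1 * \sum_(t < n) phi j (iter t f (ys y))))).
  apply: le_trans (ler_normD _ _) _; rewrite [leRHS]splitr; apply: lerD.
    exact: le_trans h1 kap1.
  by rewrite distrC.
move=> i; set h := fine (metric_entropy (mu i) f).
have l0 : 0 < l%:R :> R by rewrite ltr0n /l addSn.
have lnN0 : 0 <= ln (size (permutations (v i)))%:R :> R.
  rewrite ln_ge0// ler1n lt0n size_eq0; apply/negP => /eqP E.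
  by have := mem_permutations (v i) (v i); rewrite E perm_refl.
(* The upper bound on [l] can be multiplied by [h - eta0] only when that is nonnegative; otherwise
   the claim is immediate. *)
have [hneg|hpos] := ltP (h - eta0) 0.
  by apply: lt_le_trans hneg _; rewrite divr_ge0// ltW.
have norm0 (x : X) : `|0 : R| <= 0 by rewrite normr0.
have [lS _] := TA (fun=> 0) 0 i (v i) norm0 (perm_refl _).
set S := (size (v i))%:R : R; have S0 : 0 < S by rewrite ltr0n.
have nR : 1 <= n%:R :> R by rewrite ler1n.
have [M0' _ kk3] := kkP i.
have g1 : S * (shannon (fun y => (kk i y)%:R / (\sum_y kk i y)%N%:R) - kap) <=
    ln (size (permutations (v i)))%:R.
  apply: (C0P i (C * P i)%N (v i)).
  - apply: leq_trans (leq_bigmax (F := C0) i) _; apply: leq_trans (leq_pmulr _ (P0 i)).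
    by rewrite /C leqW// leq_addr.
  - by rewrite muln_gt0 P0.
  - exact: vP.
have g2 := n0P n n0n s ys eta peta etaP i; rewrite -/h in g2.
rewrite ltr_pdivlMr//; apply: lt_le_trans g1.
have g3 : (h - eta0) * l%:R <= (h - eta0) * ((1 + kap) * (S * n%:R)).
  by rewrite ler_wpM2l// -natrM.
apply: le_lt_trans g3 _.
exact: (rate_bound S0 nR kap0 eta00 (hM i) kap2 kap3 g2 kk3).
Qed.

End HorseshoeData.

Theorem theorem6 (R : realType) (X : pmetricType R) (f : X -> X)
    (phi : nat -> X -> R) (hX : compact [set: X]) (hf : continuous f)
    (hphi : dense_in_C phi) :
  topologically_anosov f -> transitive_on [set: X] f ->
  multi_horseshoe_dense phi f.
Proof.
move=> [infX [g [[_ cg fK gK] [c c0 hc] hs]]] tr m mu _ eta zeta m0 inv eta0 z0.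
have cphi := proj1 hphi; have z2 : 0 < zeta / 2 by rewrite divr_gt0.
have [J [theta [th0 weakP]]] := weak_dist_le hX (@cphi) z2.
have th2 : 0 < theta / 2 by rewrite divr_gt0.
have [r [d [p [q [s [mk [B [v [l [[r0 rc shad pfar] [mC mfar BC Bm Bsep] osc avg ent]]]]]]]]]] :=
  exists_horseshoe_data hX hf cg fK gK c0 hc hs tr infX inv (@cphi) J th2 eta0.
have [N [W [C [Wi WC CP Csize]]]] := exists_word_classes v.
have Wl j : size (tour q mk B (W j)) = l.
  by have [i ij] := WC j; rewrite CP in ij; have [] := avg i _ ij.
pose HS D := horseshoe f g r q mk B l W D.
have Cne i : exists w, w \in C i.
  apply/card_gt0P; apply: leq_trans (Csize i).
  rewrite lt0n size_eq0; apply/negP => /eqP E.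
  by have := mem_permutations (v i) (v i); rewrite E perm_refl.
have subT i : HS (C i) `<=` HS [set: 'I_N]%SET by apply: horseshoe_sub; exact: finset.subsetT.
have cptHS D : compact (HS D).
  exact: (horseshoe_compact hX hf cg hc rc shad mC BC Wl).
have mHS D : measurable (HS D : set (borel X)).
  by apply: closed_borel; apply: compact_closed; [exact: metric_hausdorff|exact: cptHS].
have invHS D : f @` HS D = HS D by exact: horseshoe_invariant.
have sftHS (D : {set 'I_N}) w : w \in D -> conjugate_to_transitive_sft (HS D) f.
  by move=> wD; exact: (horseshoe_sft hX hf cg fK gK hc r0 rc shad mC mfar BC Bm Bsep Wi Wl wD).
pose Iphi (mu : probability (borel X) R) j := \int[mu]_x phi j x.
(* [iota] picks, for each tour, a class containing it. One half of [theta] pays for shadowing, the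
   other for the averages along tours. *)
have approx (D : {set 'I_N}) (iota : 'I_N -> 'I_m) nu : invariant_measures f (HS D) nu ->
    (forall w, w \in D -> w \in C (iota w)) -> exists alpha : 'I_N -> R,
    [/\ forall w, 0 <= alpha w, \sum_w alpha w = 1 &
      forall j, (j < J)%N -> `|Iphi nu j - \sum_w alpha w * Iphi (mu (iota w)) j| <= theta].
  move=> nuD io.
  have [alpha [a0 aD a1 aP]] :=
    horseshoe_measure hX hf cg fK gK hc r0 rc shad mC mfar BC Bm Bsep Wi Wl nuD.
  exists alpha; split => // j jJ.
  have := aP (phi j) (theta / 2) (@cphi j) (osc j jJ); set S := \sum_w _ => h1.
  rewrite -(subrKA S); apply: le_trans (ler_normD _ _) _; rewrite [leRHS]splitr; apply: lerD => //.
  rewrite -sumrB; apply: le_trans (ler_norm_sum _ _ _) _.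
  rewrite -[leRHS]mul1r -[X in _ <= X * _]a1 mulr_suml; apply: ler_sum => w _.
  rewrite -mulrBr normrM (ger0_norm (a0 w)).
  have [wD|wD] := boolP (w \in D); last by rewrite (aD w wD) !mul0r.
  rewrite ler_wpM2l//; have := io w wD; rewrite CP => /avg[_]; exact.
have [nu0 nu0P] := choice (fun i =>
  let: ex_intro _ wi := Cne i in horseshoe_periodic fK gK hc rc shad mC BC Wl wi).
have approx1 i nu : invariant_measures f (HS (C i)) nu ->
    forall j, (j < J)%N -> `|Iphi nu j - Iphi (mu i) j| <= theta.
  move=> nuC j jJ; have [alpha [_ a1 aP]] := approx (C i) (fun=> i) nu nuC (fun w h => h).
  by have := aP j jJ; rewrite -mulr_suml a1 mul1r.
exists (fun i => HS (C i)), (HS [set: 'I_N]%SET); split.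
- by move=> i; split.
- by [].
- exact: subT.
- split; first by [].
  by move=> /(_ p Logic.I); apply: horseshoe_far.
move=> i; have [w wi] := Cne i; split.
- by split; [exact: (sftHS _ w)|apply: (sftHS _ w); rewrite inE].
- have fin := metric_entropy_fin hX hf cg fK gK c0 hc (inv i).
  have C0 : (0 < #|C i|)%N by apply/card_gt0P; exists w.
  rewrite -(fineK fin) -EFinB.
  apply: lt_le_trans (horseshoe_htop r0 rc shad mC BC Bsep Wi Wl C0); rewrite lte_fin.
  apply: lt_le_trans (ent i) _; rewrite ler_wpM2r ?invr_ge0// ler_ln ?posrE ?ltr0n//.
    by rewrite ler_nat.
  rewrite lt0n size_eq0; apply/negP => /eqP E.
  by have := mem_permutations (v i) (v i); rewrite E perm_refl.
split; apply: (@le_lt_trans _ _ (zeta / 2)%:E).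
- apply: hausdorff_dist_le.
    move=> xi [t [t01 t1 xiE]].
    have t0 i' : 0 <= t i' by have /andP[] := t01 i'.
    (* The same weights applied to the reference measures [nu0] on the small horseshoes give a
       measure on the large one. *)
    have [tau tauE] := exists_mixture nu0 t0 t1.
    exists tau.
      split => [A mA|].
        rewrite !tauE; apply: eq_bigr => i' _; congr (_ * _)%E.
        by have [inv0 _] := nu0P i'; exact: inv0.
      rewrite tauE (eq_bigr (fun i' => (t i')%:E)) => [|i' _]; first by rewrite sumEFin t1.
      have [_ n1] := nu0P i'; rewrite (_ : nu0 i' _ = 1%E) ?mule1//.
      apply/eqP; rewrite eq_le probability_le1//= -[leLHS]n1.
      by apply: le_measure; rewrite ?inE//; exact: subT.
    apply: weakP => j jJ.
    rewrite (Rintegral_lincomb hX (@cphi j) t0 t1 xiE).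
    rewrite (Rintegral_lincomb hX (@cphi j) t0 t1 (fun A _ => tauE A)).
    rewrite -sumrB; apply: le_trans (ler_norm_sum _ _ _) _.
    rewrite -[leRHS]mul1r -[X in _ <= X * _]t1 mulr_suml; apply: ler_sum => i' _.
    rewrite -mulrBr normrM (ger0_norm (t0 i')) ler_wpM2l// distrC.
    exact: approx1 (nu0P i') j jJ.
  move=> tau tauL; have [iota ioP] := choice WC.
  have [alpha [a0 a1 aP]] := approx _ iota tau tauL (fun w _ => ioP w).
  (* The weights of all tours assigned to one class add up to the coefficient of its measure. *)
  pose t i' := \sum_(w | iota w == i') alpha w.
  have t0 i' : 0 <= t i' by apply: sumr_ge0.
  have t1 : \sum_i' t i' = 1 by rewrite -a1 [RHS](partition_big iota xpredT).
  have [xi xiE] := exists_mixture mu t0 t1.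
  exists xi.
    exists t; split => // i'; rewrite t0 /= -t1 (bigD1 i')//= lerDl.
    exact: sumr_ge0.
  apply: weakP => j jJ.
  rewrite (Rintegral_lincomb hX (@cphi j) t0 t1 (fun A _ => xiE A)).
  have -> : \sum_i t i * (\int[mu i]_x phi j x) = \sum_w alpha w * Iphi (mu (iota w)) j.
    rewrite [RHS](partition_big iota xpredT)//=; apply: eq_bigr => i' _.
    by rewrite mulr_suml; apply: eq_bigr => w' /eqP->.
  exact: aP.
- by rewrite lte_fin; lra.
- apply: hausdorff_dist_le.
    move=> _ ->; exists (nu0 i); first exact: nu0P.
    by apply: weakP => j jJ; rewrite distrC; exact: approx1 (nu0P i) j jJ.
  move=> tau tauC; exists (mu i) => //.
  by apply: weakP => j jJ; exact: approx1 tauC j jJ.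
- by rewrite lte_fin; lra.
Qed.
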